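(* Regard $\mathcal S(N,\psi\backslash\mathrm{PGL}_2)_{N,\psi}$ and $\mathcal S_c(\Omega_1)_{\mathrm{Spin}_9}$ as spaces of functions on $F^\times$ and $F^\heartsuit=F\setminus\{0,1\}$ respectively (via the maps $\mathcal I$ and $\mathcal I'$ of the context). Then the transfer map $t_\psi:\mathcal S_c(\Omega_1)_{\mathrm{Spin}_9}\to\mathcal S(N,\psi\backslash\mathrm{PGL}_2)_{N,\psi}$ is given explicitly by $$t_\psi(\phi)(a)=|a|^{-3}\int_F\int_F\phi(t)\,\psi(tk^{-1})\,dt\;\psi(ka^{-1})\,|k|^{-4}\,dk\qquad(a\in F^\times),$$ in other words by an iteration of two Fourier transforms.
   Context: **Groups and spaces.** $F$ is a nonarchimedean local field of characteristic $0$ with ring of integers $\mathcal O_F$, uniformizer $\varpi$, absolute value $|\cdot|$; $\psi$ is a nontrivial unitary additive character of $F$ with conductor $\mathcal O_F$; $dx$ is the self-dual Haar measure on $F$ and $d^\times x=dx/|x|$. $\mathbb O$ is the split octonion algebra over $F$; $J$ is the 27-dimensional exceptional Jordan algebra of $3\times3$ Hermitian matrices over $\mathbb O$, with product $X\circ Y=\frac12(XY+YX)$, trace $\mathrm{Tr}$, pairing $\langle X,Y\rangle=\mathrm{Tr}(X\circ Y)$, and quadratic adjoint $X\mapsto X^\#$. $\Omega=\{X\in J:X\neq0,\ X^\#=0\}$ (rank-1 elements), $\Omega_a\subset\Omega$ those of trace $a$, $e=\mathrm{diag}(1,0,0)\in\Omega_1$. $F_4=\mathrm{Aut}(J,\circ)$,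 $\mathrm{Spin}_9$ is the stabiliser of $e$ in $F_4$, and $\mathrm{Spin}_9\backslash F_4\cong\Omega_1$. $|\eta|$ is the fixed measure on $\Omega$ (quasi-invariant under the group of linear maps preserving the cubic norm of $J$ up to scaling, with $|\eta(av)|=|a|^{12}|\eta(v)|$), and $|\omega_a|$ ($a\neq0$) the $F_4$-invariant measures on $\Omega_a$ with $\int_\Omega f|\eta|=\int_{F^\times}(\int_{\Omega_a}f|\omega_a|)\,da$. $\mathcal S_c$ denotes locally constant compactly supported functions. **Minimal representation.** In $\mathrm{PGL}_2$ let $t(a)=\begin{pmatrix}a&0\\0&1\end{pmatrix}$, $n(b)=\begin{pmatrix}1&b\\0&1\end{pmatrix}$, $w=\begin{pmatrix}0&1\\1&0\end{pmatrix}$, $N=\{n(b)\}$, $\psi(n(b))=\psi(b)$. The minimal representation $\Pi_\psi$ of $E_7$ is realised on $L^2(\Omega)$, and $\mathrm{PGL}_2\times F_4\subset E_7$ acts by $(hf)(v)=f(h^{-1}v)$ for $h\in F_4$; $(t(a)f)(v)=|a|^6f(av)$; $(n(b)f)(v)=\psi(b\,\mathrm{Tr}(v))f(v)$; $(wf)(v)=\int_{F^\times}\int_\Omega f(x)\psi(r\langle v,x\rangle)|\eta(x)|\,\psi(r^{-1})|r|^3\,d^\times r$. **Transfer map.** $p(f)=(g\mapsto(g\cdot f)(e))$ for $f\in\mathcal S_c(\Omega)$, with image denoted $\mathcal S(N,\psi\backslash\mathrm{PGL}_2)$; $q:\mathcal S_c(\Omega)\to\mathcal S_c(\Omega_1)$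 is restriction. The subscripts $(N,\psi)$ and $\mathrm{Spin}_9$ denote coinvariants. The space $\mathcal S(N,\psi\backslash\mathrm{PGL}_2)_{N,\psi}$ is regarded as a space of functions on $F^\times$ via the orbital integral $$\mathcal I(p(f))(a)=\lim_{n\to\infty}\int_{\varpi^{-n}\mathcal O_F}(wt(a)n(b)\cdot f)(e)\,\overline{\psi(b)}\,db,$$ and $\mathcal S_c(\Omega_1)_{\mathrm{Spin}_9}$ as a space of functions on $F^\heartsuit$ via $\mathcal I'$, the integration over the fibres of $r:\Omega_1\to F$, $y\mapsto\langle e,y\rangle$, normalised by $\int_{\Omega_1}\phi\,|\omega_1|=\int_F\mathcal I'(\phi)(t)\,dt$. The transfer map is $t_\psi(\mathcal I'(q(f)))=\mathcal I(p(f))$ for $f\in\mathcal S_c(\Omega)$. The double integral in the formula is an iterated integral (inner integral over $t$ first). *)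

(* Defs.v *)
From HB Require Import structures.
From mathcomp Require Import all_boot all_order all_algebra.
From mathcomp Require Import all_classical all_reals all_analysis.
From mathcomp Require Export complex.
From mathcomp Require Import ring.

Set Implicit Arguments.
Unset Strict Implicit.
Unset Printing Implicit Defensive.

Import Order.TTheory GRing.Theory Num.Theory numFieldNormedType.Exports.

Local Open Scope classical_set_scope.
Local Open Scope ring_scope.

(** * Nonarchimedean local fields *)

Definition is_uniformizer (R : realType) (F : fieldType) (v : F -> R) (pi : F) :=
  0 < v pi < 1 /\ forall x, v x < 1 -> v x <= v pi.

(* [s] represents each class of the residue field exactly once. *)
Definition is_residue_system (R : realType) (F : fieldType) (v : F -> R)
    (s : seq F) :=
  [/\ uniq s,
      {in s, forall x, v x <= 1},
      {in s &, forall x y, v (x - y) < 1 -> x = y} &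
      forall x, v x <= 1 -> exists2 y, y \in s & v (x - y) < 1].

(* A field complete for a discrete valuation with finite residue field. In the
   last axiom the absolute value is moreover the normalised one: a uniformizer
   has absolute value 1/q, with q the order of the residue field. *)
HB.mixin Record isNonarchLocal (R : realType) F & GRing.Field F := {
  vabs : F -> R ;
  vabs_ge0 : forall x, 0 <= vabs x ;
  vabs_eq0 : forall x, vabs x = 0 <-> x = 0 ;
  vabsM : forall x y, vabs (x * y) = vabs x * vabs y ;
  vabsD : forall x y, vabs (x + y) <= Num.max (vabs x) (vabs y) ;
  vabs_complete : forall u : nat -> F,
    (forall e, 0 < e -> exists N, forall m n, (N <= m)%N -> (N <= n)%N ->
       vabs (u m - u n) < e) ->
    exists l, forall e, 0 < e -> exists N, forall n, (N <= n)%N ->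
      vabs (u n - l) < e ;
  vabs_normalized : exists pi s,
    [/\ is_uniformizer vabs pi, is_residue_system vabs s
      & vabs pi = (size s)%:R^-1]
}.

#[short(type="nonarchLocalFieldType")]
HB.structure Definition NonarchLocalField (R : realType) :=
  { F of GRing.Field F & isNonarchLocal R F }.

Section metric.
Context (R : realType) (F : nonarchLocalFieldType R).

Let vdist (x y : F) : R := vabs (x - y).

Lemma vabs0 : vabs (0 : F) = 0 :> R.
Proof. exact/vabs_eq0. Qed.

Lemma vabs1 : vabs (1 : F) = 1 :> R.
Proof.
have h : vabs (1 : F) != 0 :> R by apply/eqP => /vabs_eq0/eqP; rewrite oner_eq0.
by apply: (mulfI h); rewrite -vabsM !mulr1.
Qed.

Lemma vabsN (x : F) : vabs (- x) = vabs x :> R.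
Proof.
suff h : vabs (-1 : F) = 1 :> R by rewrite -mulN1r vabsM h mul1r.
by apply/eqP; rewrite -(@eqrXn2 _ 2) ?vabs_ge0// expr2 -vabsM mulrNN mulr1 vabs1 expr1n.
Qed.

Let vdistxx x : vdist x x = 0.
Proof. by rewrite /vdist subrr vabs0. Qed.

Let vdist_positivity x y : vdist x y = 0 -> x = y.
Proof. by move=> /vabs_eq0/subr0_eq. Qed.

Let vdist_sym x y : vdist x y = vdist y x.
Proof. by rewrite /vdist -vabsN opprB. Qed.

Let vdist_triangle y x z : vdist x z <= vdist x y + vdist y z.
Proof.
rewrite /vdist -(subrK y x) -addrA addrK; apply: (le_trans (vabsD _ _)).
by rewrite ge_max lerDl lerDr !vabs_ge0.
Qed.

#[non_forgetful_inheritance]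
HB.instance Definition _ :=
  isMetric.Build R F vdistxx vdist_positivity vdist_sym vdist_triangle.

#[non_forgetful_inheritance]
HB.instance Definition _ := isPointed.Build F 0.

End metric.

HB.instance Definition _ (T U : ptopologicalType) := Pointed.on (T * U)%type.

Arguments vabs {R s}.

(** * Complex-valued integration and Schwartz functions *)

(* The complex numbers over [R]; the ascription to [numFieldType] gives access
   to their topology. *)
Definition cplx (R : realType) : numFieldType := R[i].

Definition borel (T : ptopologicalType) := g_sigma_algebraType (@open T).

Section integration.
Context (R : realType) (d : measure_display) (T : measurableType d).
Variables (mu : {measure set T -> \bar R}) (D : set T) (f : T -> cplx R).

Definition cintegrable :=
  mu.-integrable D (EFin \o (fun x => complex.Re (f x))) /\
  mu.-integrable D (EFin \o (fun x => complex.Im (f x))).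

Definition cint : cplx R :=
  Complex (Rintegral mu D (fun x => complex.Re (f x)))
          (Rintegral mu D (fun x => complex.Im (f x))).

End integration.

(* S_c(A): locally constant functions with compact support on the subspace A,
   represented by their extension by zero to the ambient space. *)
Definition Sc (R : realType) (T : topologicalType) (A : set T)
    : set (T -> cplx R) :=
  [set f | [/\ forall x, ~ A x -> f x = 0,
               exists K, [/\ compact K, K `<=` A & forall x, ~ K x -> f x = 0] &
               forall x, A x -> \forall y \near x, A y -> f y = f x]].

Section characters_and_haar.
Context (R : realType) (F : nonarchLocalFieldType R).

Definition ring_of_integers : set F := [set x | vabs x <= 1].

Record is_unitary_char (psi : F -> cplx R) : Prop := {
  psiD : forall x y, psi (x + y) = psi x * psi y ;
  psi_unitary : forall x, `|psi x| = 1 ;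
  psi_continuous : continuous psi ;
  psi_nontrivial : exists x, psi x != 1 }.

Definition has_conductor_O (psi : F -> cplx R) :=
  forall x, (forall y, ring_of_integers y -> psi (x * y) = 1)
            <-> ring_of_integers x.

Record is_haar (dx : {measure set (borel F) -> \bar R}) : Prop := {
  haar_translation : forall (a : F) (A : set (borel F)), measurable A ->
    dx [set a + x | x in (A : set F)] = dx A ;
  haar_compact : forall A : set F, compact A -> (dx A < +oo)%E ;
  haar_open : forall A : set F, open A -> A !=set0 -> (0 < dx A)%E }.

Definition fourier (dx : {measure set (borel F) -> \bar R})
    (psi : F -> cplx R) (f : F -> cplx R) (y : F) : cplx R :=
  cint dx setT (fun x : F => f x * psi (x * y)).

Definition is_selfdual_haar (dx : {measure set (borel F) -> \bar R})
    (psi : F -> cplx R) :=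
  is_haar dx /\
  forall f : F -> cplx R, Sc setT f ->
    forall x, fourier dx psi (fourier dx psi f) x = f (- x).

End characters_and_haar.

(** * Split octonions and the exceptional Jordan algebra *)

(* Cayley-Dickson doubling of the split quaternion algebra M_2(F), on which
   conjugation is the adjugate; the norm form is \det x.1 - \det x.2. *)
Notation oct F := ('M[F]_2 * 'M[F]_2)%type.

Section jordan_algebra.
Context {F : fieldType}.

Definition oct_one : oct F := (1%:M, 0).

Definition oct_mul (x y : oct F) : oct F :=
  (x.1 *m y.1 + \adj y.2 *m x.2, y.2 *m x.1 + x.2 *m \adj y.1).

Definition oct_conj (x : oct F) : oct F := (\adj x.1, - x.2).

(* Half the reduced trace: the coordinate along [oct_one]. *)
Definition oct_re (x : oct F) : F := 2%:R^-1 * \tr x.1.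

(* Matrices over the nonassociative algebra [oct F]: the ring operations of the
   library do not apply. *)
Notation omx := 'M[oct F]_3.

Definition omx_mul (X Y : omx) : omx :=
  \matrix_(i, j) \sum_k oct_mul (X i k) (Y k j).

Definition omx_scale (a : F) (X : omx) : omx :=
  \matrix_(i, j) (a *: (X i j).1, a *: (X i j).2).

Definition omx_one : omx := \matrix_(i, j) (if i == j then oct_one else 0).

Definition jordan : set omx := [set X | forall i j, X i j = oct_conj (X j i)].

Definition jprod (X Y : omx) : omx :=
  omx_scale 2%:R^-1 (omx_mul X Y + omx_mul Y X).

(* Diagonal entries of an element of [jordan] are multiples of [oct_one]. *)
Definition jtr (X : omx) : F := \sum_i oct_re (X i i).

Definition jpair (X Y : omx) : F := jtr (jprod X Y).

Definition jadj (X : omx) : omx :=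
  jprod X X - omx_scale (jtr X) X
  + omx_scale (2%:R^-1 * (jtr X ^+ 2 - jtr (jprod X X))) omx_one.

(* The cubic norm, from X o X^# = N(X) 1. *)
Definition jnorm (X : omx) : F := 3%:R^-1 * jpair X (jadj X).

Definition Omega : set omx := [set X | [/\ jordan X, X != 0 & jadj X = 0]].

Definition Omega_ (a : F) : set omx := [set X | Omega X /\ jtr X = a].

Definition je : omx :=
  \matrix_(i, j) (if (i == 0) && (j == 0) then oct_one else 0).

(* Groups of linear maps of J are given as self-maps of the ambient matrix
   space; only the restriction to [jordan] is relevant. *)
Definition jlinear_aut (g : omx -> omx) :=
  set_bij jordan jordan g /\
  forall a X Y, jordan X -> jordan Y ->
    g (omx_scale a X + Y) = omx_scale a (g X) + g Y.

Definition norm_similitude (g : omx -> omx) :=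
  jlinear_aut g /\
  exists2 c : F, c != 0 & forall X, jordan X -> jnorm (g X) = c * jnorm X.

Definition F4 (g : omx -> omx) :=
  jlinear_aut g /\
  forall X Y, jordan X -> jordan Y -> g (jprod X Y) = jprod (g X) (g Y).

Definition Spin9 (g : omx -> omx) := F4 g /\ g je = je.

(* The fibre over t of r : y |-> <e, y> on Omega_1. *)
Definition fibre (t : F) : set omx := [set y | Omega_ 1 y /\ jpair je y = t].

End jordan_algebra.

Arguments Omega F : clear implicits.
Arguments jordan F : clear implicits.
Arguments je F : clear implicits.

Notation omx F := 'M[oct F]_3.



(** * Measures on Omega, on the Omega_a, and on the fibres of r *)

Section measures.
Context (R : realType) (F : nonarchLocalFieldType R).
Variable dx : {measure set (borel F) -> \bar R}.

Let J := borel (omx F).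
Let bmeasure := {measure set J -> \bar R}.

Definition radon_on (A : set (omx F)) (mu : bmeasure) :=
  mu (~` A) = 0%E /\
  forall K : set (omx F), compact K -> K `<=` A -> (mu K < +oo)%E.

(* Quasi-invariance of a density: g multiplies it by a positive constant. *)
Record is_eta (eta : bmeasure) : Prop := {
  eta_radon : radon_on (Omega F) eta ;
  eta_neq0 : (0 < eta (Omega F))%E ;
  eta_quasi_invariant : forall g : omx F -> omx F, norm_similitude g ->
    exists2 c : R, 0 < c & forall A : set J, measurable A -> A `<=` Omega F ->
      eta (g @` A) = (c%:E * eta A)%E ;
  eta_homogeneous : forall a : F, a != 0 -> forall A : set J, measurable A ->
    eta (omx_scale a @` A) = ((vabs a ^+ 12)%:E * eta A)%E }.

(* The disintegration formula determines the omega_a only for almost every a;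
   continuity in a (the measures come from an algebraic family of forms) pins
   down every one of them, in particular omega_1. *)
Record is_omega (eta : bmeasure) (omega : F -> bmeasure) : Prop := {
  omega_radon : forall a : F, a != 0 -> radon_on (Omega_ a) (omega a) ;
  omega_invariant : forall a : F, a != 0 -> forall g : omx F -> omx F, F4 g ->
    forall A : set J, measurable A -> A `<=` Omega_ a ->
      omega a (g @` A) = omega a A ;
  omega_continuous : forall f : omx F -> cplx R, Sc (Omega F) f ->
    forall a0 : F, a0 != 0 ->
      {for a0, continuous (fun a : F => cint (omega a) (Omega_ a) f)} ;
  omega_integrable : forall f : omx F -> cplx R, Sc (Omega F) f ->
    cintegrable dx [set~ 0] (fun a : F => cint (omega a) (Omega_ a) f) ;
  omega_disintegration : forall f : omx F -> cplx R, Sc (Omega F) f ->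
    cint eta (Omega F) f =
    cint dx [set~ 0] (fun a : F => cint (omega a) (Omega_ a) f) }.

(* I'(phi), as a function on F \ {0, 1} extended by zero. *)
Definition fibre_integral (nu : F -> bmeasure) (phi : omx F -> cplx R) (t : F)
    : cplx R :=
  if (t != 0) && (t != 1) then cint (nu t) (fibre t) phi else 0.

Record is_fibre_measure (omega1 : bmeasure) (nu : F -> bmeasure) : Prop := {
  nu_radon : forall t : F, t != 0 -> t != 1 -> radon_on (fibre t) (nu t) ;
  nu_invariant : forall t : F, t != 0 -> t != 1 ->
    forall g : omx F -> omx F, Spin9 g ->
    forall A : set J, measurable A -> A `<=` fibre t ->
      nu t (g @` A) = nu t A ;
  nu_continuous : forall phi : omx F -> cplx R, Sc (Omega_ (1 : F)) phi ->
    forall t0 : F, t0 != 0 -> t0 != 1 ->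
      {for t0, continuous (fibre_integral nu phi)} ;
  nu_integrable : forall phi : omx F -> cplx R, Sc (Omega_ (1 : F)) phi ->
    cintegrable dx setT (fibre_integral nu phi) ;
  nu_normalised : forall phi : omx F -> cplx R, Sc (Omega_ (1 : F)) phi ->
    cint omega1 (Omega_ (1 : F)) phi = cint dx setT (fibre_integral nu phi) }.

End measures.

(** * The action of PGL_2 and the transfer map *)

Section transfer.
Context (R : realType) (F : nonarchLocalFieldType R).
Variables (psi : F -> cplx R) (dx : {measure set (borel F) -> \bar R}).
Variable eta : {measure set (borel (omx F)) -> \bar R}.

Definition mx2 (a b c d : F) : 'M[F]_2 :=
  \matrix_(i, j) (if i == 0 then if j == 0 then a else b
                  else if j == 0 then c else d).

Definition tmx (a : F) : 'M[F]_2 := mx2 a 0 0 1.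
Definition nmx (b : F) : 'M[F]_2 := mx2 1 b 0 1.
Definition wmx : 'M[F]_2 := mx2 0 1 1 0.

Definition act_t (a : F) (f : omx F -> cplx R) (v : omx F) : cplx R :=
  ((vabs a ^+ 6)%:C)%C * f (omx_scale a v).

Definition act_n (b : F) (f : omx F -> cplx R) (v : omx F) : cplx R :=
  psi (b * jtr v) * f v.

Definition act_w (f : omx F -> cplx R) (v : omx F) : cplx R :=
  cint dx [set~ 0] (fun r : F =>
    cint eta (Omega F) (fun x : omx F => f x * psi (r * jpair v x))
    * psi r^-1 * ((vabs r ^+ 3)%:C)%C * ((vabs r)^-1%:C)%C).

(* g . f for g in PGL_2, given by a representative in GL_2, through the Bruhat
   decomposition g = n(x) t(a) or g = n(x) w t(a) n(b) up to scalars; see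
   [bruhat_small] and [bruhat_big]. *)
Definition act (g : 'M[F]_2) (f : omx F -> cplx R) : omx F -> cplx R :=
  if g 1 0 == 0 then act_n (g 0 1 / g 1 1) (act_t (g 0 0 / g 1 1) f)
  else act_n (g 0 0 / g 1 0)
         (act_w (act_t (- (g 1 0 ^+ 2) / \det g) (act_n (g 1 1 / g 1 0) f))).

(* p, whose values are functions on PGL_2. *)
Definition whittaker (f : omx F -> cplx R) (g : 'M[F]_2) : cplx R := act g f (je F).

(* S(N,psi\PGL_2) *)
Definition S_whittaker : set ('M[F]_2 -> cplx R) := whittaker @` Sc (Omega F).

(* I, as a function on F^x extended by zero. *)
Definition orbital_integral (pi : F) (h : 'M[F]_2 -> cplx R) (a : F) : cplx R :=
  if a == 0 then 0
  else lim ((fun n : nat =>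
         cint dx [set pi ^- n * y | y in @ring_of_integers R F]
           (fun b : F => h (wmx *m tmx a *m nmx b) * conjc (psi b))) @ \oo).

(* The coinvariants S(N,psi\PGL_2)_{N,psi} as functions on F^x, via I. *)
Definition S_N_psi (pi : F) : set (F -> cplx R) :=
  orbital_integral pi @` S_whittaker.

(* The coinvariants S_c(Omega_1)_{Spin_9} as functions on F \ {0, 1}, via I'. *)
Definition S_Spin9 (nu : F -> {measure set (borel (omx F)) -> \bar R})
    : set (F -> cplx R) :=
  fibre_integral nu @` Sc (Omega_ (1 : F)).

(* q *)
Definition restr1 (f : omx F -> cplx R) : omx F -> cplx R :=
  patch (fun=> 0) (Omega_ (1 : F)) f.

Definition is_transfer (pi : F)
    (nu : F -> {measure set (borel (omx F)) -> \bar R})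
    (tpsi : (F -> cplx R) -> (F -> cplx R)) :=
  (forall phi, S_Spin9 nu phi -> S_N_psi pi (tpsi phi)) /\
  forall f, Sc (Omega F) f ->
    tpsi (fibre_integral nu (restr1 f)) = orbital_integral pi (whittaker f).

Lemma mul_mx2 a b c d a' b' c' d' :
  mx2 a b c d *m mx2 a' b' c' d' =
  mx2 (a * a' + b * c') (a * b' + b * d') (c * a' + d * c') (c * b' + d * d').
Proof.
apply/matrixP => i j; rewrite !mxE !big_ord_recl big_ord0 !mxE /= addr0.
by case: ifP => _; case: ifP.
Qed.

Lemma mx2E (g : 'M[F]_2) : g = mx2 (g 0 0) (g 0 1) (g 1 0) (g 1 1).
Proof.
apply/matrixP => i j; rewrite !mxE.
by case: i => [[|[]] // ?]; case: j => [[|[]] // ?] /=; congr (g _ _); exact/val_inj.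
Qed.

Lemma det_mx22 (g : 'M[F]_2) : \det g = g 0 0 * g 1 1 - g 0 1 * g 1 0.
Proof.
rewrite (expand_det_row _ ord0) !big_ord_recl big_ord0 addr0 /cofactor.
rewrite !det_mx11 !mxE expr0 expr1 mul1r mulN1r mulrN.
by congr (_ * g _ _ - g _ _ * g _ _); exact/val_inj.
Qed.

Lemma bruhat_small (g : 'M[F]_2) : g 1 1 != 0 -> g 1 0 = 0 ->
  g = g 1 1 *: (nmx (g 0 1 / g 1 1) *m tmx (g 0 0 / g 1 1)).
Proof.
move=> h h0; rewrite mul_mx2 {1}[g]mx2E h0; apply/matrixP => i j; rewrite !mxE.
by case: ifP => _; case: ifP => _; field.
Qed.

Lemma bruhat_big (g : 'M[F]_2) : \det g != 0 -> g 1 0 != 0 ->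
  g = (- \det g / g 1 0) *: (nmx (g 0 0 / g 1 0) *m
    (wmx *m tmx (- (g 1 0 ^+ 2) / \det g) *m nmx (g 1 1 / g 1 0))).
Proof.
move=> hd h; rewrite !mul_mx2 {1}[g]mx2E.
apply/matrixP => i j; rewrite !mxE; move: hd; rewrite det_mx22 => hd.
by case: ifP => _; case: ifP => _; field; rewrite h hd.
Qed.

(* The group element of the orbital integral acts through the given formulas. *)
Lemma act_wtn (hpsi : is_unitary_char psi) (a b : F) f : a != 0 ->
  act (wmx *m tmx a *m nmx b) f = act_w (act_t a (act_n b f)).
Proof.
move=> a0; rewrite !mul_mx2 /act det_mx22 !mxE /=.
rewrite !(mul0r, mul1r, mulr0, add0r, addr0, mulr1) (negPf a0).
have -> : - a ^+ 2 / - a = a by rewrite invrN mulrNN expr2 mulfK.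
rewrite [a * b]mulrC mulfK//; apply/funext => v; rewrite /act_n mul0r.
have h0 : psi 0 != 0.
  by apply/eqP => h; move: (psi_unitary hpsi 0) => /eqP; rewrite h normr0 eq_sym oner_eq0.
suff -> : psi 0 = 1 by rewrite mul1r.
by apply: (mulfI h0); rewrite -(psiD hpsi) addr0 mulr1.
Qed.

End transfer.

(* Main.v *)
Require Import Defs.
From HB Require Import structures.
From mathcomp Require Import all_boot all_order all_algebra.
From mathcomp Require Import all_classical all_reals all_analysis.
From mathcomp Require Import measurable_realfun ring zify.

Set Implicit Arguments.
Unset Strict Implicit.
Unset Printing Implicit Defensive.

Import Order.TTheory GRing.Theory Num.Theory numFieldNormedType.Exports.

Local Open Scope classical_set_scope.
Local Open Scope ring_scope.

(* For f in S_c(Omega), let W(s) be the integral of f(x) psi(s x_11) over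
   Omega_1 and H_b(s) that of f(x) psi(b Tr x) psi(s x_11) over Omega, where
   x_11 = <e, x>. Disintegration over the fibres of r shows that W is the
   Fourier transform of I'(q f), and the homogeneity of eta gives
     (w t(a) n(b) f)(e) = |a|^-6 int H_b(r / a) psi(1 / r) |r|^2 dr.
   On a ball of radius |pi|^-n the integral over b is a finite sum of additive
   characters, evaluated at Tr x - 1: it replaces H_b by the mean of the slices
   Tr x = u of Omega over the ball of radius |pi|^n around u = 1, which by
   homogeneity is W as soon as n is large with respect to s. Dominated
   convergence and the substitution r = a / k then yield the two Fourier
   transforms.

   Domination rests on the bounds |H_b(s)|, |W(s)| <= C |s|^-4, which come from
   the action of F_4. For an isotropic octonion a, the exponential of the
   derivation with a in position (1,2) shifts x_11 by t <a, x_12>; averaging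
   over small t localises the integral to |<a, x_12>| <= c / |s|. Doing so for
   the four basis vectors a of a maximal isotropic subspace leaves a set of mass
   O(|s|^-4) where x_11 and x_22 are far apart, since the exponentials attached
   to the dual basis have disjoint translates of it. Permutations of the three
   indices and exponentials reduce the whole of Omega to this situation, as no
   scalar matrix lies in Omega. *)

(** * Absolute value *)

(** The exponent 4 decides convergence: [w] carries the weight |r|^3 d^x r = |r|^2 dr, so the bound
    |s|^-4 leaves |r|^-2, which is integrable at infinity. It is half the dimension of the
    octonions, the dimension of a maximal isotropic subspace. Fubini's theorem is never applied to b
    and r. On a given ball the integrand is constant in b modulo a fixed lattice, so exchanging the
    two integrals is linearity over a finite sum, once every summand is integrable in r; the decay
    for [eta] serves this purpose, the decay for [omega 1] gives the majorant. The measures are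
    known through axioms only. Quasi-invariance of [eta] leaves an unknown constant, so its exact
    invariance is drawn from that of the [omega a]. Disintegration sees a slice only for almost
    every trace, and continuity in the trace recovers its value at each point. The slice of f(x)
    psi(s x_11) at a trace u close to 1 is W(s u), with |u| = 1. For fixed s and u close enough to 1
    this is W(s), which gives the limit; for all s at once, |s u| = |s| gives a bound independent of
    n. *)

Section local_field.
Context (R : realType) (F : nonarchLocalFieldType R).
Implicit Types x y z c d : F.

Lemma vabs_gt0 x : (0 < vabs x) = (x != 0).
Proof.
rewrite lt0r vabs_ge0 andbT; apply/negP/negP => h; apply: contra_not h.
  by move=> /eqP ->; rewrite vabs0 eqxx.
by move=> /eqP/vabs_eq0 ->; rewrite eqxx.
Qed.

Lemma vabsV x : vabs x^-1 = (vabs x)^-1.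
Proof.
have [->|x0] := eqVneq x 0; first by rewrite invr0 vabs0 invr0.
have h : vabs x != 0 by rewrite gt_eqF// vabs_gt0.
by apply: (mulfI h); rewrite -vabsM !divff// vabs1.
Qed.

Lemma vabs_div x y : vabs (x / y) = vabs x / vabs y.
Proof. by rewrite vabsM vabsV. Qed.

Lemma vabsX x n : vabs (x ^+ n) = vabs x ^+ n.
Proof. by elim: n => [|n ih]; rewrite ?expr0 ?vabs1// !exprS vabsM ih. Qed.

Lemma vabsBC x y : vabs (x - y) = vabs (y - x).
Proof. by rewrite -vabsN opprB. Qed.

Lemma vabsD_le x y (e : R) : vabs x <= e -> vabs y <= e -> vabs (x + y) <= e.
Proof. by move=> hx hy; apply: (le_trans (vabsD _ _)); rewrite ge_max hx hy. Qed.

Lemma vabsB_le x y (e : R) : vabs x <= e -> vabs y <= e -> vabs (x - y) <= e.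
Proof. by move=> hx hy; apply: vabsD_le => //; rewrite vabsN. Qed.

Lemma vabsD_lt x y (e : R) : vabs x < e -> vabs y < e -> vabs (x + y) < e.
Proof. by move=> hx hy; apply: (le_lt_trans (vabsD _ _)); rewrite gt_max hx hy. Qed.

Lemma vabsB_trans y x z (e : R) :
  vabs (x - y) <= e -> vabs (y - z) <= e -> vabs (x - z) <= e.
Proof. by move=> h1 h2; rewrite -(subrK y x) -addrA; exact: vabsD_le. Qed.

Lemma vabsDr x y : vabs x < vabs y -> vabs (x + y) = vabs y.
Proof.
move=> h; apply/eqP; rewrite eq_le vabsD_le// ?(ltW h)//=.
rewrite leNgt; apply/negP => h2.
have := vabsD_lt h2 (e := vabs y) (x := x + y) (y := - x).
by rewrite vabsN addrAC subrr add0r ltxx => /(_ h).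
Qed.

Lemma uniformizer_neq0 pi : is_uniformizer (@vabs R F) pi -> pi != 0.
Proof. by case=> /andP[]; rewrite vabs_gt0. Qed.

Lemma exists_residues : exists (pi : F) (s : seq F),
  [/\ is_uniformizer (@vabs R F) pi, is_residue_system (@vabs R F) s
    & vabs pi = (size s)%:R^-1 :> R].
Proof. exact: vabs_normalized. Qed.

Lemma exists_uniformizer : exists pi : F, is_uniformizer (@vabs R F) pi.
Proof. by have [pi [s [h _ _]]] := exists_residues; exists pi. Qed.

Lemma expr_lt_eps (r e : R) : 0 < r < 1 -> 0 < e -> exists n, r ^+ n < e.
Proof.
move=> /andP[r0 r1] e0.
have : (fun n => r ^+ n) @ \oo --> (0 : R).
  by apply: cvg_expr; rewrite ger0_norm// ltW.
move=> /cvgr_lt/(_ _ e0) [N _ /(_ N)/=] h.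
by exists N; apply: h.
Qed.

Lemma vabs_small (e : R) : 0 < e -> exists2 c : F, c != 0 & vabs c < e.
Proof.
move=> e0; have [pi hpi] := exists_uniformizer.
have [n hn] := expr_lt_eps (proj1 hpi) e0.
exists (pi ^+ n); last by rewrite vabsX.
by rewrite expf_neq0//; exact: uniformizer_neq0 hpi.
Qed.

Lemma vabs_min c d : c != 0 -> d != 0 ->
  exists2 e : F, e != 0 & vabs e <= vabs c /\ vabs e <= vabs d.
Proof. by move=> c0 d0; have [h|/ltW h] := leP (vabs c) (vabs d : R); [exists c|exists d]. Qed.

Lemma vabs_uniformizer_pow pi x : is_uniformizer (@vabs R F) pi ->
  x != 0 -> vabs x <= 1 -> exists n, vabs x = vabs pi ^+ n.
Proof.
move=> hpi x0 x1.
have ex : exists n, vabs pi ^+ n <= vabs x.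
  have [|n /ltW ?] := expr_lt_eps (proj1 hpi) (_ : 0 < vabs x); last by exists n.
  by rewrite vabs_gt0.
case: (ex_minnP ex) => n hn hmin; exists n; apply/eqP; rewrite eq_le hn andbT.
case: n hn hmin => [_ _|n hn hmin]; first by rewrite expr0.
have pin : pi ^+ n != 0 by rewrite expf_neq0// (uniformizer_neq0 hpi).
(* By minimality |x| < |pi|^n, so x / pi^n lies in the maximal ideal and has absolute value at most
   |pi|. *)
have := (proj2 hpi) (x / pi ^+ n); rewrite vabs_div.
rewrite ltr_pdivrMr ?ler_pdivrMr ?vabs_gt0// mul1r vabsX -exprS; apply.
by rewrite ltNge; apply/negP => /hmin; rewrite ltnn.
Qed.

(** The radius is the absolute value of a field element, so for c != 0 the ball is the coset x + c
    O, both open and closed. *)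
Definition cball x c : set F := [set y | vabs (y - x) <= vabs c].

Lemma cball_center x c : cball x c x.
Proof. by rewrite /cball/= subrr vabs0 vabs_ge0. Qed.

Lemma nbhs_cball x c : c != 0 -> nbhs x (cball x c).
Proof.
move=> c0; apply/nbhs_ballP; exists (vabs c) => /=; first by rewrite vabs_gt0.
by move=> y; rewrite /ball/= /cball/= => /ltW; rewrite vabsBC.
Qed.

Lemma nbhs_cballP x (A : set F) :
  nbhs x A <-> exists2 c, c != 0 & cball x c `<=` A.
Proof.
split=> [/nbhs_ballP[e /= e0 h]|[c c0 h]]; last first.
  exact: filterS h (nbhs_cball _ c0).
have [c c0 ce] := vabs_small e0; exists c => // y hy; apply: h.
by rewrite /ball/= vabsBC; exact: le_lt_trans hy ce.
Qed.

Lemma open_cball x c : c != 0 -> open (cball x c).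
Proof.
move=> c0; rewrite openE => y hy; apply/nbhs_cballP; exists c => // z hz.
exact: vabsB_trans hz hy.
Qed.

Lemma open_cballC x c : c != 0 -> open (~` cball x c).
Proof.
move=> c0; rewrite openE => y hy; apply/nbhs_cballP; exists c => // z hz.
apply: contra_not hy => hy; apply: vabsB_trans hy.
by rewrite vabsBC.
Qed.

Lemma cball_eq x y c : cball x c y -> cball x c = cball y c.
Proof.
move=> h; apply/seteqP; split=> z hz.
  by apply: vabsB_trans hz _; rewrite vabsBC.
exact: vabsB_trans hz h.
Qed.

(* Representatives of the ball of radius |c| modulo the ball of radius |d|. *)
Record ball_reps c d (ts : seq F) : Prop := {
  reps_uniq : uniq ts ;
  reps_in : {in ts, forall t, vabs t <= vabs c} ;
  reps_inj : {in ts &, forall t u, vabs (t - u) <= vabs d -> t = u} ;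
  reps_surj : forall x, vabs x <= vabs c ->
    exists2 t, t \in ts & vabs (x - t) <= vabs d ;
  reps_size : (size ts)%:R * vabs d = vabs c }.

(** Induction on n with |d| = |pi|^n |c|: a class modulo e = d / pi splits into the classes of t + e
    r modulo d, with r in a residue system. The count follows from |pi| = 1/q. *)
Lemma exists_ball_reps c d : d != 0 -> vabs d <= vabs c ->
  exists ts, ball_reps c d ts.
Proof.
have [pi [s [hpi [us s1 sinj ssurj] qs]]] := exists_residues.
move=> d0 dc; have c0 : c != 0 by rewrite -vabs_gt0 (lt_le_trans _ dc)// vabs_gt0.
have [||n] := @vabs_uniformizer_pow pi (d / c) hpi.
- by rewrite mulf_neq0// invr_neq0.
- by rewrite vabs_div ler_pdivrMr ?vabs_gt0// mul1r.
rewrite vabs_div => h; have {h} : vabs d = vabs pi ^+ n * vabs c.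
  by rewrite -h mulfVK// gt_eqF// vabs_gt0.
elim: n d d0 {dc} => [|n ih] d d0.
  rewrite expr0 mul1r => dc; exists [:: 0]; split=> //.
  - by move=> t; rewrite inE => /eqP ->; rewrite vabs0 vabs_ge0.
  - by move=> t u; rewrite !inE => /eqP -> /eqP ->.
  - by move=> x hx; exists 0; rewrite ?inE// subr0 dc.
  - by rewrite mul1r.
have p0 := uniformizer_neq0 hpi.
have vp0 : 0 < vabs pi by rewrite vabs_gt0.
move=> dc; have [||ts [uts h1 h2 h3 h4]] := ih (d / pi).
- by rewrite mulf_neq0// invr_neq0.
- by rewrite vabs_div dc exprS mulrAC [_ * _ ^+ _]mulrC mulfK// gt_eqF.
set e := d / pi in h1 h2 h3 h4; have e0 : e != 0 by rewrite mulf_neq0// invr_neq0.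
have de : vabs d = vabs e * vabs pi by rewrite vabs_div mulfVK// gt_eqF.
have ve0 : 0 < vabs e by rewrite vabs_gt0.
(* The two levels separate: modulo e the hypothesis gives t = u, and then |r - r'| <= |pi| < 1 gives
   r = r'. *)
have key t u r r' : t \in ts -> u \in ts -> r \in s -> r' \in s ->
    vabs (t + e * r - (u + e * r')) <= vabs d -> t = u /\ r = r'.
  move=> ht hu hr hr' h.
  have tu : t = u.
    apply: h2 => //.
    have -> : t - u = (t + e * r - (u + e * r')) - (e * r - e * r').
      by rewrite opprD addrACA opprB; ring.
    apply: vabsB_le.
      apply: (le_trans h); rewrite de ger_pMr//.
      by have [/andP[_ /ltW]] := hpi.
    by apply: vabsB_le; rewrite vabsM ger_pMr// s1.
  split=> //; apply: sinj => //; move: h; rewrite tu.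
  have -> : u + e * r - (u + e * r') = e * (r - r') by ring.
  rewrite vabsM de ler_pM2l// => h.
  by apply: (le_lt_trans h); have [/andP[]] := hpi.
exists [seq t + e * r | t <- ts, r <- s]; split.
- apply: allpairs_uniq => // -[t r] [u r'] /allpairsP[[? ?]/= [ht hr [-> ->]]].
  move=> /allpairsP[[? ?]/= [hu hr' [-> ->]]] h.
  by have [] := key _ _ _ _ ht hu hr hr'; rewrite ?h ?subrr ?vabs0 ?vabs_ge0// => -> ->.
- move=> x /allpairsP[[t r]/= [ht hr ->]]; apply: vabsD_le; first exact: h1.
  rewrite vabsM; apply: (@le_trans _ _ (vabs e)); first by rewrite ger_pMr// s1.
  rewrite -h4 ler_peMl ?vabs_ge0//.
  have [t' ht' _] := h3 0 ltac:(by rewrite vabs0 vabs_ge0).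
  by rewrite ler1n; case: (ts) ht'.
- move=> _ _ /allpairsP[[t r]/= [ht hr ->]] /allpairsP[[u r']/= [hu hr' ->]] h.
  by have [-> ->] := key _ _ _ _ ht hu hr hr' h.
- move=> x hx; have [t ht hxt] := h3 _ hx.
  have [|r hr hxr] := ssurj ((x - t) / e).
    by rewrite vabs_div ler_pdivrMr// mul1r.
  exists (t + e * r); first by apply/allpairsP; exists (t, r).
  have -> : x - (t + e * r) = e * ((x - t) / e - r) by field.
  by rewrite vabsM de ler_pM2l//; apply: (proj2 hpi).
- rewrite size_allpairs natrM -h4 de qs mulrACA mulfV ?mulr1// -invr_eq0 -qs gt_eqF//.
Qed.

End local_field.

(** * Complex-valued integrals *)

Section complex_modulus.
Context (R : realType).
Implicit Types z w : cplx R.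

(** The norm of [cplx R] takes its values in [cplx R]; this is the real number behind it, usable in
    estimates over [R]. *)
Definition cmod z : R := Normc.normc (z : R[i]).

Lemma normc_cmod z : `|z| = ((cmod z)%:C)%C. Proof. by []. Qed.

Lemma cmodM z w : cmod (z * w) = cmod z * cmod w.
Proof. exact: Normc.normcM. Qed.

Lemma cmod_ge0 z : 0 <= cmod z.
Proof. by case: z => a b; rewrite /cmod/= sqrtr_ge0. Qed.

Lemma cmod0 : cmod 0 = 0. Proof. exact: Normc.normc0. Qed.

Lemma cmod_real (r : R) : cmod (r%:C)%C = `|r|.
Proof. by rewrite /cmod/= expr0n/= addr0 sqrtr_sqr. Qed.

Lemma cmod_bool (b : bool) : cmod b%:R = b%:R.
Proof. by rewrite -(rmorph_nat (real_complex R)) cmod_real normr_nat. Qed.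

Lemma cmod_ge_Re z : `|complex.Re z| <= cmod z.
Proof. by rewrite -lecR; exact: normc_ge_Re. Qed.

Lemma cmod_ge_Im z : `|complex.Im z| <= cmod z.
Proof.
case: z => a b; rewrite /cmod/= -[leLHS]sqrtr_sqr ler_sqrt ?lerDr ?sqr_ge0//.
by rewrite addr_ge0 ?sqr_ge0.
Qed.

Lemma cmod_le_ReIm z : cmod z <= `|complex.Re z| + `|complex.Im z|.
Proof.
case: z => a b; rewrite /cmod/= -(@ler_pXn2r _ 2) ?nnegrE ?sqrtr_ge0 ?addr_ge0//.
rewrite sqr_sqrtr ?addr_ge0 ?sqr_ge0// sqrrD !real_normK ?num_real//.
by rewrite lerD2r lerDl mulrn_wge0// mulr_ge0.
Qed.

Lemma cmodD z w : cmod (z + w) <= cmod z + cmod w.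
Proof. exact: (@le_normcD R z w). Qed.

Lemma cmod_eq0 z : cmod z = 0 -> z = 0.
Proof. exact: Normc.eq0_normc. Qed.

Lemma cplx_hausdorff : hausdorff_space (cplx R).
Proof. exact: norm_hausdorff. Qed.

Lemma cvg_cplx (u : nat -> cplx R) (l : cplx R) :
  (fun n => complex.Re (u n)) @ \oo --> complex.Re l ->
  (fun n => complex.Im (u n)) @ \oo --> complex.Im l ->
  u @ \oo --> l.
Proof.
move=> hr hi; apply/cvgrPdist_lt => -[e1 e2]; rewrite ltcE/= => /andP[/eqP -> e0].
have e20 : 0 < e1 / 2 by rewrite divr_gt0.
near=> n; rewrite normc_cmod ltcR (le_lt_trans (cmod_le_ReIm _))//.
rewrite (splitr e1) ltrD//.
  have : `|complex.Re l - complex.Re (u n)| < e1 / 2.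
    by near: n; exact: (cvgrPdist_lt _ _).1 hr _ e20.
  by case: (l) => ? ?; case: (u n) => ? ?.
have : `|complex.Im l - complex.Im (u n)| < e1 / 2.
  by near: n; exact: (cvgrPdist_lt _ _).1 hi _ e20.
by case: (l) => ? ?; case: (u n) => ? ?.
Unshelve. all: by end_near. Qed.

End complex_modulus.

Section complex_integral.
Context (R : realType) (d : measure_display) (T : measurableType d).
Implicit Types (mu : {measure set T -> \bar R}) (D E : set T).
Implicit Types (f g : T -> cplx R) (z : cplx R).

Definition cmeasurable D f :=
  measurable_fun D (fun x => complex.Re (f x)) /\
  measurable_fun D (fun x => complex.Im (f x)).

Lemma cmeasurable_cst D z : cmeasurable D (fun=> z).
Proof. by split; exact: measurable_cst. Qed.

Lemma cmeasurableM D f g : cmeasurable D f -> cmeasurable D g ->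
  cmeasurable D (fun x => f x * g x).
Proof.
move=> [fr fi] [gr gi]; split.
  have -> : (fun x => complex.Re (f x * g x)) =
      (fun x => complex.Re (f x) * complex.Re (g x) -
                complex.Im (f x) * complex.Im (g x)).
    by apply/funext => x; case: (f x) => ? ?; case: (g x).
  by apply: measurable_funB; exact: measurable_funM.
have -> : (fun x => complex.Im (f x * g x)) =
    (fun x => complex.Re (f x) * complex.Im (g x) +
              complex.Im (f x) * complex.Re (g x)).
  by apply/funext => x; case: (f x) => ? ?; case: (g x).
by apply: measurable_funD; exact: measurable_funM.
Qed.

Lemma cintegrable_measurable mu D f : cintegrable mu D f -> cmeasurable D f.
Proof.
move=> [/integrableP[/measurable_EFinP ? _] /integrableP[/measurable_EFinP ? _]].
by split.
Qed.

Lemma le_cintegrable mu D f (h : T -> R) : measurable D -> cmeasurable D f ->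
  (forall x, D x -> cmod (f x) <= h x) -> mu.-integrable D (EFin \o h) ->
  cintegrable mu D f.
Proof.
move=> mD [fr fi] fh ih.
split; apply: le_integrable ih => //; try exact/measurable_EFinP; move=> x Dx /=;
  rewrite lee_fin; apply: (@le_trans _ _ (cmod (f x)));
  rewrite ?cmod_ge_Re ?cmod_ge_Im// (le_trans (fh _ Dx))// ler_norm//.
Qed.

Lemma bounded_cintegrable mu D f (M : R) : measurable D -> (mu D < +oo)%E ->
  cmeasurable D f -> (forall x, D x -> cmod (f x) <= M) -> cintegrable mu D f.
Proof.
move=> mD fD mf fM; apply: (@le_cintegrable _ _ _ (fun=> M)) => //.
apply/integrableP; split; first exact/measurable_EFinP/measurable_cst.
by rewrite /= integral_cst// lte_mul_pinfty// lee_fin.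
Qed.

Lemma cintegrable_cmod mu D f : measurable D -> cintegrable mu D f ->
  mu.-integrable D (EFin \o (fun x => cmod (f x))).
Proof.
move=> mD [fr fi].
have h : mu.-integrable D
    (fun x => (`|complex.Re (f x)|%:E + `|complex.Im (f x)|%:E)%E).
  apply: integrableD => //.
    by have := integrable_abse fr.
  by have := integrable_abse fi.
apply: le_integrable h => //.
  have [mr mi] := cintegrable_measurable (conj fr fi).
  apply/measurable_EFinP.
  have -> : (fun x => cmod (f x)) =
      (fun x => Num.sqrt (complex.Re (f x) ^+ 2 + complex.Im (f x) ^+ 2)).
    by apply/funext => x; case: (f x).
  apply: (@measurableT_comp _ _ _ _ _ _ (@Num.sqrt R)).
    by apply: continuous_measurable_fun; exact: sqrt_continuous.
  by apply: measurable_funD; exact: measurable_funX.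
move=> x Dx /=; rewrite lee_fin ger0_norm ?cmod_ge0//.
by rewrite ger0_norm ?addr_ge0// cmod_le_ReIm.
Qed.

Lemma eq_cint mu D f g : (forall x, D x -> f x = g x) ->
  cint mu D f = cint mu D g.
Proof.
move=> fg; rewrite /cint; congr Complex; apply: eq_Rintegral => x /set_mem Dx;
  by rewrite fg.
Qed.

Lemma eq_cintegrable mu D f g : measurable D -> (forall x, D x -> f x = g x) ->
  cintegrable mu D f -> cintegrable mu D g.
Proof.
move=> mD fg [fr fi]; split.
  by apply: eq_integrable fr => // x /set_mem Dx /=; rewrite fg.
by apply: eq_integrable fi => // x /set_mem Dx /=; rewrite fg.
Qed.

Lemma cintegrable0 mu D : cintegrable mu D (fun=> 0).
Proof. by split; exact: integrable0. Qed.

Lemma cint0 mu D : cint mu D (fun=> 0) = 0.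
Proof. by rewrite /cint /Rintegral integral0. Qed.

Lemma cintegrableD mu D f g : measurable D ->
  cintegrable mu D f -> cintegrable mu D g ->
  cintegrable mu D (fun x => f x + g x).
Proof.
move=> mD [fr fi] [gr gi]; split.
  apply: eq_integrable (integrableD mD fr gr) => // x _ /=.
  by case: (f x) => ? ?; case: (g x) => ? ?; rewrite -EFinD.
apply: eq_integrable (integrableD mD fi gi) => // x _ /=.
by case: (f x) => ? ?; case: (g x) => ? ?; rewrite -EFinD.
Qed.

Lemma cintD mu D f g : measurable D ->
  cintegrable mu D f -> cintegrable mu D g ->
  cint mu D (fun x => f x + g x) = cint mu D f + cint mu D g.
Proof.
move=> mD [fr fi] [gr gi].
rewrite {2 3}/cint -[RHS]/(Complex (_ + _) (_ + _)) -!RintegralD//.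
by congr Complex; apply: eq_Rintegral => x _; case: (f x) => ? ?; case: (g x).
Qed.

Lemma cintegrableZ mu D z f : measurable D -> cintegrable mu D f ->
  cintegrable mu D (fun x => z * f x).
Proof.
move=> mD hf; apply: (@le_cintegrable _ _ _ (fun x => cmod z * cmod (f x))) => //.
- apply: cmeasurableM; first exact: cmeasurable_cst.
  exact: cintegrable_measurable hf.
- by move=> x _; rewrite cmodM.
- have := integrableZl mD (cmod z) (cintegrable_cmod mD hf).
  by apply: eq_integrable => // x _ /=; rewrite EFinM.
Qed.

Lemma cintZ mu D z f : measurable D -> cintegrable mu D f ->
  cint mu D (fun x => z * f x) = z * cint mu D f.
Proof.
move=> mD [fr fi]; case: z => a b.
have ar := integrableZl mD a fr; have ai := integrableZl mD a fi.
have br := integrableZl mD b fr; have bi := integrableZl mD b fi.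
rewrite /cint -[RHS]/(Complex (_ - _) (_ + _)) -!RintegralZl//.
rewrite -RintegralB// -RintegralD//.
by congr Complex; apply: eq_Rintegral => x _; case: (f x).
Qed.

Lemma cintZr mu D z f : measurable D -> cintegrable mu D f ->
  cint mu D (fun x => f x * z) = cint mu D f * z.
Proof.
move=> mD hf; rewrite mulrC -cintZ//.
by apply: eq_cint => x _; rewrite mulrC.
Qed.

Lemma cintegrable_sum mu D (I : Type) (r : seq I) (f : I -> T -> cplx R) :
  measurable D -> (forall i, cintegrable mu D (f i)) ->
  cintegrable mu D (fun x => \sum_(i <- r) f i x).
Proof.
move=> mD hf; elim: r => [|i r ih].
  by apply: eq_cintegrable (cintegrable0 mu D) => // x _; rewrite big_nil.
apply: eq_cintegrable (cintegrableD mD (hf i) ih) => // x _.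
by rewrite big_cons.
Qed.

Lemma cint_sum mu D (I : Type) (r : seq I) (f : I -> T -> cplx R) :
  measurable D -> (forall i, cintegrable mu D (f i)) ->
  cint mu D (fun x => \sum_(i <- r) f i x) = \sum_(i <- r) cint mu D (f i).
Proof.
move=> mD hf; elim: r => [|i r ih].
  rewrite big_nil; transitivity (cint mu D (fun=> 0 : cplx R)); last exact: cint0.
  by apply: eq_cint => x _; rewrite big_nil.
rewrite big_cons -ih -cintD//; last exact: cintegrable_sum.
by apply: eq_cint => x _; rewrite big_cons.
Qed.

Lemma cint_cst mu D z : measurable D ->
  cint mu D (fun=> z) = z * ((fine (mu D))%:C)%C.
Proof.
move=> mD; case: z => a b; rewrite /cint !Rintegral_cst//.
by rewrite -[RHS]/(Complex (_ - _) (_ + _)) !mulr0 subr0 add0r.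
Qed.

Lemma cint_indic mu D E f : measurable D ->
  cint mu D (fun x => (x \in E)%:R * f x) = cint mu (D `&` E) f.
Proof.
move=> mD; rewrite /cint !Rintegral_mkcondr; congr Complex; apply: eq_Rintegral => x _;
  by rewrite patchE; case: (x \in E); rewrite ?mul1r ?mul0r.
Qed.

(** The factor 2 comes from estimating the real and imaginary parts separately. It is absorbed below
    by an unspecified constant or an arbitrary epsilon. *)
Lemma cmod_cint_le mu D f (h : T -> R) : measurable D -> cintegrable mu D f ->
  mu.-integrable D (EFin \o h) -> (forall x, D x -> cmod (f x) <= h x) ->
  cmod (cint mu D f) <= 2 * Rintegral mu D h.
Proof.
move=> mD [fr fi] ih fh; apply: (le_trans (cmod_le_ReIm _)).
have aux (g : T -> R) : mu.-integrable D (EFin \o g) ->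
    (forall x, D x -> `|g x| <= h x) -> `|Rintegral mu D g| <= Rintegral mu D h.
  move=> ig gh; apply: (le_trans (le_normr_Rintegral mD ig)).
  apply: le_Rintegral => //.
  exact: integrable_abse ig.
rewrite mulr2n mulrDl mul1r; apply: lerD; apply: aux => // x Dx.
  exact: le_trans (cmod_ge_Re _) (fh _ Dx).
exact: le_trans (cmod_ge_Im _) (fh _ Dx).
Qed.

Lemma cint_real mu D (h : T -> R) :
  cint mu D (fun x => ((h x)%:C)%C) = ((Rintegral mu D h)%:C)%C.
Proof. by rewrite /cint/= /Rintegral integral0. Qed.

(** Dominated convergence for sequences that are eventually constant at every point, the only kind
    that occurs in the limit over balls. *)
Lemma cvg_cint mu D (f : nat -> T -> cplx R) g (h : T -> R) : measurable D ->
  (forall n, cmeasurable D (f n)) -> cmeasurable D g ->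
  mu.-integrable D (EFin \o h) ->
  (forall n x, D x -> cmod (f n x) <= h x) ->
  (forall x, D x -> \forall n \near \oo, f n x = g x) ->
  (fun n => cint mu D (f n)) @ \oo --> cint mu D g.
Proof.
move=> mD mf mg ih fh fg.
have aux (p : cplx R -> R) : (forall z, `|p z| <= cmod z) ->
    (forall n, measurable_fun D (fun x => p (f n x))) ->
    measurable_fun D (fun x => p (g x)) ->
    (fun n => Rintegral mu D (fun x => p (f n x))) @ \oo -->
    Rintegral mu D (fun x => p (g x)).
  move=> pc mpf mpg.
  have [|||||] := @dominated_convergence _ T R mu D mD
    (fun n x => (p (f n x))%:E) (fun x => (p (g x))%:E) (EFin \o h).
  - by move=> n; exact/measurable_EFinP.
  - exact/measurable_EFinP.
  - apply/aeW => x Dx; apply: cvg_near_cst.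
    by have := fg x Dx; apply: filterS => n ->.
  - exact: ih.
  - apply/aeW => x n Dx /=; rewrite lee_fin.
    exact: le_trans (pc _) (fh _ _ Dx).
  - move=> ig _ hc; apply: fine_cvg; rewrite fineK//.
    exact: integrable_fin_num.
apply: cvg_cplx; apply: aux => //; try exact: cmod_ge_Re; try exact: cmod_ge_Im.
- by move=> n; have [] := mf n.
- by have [] := mg.
- by move=> n; have [] := mf n.
- by have [] := mg.
Qed.

End complex_integral.

(** * Pushforward of a measure with density, and change of variables *)

Section weighted_pushforward.
Local Open Scope ereal_scope.
Context (R : realType) (d d' : measure_display).
Context (T : measurableType d) (T' : measurableType d').
Variables (mu : {measure set T -> \bar R}) (D : set T).
Variables (phi : T -> T') (h : T -> R).
Hypotheses (mD : measurable D) (mphi : measurable_fun D phi).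
Hypotheses (mh : measurable_fun D h) (h0 : forall x, (0 <= h x)%R).

(** The measurability and positivity proofs are arguments of the term, so that the measure structure
    declared below can be inferred from it. *)
Definition wpush (_ : measurable_fun D phi) (_ : measurable_fun D h)
    (_ : measurable D) (_ : forall x, (0 <= h x)%R) (A : set T') :=
  \int[mu]_(x in D `&` phi @^-1` A) (h x)%:E.

Notation m := (wpush mphi mh mD h0).

Let m0 : m set0 = 0.
Proof. by rewrite /wpush preimage_set0 setI0 integral_set0. Qed.

Let m_ge0 A : 0 <= m A.
Proof. by apply: integral_ge0 => x _; rewrite lee_fin. Qed.

Let mhS A : measurable A -> measurable_fun (D `&` phi @^-1` A) (EFin \o h).
Proof.
by move=> mA; apply/measurable_EFinP; exact: measurable_funS mh.
Qed.

Let m_sigma_additive : semi_sigma_additive m.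
Proof.
move=> /= G mG tG mUG; rewrite /wpush; apply: cvg_toP.
  apply: ereal_nondecreasing_is_cvgn => k n kn.
  apply: lee_sum_nneg_natr => // j _ _.
  by apply: integral_ge0 => /= x _; rewrite lee_fin.
rewrite preimage_bigcup setI_bigcupr ge0_integral_bigcup//=.
- by move=> i; exact: mphi.
- rewrite -setI_bigcupr -preimage_bigcup; exact: mhS.
- by move=> x _; rewrite lee_fin.
- apply/trivIsetP => i j _ _ ij; rewrite setIACA setIid -preimage_setI.
  by move/trivIsetP : tG => /(_ _ _ _ _ ij) ->//; rewrite preimage_set0 setI0.
Qed.

HB.instance Definition _ := isMeasure.Build _ _ _ m m0 m_ge0 m_sigma_additive.

Import HBNNSimple.

Let integral_wpush_nnsfun (f : {nnsfun T' >-> R}) :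
  \int[m]_x (f x)%:E = \int[mu]_(x in D) ((h x)%:E * (f (phi x))%:E).
Proof.
under [LHS]eq_integral do rewrite fimfunE -fsumEFin//.
rewrite ge0_integral_fsum//; last 2 first.
  - by move=> r; exact/measurable_EFinP/measurableT_comp.
  - by move=> n x _; rewrite EFinM nnfun_muleindic_ge0.
under [RHS]eq_integral.
  move=> x xD; rewrite fimfunE -fsumEFin// ge0_mule_fsumr; last first.
    by move=> r; rewrite EFinM nnfun_muleindic_ge0.
  over.
have mB r : measurable (f @^-1` [set r]) by [].
have mcomp r : measurable_fun D (fun x => (\1_(f @^-1` [set r]) (phi x) : R)).
  by apply: (@measurableT_comp _ _ _ _ _ _ (\1_(f @^-1` [set r]) : T' -> R)).
rewrite [RHS]ge0_integral_fsum//; last 2 first.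
  - move=> r; apply: emeasurable_funM; first exact/measurable_EFinP.
    exact/measurable_EFinP/measurable_funM.
  - by move=> n x _; apply: mule_ge0; rewrite ?lee_fin// -lee_fin EFinM nnfun_muleindic_ge0.
apply: eq_fsbigr => r _.
rewrite integralZl_indic_nnsfun//= integral_indic// setIT.
have [r0|r0] := ltP r 0%R.
  rewrite (_ : f @^-1` [set r] = set0); last first.
    apply/seteqP; split => // x /= fxr; move: r0; rewrite -fxr ltNge.
    by rewrite fun_ge0.
  rewrite measure0 mule0 integral0_eq// => x _.
  by rewrite indic0 mulr0 mule0.
set B := D `&` phi @^-1` (f @^-1` [set r]).
have mB' : measurable B by exact: mphi.
have DB : B = D `&` B by rewrite setIidr//; exact: subIsetl.
transitivity (r%:E * \int[mu]_(x in D `&` B) (h x)%:E); first by rewrite -DB.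
rewrite integral_mkcondr -ge0_integralZl//.
- apply: eq_integral => x xD; rewrite patchE indicE /=.
  have -> : (phi x \in f @^-1` [set r]) = (x \in B).
    apply/idP/idP => [/set_mem fx|/set_mem[_ fx]]; apply/mem_set => //.
    by split => //; exact/set_mem.
  by case: ifPn => _; rewrite ?mulr1 ?mulr0 ?mule0// muleC.
- apply: (measurable_restrict (fun x => (h x)%:E) mB' mD).1.
  by apply/measurable_EFinP; exact: measurable_funS mh.
- by move=> x _; rewrite patchE; case: ifPn; rewrite ?lee_fin.
Qed.

Let ge0_integral_wpushT (f : T' -> \bar R) : measurable_fun setT f ->
  (forall x, 0 <= f x) ->
  \int[m]_x f x = \int[mu]_(x in D) ((h x)%:E * f (phi x)).
Proof.
move=> mf f0; pose f_ := nnsfun_approx measurableT mf.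
have mg n : measurable_fun D (fun x => (h x)%:E * (f_ n (phi x))%:E).
  apply: emeasurable_funM; first exact/measurable_EFinP.
  exact/measurable_EFinP/measurableT_comp.
have g0 n x : D x -> 0 <= (h x)%:E * (f_ n (phi x))%:E.
  by move=> _; rewrite mule_ge0 ?lee_fin.
have ndg x : D x -> {homo (fun n => (h x)%:E * (f_ n (phi x))%:E) : a b / (a <= b)%N >-> a <= b}.
  move=> _ a b ab; apply: lee_wpmul2l; first by rewrite lee_fin.
  by rewrite lee_fin; exact/lefP/nd_nnsfun_approx.
transitivity (limn (fun n => \int[m]_x (f_ n x)%:E)).
  rewrite -monotone_convergence//=.
  - apply: eq_integral => x _; apply/esym/cvg_lim => //=.
    exact: cvg_nnsfun_approx.
  - by move=> n; exact/measurable_EFinP.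
  - by move=> n x _; rewrite lee_fin.
  - by move=> x _ a b ab; rewrite lee_fin//; exact/lefP/nd_nnsfun_approx.
under eq_fun do rewrite integral_wpush_nnsfun.
rewrite -monotone_convergence//=.
apply: eq_integral => x _; apply/cvg_lim => //=.
by apply: cvgeZl => //; exact: cvg_nnsfun_approx.
Qed.

Lemma ge0_integral_wpush (D' : set T') (f : T' -> \bar R) :
  measurable D' -> (forall x, D x -> D' (phi x)) ->
  measurable_fun D' f -> (forall x, D' x -> 0 <= f x) ->
  \int[m]_(x in D') f x = \int[mu]_(x in D) ((h x)%:E * f (phi x)).
Proof.
move=> mD' DD' mf f0; transitivity (\int[m]_x (f \_ D') x); first exact: integral_mkcond.
etransitivity.
  apply: (ge0_integral_wpushT (f := f \_ D')); last first.
  - by move=> x; rewrite patchE; case: ifPn => // /set_mem /f0.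
  - exact: (measurable_restrictT f mD').1 mf.
by apply: eq_integral => x /set_mem /DD' Dx; rewrite patchT//; exact/mem_set.
Qed.

End weighted_pushforward.

Section change_of_variables.
Context (R : realType) (d d' : measure_display).
Context (T : measurableType d) (T' : measurableType d').
Variables (mu : {measure set T -> \bar R}) (nu : {measure set T' -> \bar R}).
Variables (D : set T) (D' : set T') (phi : T -> T') (h : T -> R).
Hypotheses (mD : measurable D) (mD' : measurable D').
Hypotheses (mphi : measurable_fun D phi) (phiD : forall x, D x -> D' (phi x)).
Hypotheses (mh : measurable_fun D h) (h0 : forall x, 0 <= h x).
Hypothesis nuE : forall A, measurable A -> A `<=` D' ->
  nu A = (\int[mu]_(x in D `&` phi @^-1` A) (h x)%:E)%E.

(** Hypothesis [nuE] says that on D' the measure [nu] is the pushforward under [phi] of [mu]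
    weighted by [h], so the formula reduces to the one for [wpush]. *)
Lemma ge0_integral_change (f : T' -> \bar R) : measurable_fun D' f ->
  (forall x, D' x -> (0 <= f x)%E) ->
  (\int[nu]_(x in D') f x = \int[mu]_(x in D) ((h x)%:E * f (phi x)))%E.
Proof.
move=> mf f0; rewrite -(@ge0_integral_wpush _ _ _ _ _ mu D phi h mD mphi mh h0 D')//.
by apply: eq_measure_integral => A mA AD; exact: nuE.
Qed.

Let measurable_change (f : T' -> R) : measurable_fun D' f ->
  measurable_fun D (fun x => h x * f (phi x)).
Proof.
move=> mf; apply: measurable_funM => //.
by apply: (measurable_comp mD') => // _ [x Dx <-]; exact: phiD.
Qed.

Lemma integrable_change (f : T' -> R) : nu.-integrable D' (EFin \o f) ->
  mu.-integrable D (fun x => (h x * f (phi x))%:E).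
Proof.
move=> /integrableP[/measurable_EFinP mf fi]; apply/integrableP; split.
  exact/measurable_EFinP/measurable_change.
move: fi; rewrite ge0_integral_change//; last exact/measurableT_comp/measurable_EFinP.
congr (_ < _)%E; apply: eq_integral => x _.
by rewrite EFinM abseM [in RHS]gee0_abs ?lee_fin.
Qed.

Lemma Rintegral_change (f : T' -> R) : nu.-integrable D' (EFin \o f) ->
  Rintegral nu D' f = Rintegral mu D (fun x => h x * f (phi x)).
Proof.
move=> fi; have /integrableP[/measurable_EFinP mf _] := fi.
rewrite /Rintegral integralE [in RHS]integralE; congr (fine (_ - _)%E).
  rewrite ge0_integral_change//.
    apply: eq_integral => x _; rewrite !funeposE /= EFinM.
    by rewrite maxe_pMr ?lee_fin// mule0.
  exact/measurable_funepos/measurable_EFinP.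
rewrite ge0_integral_change//.
  apply: eq_integral => x _; rewrite !funenegE /= -mulrN EFinM.
  by rewrite maxe_pMr ?lee_fin// mule0.
exact/measurable_funeneg/measurable_EFinP.
Qed.

Lemma cintegrable_change (f : T' -> cplx R) : cintegrable nu D' f ->
  cintegrable mu D (fun x => ((h x)%:C)%C * f (phi x)).
Proof.
move=> [/integrable_change fr /integrable_change fi]; split.
  by apply: eq_integrable fr => // x _ /=; case: (f _) => a b /=; rewrite mul0r subr0.
by apply: eq_integrable fi => // x _ /=; case: (f _) => a b /=; rewrite mul0r addr0.
Qed.

Lemma cint_change (f : T' -> cplx R) : cintegrable nu D' f ->
  cint nu D' f = cint mu D (fun x => ((h x)%:C)%C * f (phi x)).
Proof.
move=> [fr fi]; rewrite /cint !Rintegral_change//; congr Complex;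
  by apply: eq_Rintegral => x _; case: (f _) => a b /=; rewrite mul0r ?subr0 ?addr0.
Qed.

End change_of_variables.

(** * Haar measure *)

Section borel.
Context (R : realType) (T : ptopologicalType).

Lemma borel_open (A : set T) : open A -> measurable (A : set (borel T)).
Proof. by move=> oA; exact: sub_sigma_algebra. Qed.

Lemma borel_closed (A : set T) : closed A -> measurable (A : set (borel T)).
Proof.
move=> cA; rewrite -[A]setCK; apply: measurableC.
by apply: borel_open; exact: closed_openC.
Qed.

Lemma borel_measurable_fun (S : ptopologicalType) (D : set T) (f : T -> S) :
  measurable (D : set (borel T)) -> (forall x, D x -> {for x, continuous f}) ->
  measurable_fun (D : set (borel T)) (f : borel T -> borel S).
Proof.
move=> mD cf; apply: (@measurability _ _ (borel T) (borel S) D f (@open S)) => // _ [B oB <-].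
have -> : D `&` f @^-1` B = D `&` (f @^-1` B)°.
  apply/seteqP; split=> y [Dy By]; split => //; last exact: (nbhs_singleton By).
  exact: cf y Dy _ (open_nbhs_nbhs (conj oB By)).
by apply: measurableI => //; apply: borel_open; exact: open_interior.
Qed.

Definition locally_constant_on (S : Type) (D : set T) (f : T -> S) :=
  forall x, D x -> \forall y \near x, D y -> f y = f x.

(** The preimage of an arbitrary set is relatively open in D, whence the measurability of locally
    constant functions whatever the structure on the target. *)
Lemma locally_constant_preimage (S : Type) (D : set T) (f : T -> S) (B : set S) :
  measurable (D : set (borel T)) -> locally_constant_on D f ->
  measurable (D `&` f @^-1` B : set (borel T)).
Proof.
move=> mD lf; have -> : D `&` f @^-1` B = D `&` [set y | D y -> B (f y)]°.
  apply/seteqP; split=> y [Dy By]; split => //.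
    rewrite /interior/=; have := lf y Dy; apply: filterS => z h Dz.
    by rewrite h.
  exact: (nbhs_singleton By).
by apply: measurableI => //; apply: borel_open; exact: open_interior.
Qed.

Lemma locally_constant_cmeasurable (D : set T) (f : T -> cplx R) :
  measurable (D : set (borel T)) -> locally_constant_on D f ->
  cmeasurable (D : set (borel T)) f.
Proof.
move=> mD lf; split=> _ B _.
  exact: (@locally_constant_preimage _ D f [set z | B (complex.Re z)]).
exact: (@locally_constant_preimage _ D f [set z | B (complex.Im z)]).
Qed.

Lemma locally_constant_measurable (D : set T) (f : T -> R) :
  measurable (D : set (borel T)) -> locally_constant_on D f ->
  measurable_fun (D : set (borel T)) f.
Proof. by move=> mD lf _ B _; exact: locally_constant_preimage. Qed.

End borel.

(** * Compactness of balls *)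

Section compactness.
Context (R : realType) (F : nonarchLocalFieldType R).

(** A ball is a finite union of balls of any smaller radius, and an ultrafilter that contains a
    finite union contains one of its members. *)
Lemma ultra_cball (U : set_system F) (x c d : F) : UltraFilter U ->
  c != 0 -> d != 0 -> U (cball x c) -> exists y, U (cball y d).
Proof.
move=> uU c0 d0 Uc; have [dc|/ltW cd] := leP (vabs d) (vabs c); last first.
  by exists x; apply: filterS Uc => y hy; exact: le_trans hy cd.
have [ts [_ _ _ surj _]] := exists_ball_reps d0 dc.
apply: contrapT => hn.
have hC t : U (~` cball (x + t) d).
  by have [h|//] := in_ultra_setVsetC (cball (x + t) d) uU; exfalso; apply: hn; exists (x + t).
have hall (s : seq F) : U [set y | forall t, t \in s -> ~ cball (x + t) d y].
  elim: s => [|t s ih]; first by apply: filterS filterT.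
  apply: filterS2 (hC t) ih => y h1 h2 u; rewrite inE => /predU1P[->//|]; exact: h2.
have [y [hy1 hy2]] := filter_ex (filterI Uc (hall ts)).
have [t ts_t ht] := surj (y - x) hy1.
by apply: (hy2 t ts_t); rewrite /cball/= opprD addrA.
Qed.

(** An ultrafilter on the ball contains a ball of radius |pi|^n for each n. These balls meet
    pairwise, so their centers form a Cauchy sequence, and the ultrafilter converges to its
    limit. *)
Lemma compact_cball (x c : F) : c != 0 -> compact (cball x c).
Proof.
move=> c0; rewrite compact_ultra => U uU Uc.
have [pi hpi] := @exists_uniformizer R F.
have p0 n : pi ^+ n != 0 by rewrite expf_neq0// (uniformizer_neq0 hpi).
have /choice[y hy] n : exists y, U (cball y (pi ^+ n)) by exact: ultra_cball Uc.
have le_pow m n : (m <= n)%N -> vabs (pi ^+ n) <= vabs (pi ^+ m).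
  move=> mn; have [/andP[/ltW h0 /ltW h1] _] := hpi.
  by rewrite !vabsX; apply: ler_wiXn2l.
have meet m n : (m <= n)%N -> vabs (y m - y n) <= vabs (pi ^+ m).
  move=> mn; have [z [/= h1 h2]] := filter_ex (filterI (hy m) (hy n)).
  apply: (@vabsB_trans _ _ z); first by rewrite vabsBC.
  exact: le_trans h2 (le_pow _ _ mn).
have pow_lt e : 0 < e -> exists N, vabs (pi ^+ N) < e.
  by move=> e0; have [N hN] := expr_lt_eps (proj1 hpi) e0; exists N; rewrite vabsX.
have [l hl] : exists l : F, forall e, 0 < e -> exists N, forall n, (N <= n)%N ->
    vabs (y n - l) < e.
  apply: vabs_complete => e e0; have [N hN] := pow_lt e e0.
  exists N => m n Nm Nn; apply: le_lt_trans hN.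
  by apply: (@vabsB_trans _ _ (y N)); [rewrite vabsBC|]; exact: meet.
have Ul d : d != 0 -> U (cball l d).
  move=> d0; have [|N hN] := hl (vabs d); first by rewrite vabs_gt0.
  have [|M hM] := pow_lt (vabs d); first by rewrite vabs_gt0.
  have := hy (maxn N M); apply: filterS => z hz; apply: (@vabsB_trans _ _ (y (maxn N M))).
    by apply: (le_trans hz); apply: (le_trans (le_pow _ _ (leq_maxr N M))); exact: ltW.
  by apply/ltW/hN; exact: leq_maxl.
exists l; split.
  have [z [/= h1 h2]] := filter_ex (filterI Uc (Ul _ c0)).
  by apply: (@vabsB_trans _ _ z) => //; rewrite vabsBC.
by move=> A /nbhs_cballP[d d0 hd]; apply: filterS hd (Ul _ d0).
Qed.

End compactness.

Section haar.
Context (R : realType) (F : nonarchLocalFieldType R).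
Variable dx : {measure set (borel F) -> \bar R}.
Hypothesis hdx : is_haar dx.
Implicit Types x y c d : F.

Lemma measurable_cball x c : c != 0 -> measurable (cball x c : set (borel F)).
Proof. by move=> c0; apply: borel_open; exact: open_cball. Qed.

Lemma measurable_neq0 : measurable ([set~ 0] : set (borel F)).
Proof.
apply: borel_open; rewrite openE => x /eqP x0; apply/nbhs_cballP.
have [c c0 hc] := @vabs_small R F (vabs x) ltac:(by rewrite vabs_gt0).
exists c => // y; rewrite /cball/= => h y0; move: h; rewrite y0 sub0r vabsN.
by rewrite leNgt hc.
Qed.

(** Left free for an arbitrary Haar measure; self-duality forces the value 1 in [selfdual_volO]. *)
Definition volO : R := fine (dx (cball 0 1)).

Lemma haar_cball_lty x c : c != 0 -> (dx (cball x c) < +oo)%E.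
Proof. by move=> c0; apply: (haar_compact hdx); exact: compact_cball. Qed.

Lemma haar_cball_center x c : c != 0 -> dx (cball x c) = dx (cball 0 c).
Proof.
move=> c0; rewrite -(haar_translation hdx x (measurable_cball 0 c0)).
congr (dx _); apply/seteqP; split=> [y hy|_ [y hy <-]].
  by exists (y - x); [rewrite /cball/= subr0|rewrite addrC subrK].
by move: hy; rewrite /cball/= subr0 addrC addKr.
Qed.

Lemma ball_reps_le c d ts : ball_reps c d ts -> vabs d <= vabs c.
Proof.
case=> _ _ _ surj <-; have [u hu _] := surj 0 ltac:(by rewrite vabs0 vabs_ge0).
by rewrite ler_peMl ?vabs_ge0// ler1n; case: (ts) hu.
Qed.

Lemma ball_reps_cover x c d ts : ball_reps c d ts ->
  cball x c = \bigcup_(t in [set` ts]) cball (x + t) d.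
Proof.
move=> h; have dc := ball_reps_le h; case: h => _ tin _ tsurj _.
apply/seteqP; split=> [y hy|y [t /= ht hy]].
  by have [t ht h] := tsurj (y - x) hy; exists t => //; rewrite /cball/= opprD addrA.
rewrite /cball/=; have -> : y - x = (y - (x + t)) + t by ring.
by apply: vabsD_le; [exact: le_trans hy dc|exact: tin].
Qed.

Lemma ball_reps_trivIset x c d ts : ball_reps c d ts ->
  trivIset [set` ts] (fun t => cball (x + t) d).
Proof.
move=> [_ _ tinj _ _] t u /= ht hu [y [h1 h2]]; apply: tinj => //.
have -> : t - u = (y - (x + u)) - (y - (x + t)) by ring.
exact: vabsB_le.
Qed.

Lemma haar_ball_reps x c d ts : d != 0 -> ball_reps c d ts ->
  dx (cball x c) = ((size ts)%:R%:E * dx (cball 0%R d))%E.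
Proof.
move=> d0 h.
rewrite (ball_reps_cover x h) measure_fin_bigcup//; last first.
- by move=> t _; exact: measurable_cball.
- exact: ball_reps_trivIset h.
- exact: finite_seq.
rewrite -fsbig_seq/=; last exact: reps_uniq h.
under eq_bigr do rewrite haar_cball_center//.
rewrite big_const_seq count_predT; elim: (size ts) => [|n ih]; first by rewrite mul0e.
by rewrite iterS ih -nat1r EFinD ge0_muleDl ?mul1e// lee_fin.
Qed.

(** Translation invariance reduces to comparing the balls of radii |c| and 1: the larger one is a
    disjoint union of translates of the smaller, as many as the ratio of the radii. *)
Lemma haar_cball x c : c != 0 -> dx (cball x c) = (vabs c * volO)%:E.
Proof.
move=> c0; rewrite haar_cball_center//.
have fO : dx (cball 0 1) \is a fin_num.
  by rewrite ge0_fin_numE ?measure_ge0// haar_cball_lty// oner_neq0.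
have aux b e : b != 0 -> e != 0 -> vabs e <= vabs b ->
    exists2 n : nat, n%:R * vabs e = vabs b &
      dx (cball 0 b) = (n%:R%:E * dx (cball 0%R e))%E.
  move=> b0 e0 eb; have [ts h] := exists_ball_reps e0 eb.
  by exists (size ts); [exact: reps_size h|exact: haar_ball_reps h].
have [c1|/ltW c1] := leP (vabs c) (vabs (1 : F) : R).
  have [n hn hd] := aux 1 c (oner_neq0 F) c0 c1.
  have nv : n%:R = (vabs c)^-1 :> R.
    have vc : vabs c != 0 :> R by rewrite gt_eqF// vabs_gt0.
    by apply: (mulIf vc); rewrite hn mulVf// vabs1.
  rewrite /volO hd nv -[dx (cball 0 c)]fineK ?ge0_fin_numE ?measure_ge0 ?haar_cball_lty//.
  by rewrite -EFinM/= mulVKf// gt_eqF// vabs_gt0.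
have [n hn hd] := aux c 1 c0 (oner_neq0 F) c1.
by rewrite hd -hn vabs1 mulr1 EFinM fineK.
Qed.

Lemma volO_gt0 : 0 < volO.
Proof.
rewrite /volO fine_gt0//; apply/andP; split; last by rewrite haar_cball_lty// oner_neq0.
apply: (haar_open hdx); first by apply: open_cball; exact: oner_neq0.
by exists 0; exact: cball_center.
Qed.

Lemma measurable_set1F x : measurable ([set x] : set (borel F)).
Proof.
apply: borel_closed; apply: compact_closed; last exact: compact_set1.
exact: (@metric_hausdorff R F).
Qed.

(** A function constant modulo d integrates to a finite sum. This turns the integral over b into a
    sum and gives the orthogonality relations of characters. *)
Lemma cint_cball_sum x c d ts (G : F -> cplx R) : d != 0 -> ball_reps c d ts ->
  (forall y z, cball x c y -> cball x c z -> vabs (y - z) <= vabs d -> G y = G z) ->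
  cint dx (cball x c) G = \sum_(t <- ts) (((vabs d * volO)%:C)%C * G (x + t)).
Proof.
move=> d0 h hG; have dc := ball_reps_le h.
have c0 : c != 0 by rewrite -vabs_gt0 (lt_le_trans _ dc)// vabs_gt0.
have mc := measurable_cball x c0.
have tc t : t \in ts -> cball x c (x + t).
  by move=> ht; rewrite /cball/= addrAC subrr add0r; exact: reps_in h _ ht.
transitivity (cint dx (cball x c) (fun y =>
    \sum_(t <- ts) (y \in cball (x + t) d)%:R * G (x + t))).
  apply: eq_cint => y hy; have [t ht hyt] := reps_surj h hy.
  have hyt' : vabs (y - (x + t)) <= vabs d by rewrite opprD addrA.
  rewrite (bigD1_seq t)//=; last exact: reps_uniq h.
  rewrite mem_set// mul1r big_seq_cond big1 ?addr0; first by apply: hG => //; exact: tc.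
  move=> u /andP[hu ut]; rewrite memNset ?mul0r// => hyu; case/eqP: ut.
  apply: (reps_inj h) => //.
  have -> : u - t = (y - (x + t)) - (y - (x + u)) by ring.
  exact: vabsB_le.
rewrite cint_sum//; last first.
  move=> t; apply: (@bounded_cintegrable _ _ _ _ _ _ (cmod (G (x + t)))) => //.
  - exact: haar_cball_lty.
  - apply: cmeasurableM; last exact: cmeasurable_cst.
    apply: locally_constant_cmeasurable => // y _; apply/nbhs_cballP; exists d => // z hz _.
    congr (nat_of_bool _)%:R; apply/idP/idP => /set_mem; move: hz; rewrite /cball/= => hz h1.
      by apply/mem_set; apply: vabsB_trans h1; rewrite vabsBC.
    by apply/mem_set; exact: vabsB_trans h1.
  - move=> y _; rewrite cmodM cmod_bool; case: (_ \in _); rewrite ?mul1r ?mul0r//.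
    exact: cmod_ge0.
rewrite big_seq [RHS]big_seq; apply: eq_bigr => t ht.
rewrite cint_indic// setIidr; last first.
  move=> y hy; rewrite /cball/=; have -> : y - x = (y - (x + t)) + t by ring.
  by apply: vabsD_le; [exact: le_trans hy dc|exact: reps_in h _ ht].
rewrite cint_cst; last exact: measurable_cball.
by rewrite haar_cball// mulrC.
Qed.

Lemma cint_cball_translate c a (G : F -> cplx R) : c != 0 -> vabs a <= vabs c ->
  cintegrable dx (cball 0 c) G ->
  cint dx (cball 0 c) G = cint dx (cball 0 c) (fun x => G (x + a)).
Proof.
move=> c0 ac iG; have mc := measurable_cball 0 c0.
pose phi (x : F) := x + a.
have mphi : measurable_fun (cball 0 c : set (borel F)) (phi : borel F -> borel F).
  apply: borel_measurable_fun => // x _ A /nbhs_cballP[d d0 hd].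
  apply/nbhs_cballP; exists d => // y hy; apply: hd.
  by rewrite /cball/= opprD addrACA subrr addr0.
rewrite (@cint_change _ _ _ _ _ dx dx (cball 0 c) (cball 0 c) phi (fun=> 1))//.
- by apply: eq_cint => x _; rewrite mul1r.
- by move=> x; rewrite /cball/= !subr0 => hx; exact: vabsD_le.
- move=> A mA AB; rewrite integral_cst//; last exact: mphi.
  rewrite mul1e -[LHS](haar_translation hdx (- a))//; congr (dx _).
  apply/seteqP; split=> [_ [x Ax <-]|x [_ Ax]].
    split; last by rewrite /preimage/phi/= addrC addNKr.
    move: (AB _ Ax); rewrite /cball/= !subr0 => hx.
    by rewrite addrC; exact: vabsB_le.
  by exists (phi x) => //; rewrite /phi addrCA addNr addr0.
Qed.

(** * The Haar measure under r -> a / r *)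

Section inversion.
Variable a : F.
Hypothesis a0 : a != 0.

Lemma continuous_divr (x : F) : x != 0 -> {for x, continuous (fun r : F => a / r)}.
Proof.
move=> x0 A /nbhs_cballP[c c0 hc]; apply/nbhs_cballP.
(* The first bound forces |y| = |x|; then a / y - a / x = (x - y) a / (x y) has size |x - y| |a| /
   |x|^2, which the second bound keeps below |c|. *)
have [d d0 hd] := @vabs_small R F (Num.min (vabs x) (vabs (c * x ^+ 2 / a)))
  ltac:(by rewrite lt_min !vabs_gt0 x0 !mulf_neq0 ?invr_neq0// expf_neq0).
move: hd; rewrite lt_min => /andP[dx1 dx2]; exists d => // y hy; apply: hc.
have yx : vabs y = vabs x.
  by rewrite -(subrK x y) vabsDr// (le_lt_trans hy).
have y0 : y != 0 by rewrite -vabs_gt0 yx vabs_gt0.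
rewrite /cball/=; have -> : a / y - a / x = (x - y) * (a / (y * x)).
  by field; rewrite x0 y0.
rewrite vabsM vabs_div vabsM yx vabsBC.
apply: (@le_trans _ _ (vabs (c * x ^+ 2 / a) * (vabs a / (vabs x * vabs x)))).
  rewrite ler_wpM2r ?mulr_ge0 ?invr_ge0 ?mulr_ge0 ?vabs_ge0//.
  exact: le_trans hy (ltW dx2).
rewrite -vabsM -vabs_div -vabsM; have -> // : c * x ^+ 2 / a * (a / (x * x)) = c.
by field; rewrite a0 x0.
Qed.

Let D : set (borel F) := [set~ 0].
Let phi (r : borel F) : borel F := a / r.
Let h (r : borel F) : R := vabs a * vabs r ^- 2.

Let mphi : measurable_fun D phi.
Proof.
apply: borel_measurable_fun; first exact: measurable_neq0.
by move=> x /eqP x0; exact: continuous_divr.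
Qed.

Let lch : locally_constant_on (D : set F) h.
Proof.
move=> x /eqP x0; have [d d0 hd] := @vabs_small R F (vabs x) ltac:(by rewrite vabs_gt0).
apply/nbhs_cballP; exists d => // y hy _; rewrite /h; congr (_ * _ ^- 2).
by rewrite -(subrK x y) vabsDr// (le_lt_trans hy).
Qed.

Let mh : measurable_fun D h.
Proof. by apply: locally_constant_measurable => //; exact: measurable_neq0. Qed.

Let h0 x : 0 <= h x.
Proof. by rewrite mulr_ge0 ?invr_ge0 ?exprn_ge0 ?vabs_ge0. Qed.

(** A generating family stable under intersection: balls avoiding 0, on which the absolute value is
    constant and both measures can be computed; the empty set, for intersections; {0}, to reach the
    open sets that contain 0. *)
Let small_balls : set (set (borel F)) := [set A | A = set0 \/ A = [set 0] \/
  exists c d : F, [/\ d != 0, vabs d < vabs c & A = cball c d]].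

Let small_ballsI : setI_closed small_balls.
Proof.
have cI (c d c' d' : F) : vabs d <= vabs d' -> cball c d `&` cball c' d' !=set0 ->
    cball c d `&` cball c' d' = cball c d.
  move=> dd [z [h1 h2]]; apply/setIidPl => y hy.
  apply: vabsB_trans h2; apply: le_trans dd; apply: vabsB_trans hy _.
  by rewrite vabsBC.
have not0 (c d : F) : vabs d < vabs c -> ~ cball c d 0.
  by move=> h1; rewrite /cball/= sub0r vabsN leNgt h1.
move=> A B [->|[->|[c [d [d0 cd ->]]]]]; first by rewrite set0I; left.
  move=> [->|[->|[c [d [d0 cd ->]]]]]; first by rewrite setI0; left.
    by rewrite setIid; right; left.
  by left; apply/seteqP; split=> // x [/= ->] /not0; exact.
move=> [->|[->|[c' [d' [d0' cd' ->]]]]]; first by rewrite setI0; left.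
  by left; apply/seteqP; split=> // x [/= + xE]; rewrite xE => /not0; exact.
have [->|/set0P ne] := eqVneq (cball c d `&` cball c' d') set0; first by left.
right; right; have [dd|/ltW dd] := leP (vabs d) (vabs d' : R).
  by exists c, d; split => //; exact: cI.
exists c', d'; split => //; rewrite setIC cI// setIC//.
Qed.

(* Countably many balls suffice: the radii are powers of a uniformizer and the
   centers representatives of large balls. *)
Let small_balls_basis : exists g : nat -> set F, (forall k, small_balls (g k)) /\
  forall (U : set F) x, open U -> U x -> exists2 k, g k `<=` U & g k x.
Proof.
have [pi hpi] := @exists_uniformizer R F.
have p0 n : pi ^+ n != 0 by rewrite expf_neq0// (uniformizer_neq0 hpi).
have pn0 n : pi ^- n != 0 by rewrite invr_neq0.
have p1 n : vabs (pi ^+ n) <= 1.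
  rewrite vabsX exprn_ile1 ?vabs_ge0//.
  by have [/andP[_ /ltW]] := hpi.
have ex_reps nm : exists ts, ball_reps (pi ^- nm.1) (pi ^+ nm.2) ts.
  apply: exists_ball_reps => //; apply: (le_trans (p1 _)).
  by rewrite vabsV -[leLHS]invr1 lef_pV2 ?posrE ?vabs_gt0.
have /choice[ts hts] := ex_reps.
pose V n m i := cball (nth 0 (ts (n, m)) i) (pi ^+ m).
pose W n m i : set F := if pselect (V n m i 0) then [set 0] else V n m i.
exists (fun k => if unpickle k is Some (n, m, i) then W n m i else set0); split.
  move=> k; case: unpickle => [[[n m] i]|]; last by left.
  rewrite /W; case: pselect => p /=; first by right; left.
  right; right; exists (nth 0 (ts (n, m)) i), (pi ^+ m); split => //.
  by rewrite ltNge; apply/negP => le; apply: p; rewrite /V /cball/= sub0r vabsN.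
move=> U x oU Ux.
have [c c0 hc] := (nbhs_cballP x U).1 (open_nbhs_nbhs (conj oU Ux)).
pose e := if x == 0 then vabs c else Num.min (vabs c) (vabs x).
have e0 : 0 < e.
  by rewrite /e; case: ifPn => x0; rewrite ?lt_min !vabs_gt0 ?c0.
have [m] := @expr_lt_eps R _ e (proj1 hpi) e0.
have [n hn] : exists n, vabs x <= vabs (pi ^- n).
  have [->|x0] := eqVneq x 0; first by exists 0; rewrite vabs0 vabs_ge0.
  have [|n hn] := @expr_lt_eps R _ (vabs x)^-1 (proj1 hpi).
    by rewrite invr_gt0 vabs_gt0.
  exists n; rewrite vabsV -[leLHS]invrK lef_pV2 ?posrE ?invr_gt0 ?vabs_gt0//.
  by rewrite vabsX ltW.
rewrite -vabsX => hm; have [t ht hxt] := reps_surj (hts (n, m)) hn.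
have VE : cball t (pi ^+ m) = cball x (pi ^+ m) by exact: cball_eq.
exists (pickle (n, m, index t (ts (n, m)))); rewrite pickleK /W /V nth_index// VE;
  case: pselect => p /=; move: hm; rewrite /e; case: ifPn => [/eqP xE hm|_].
- by move=> _ ->; rewrite -xE.
- by move: p; rewrite /cball/= sub0r vabsN lt_min leNgt => /negbTE ->; rewrite andbF.
- by case: p; rewrite xE; exact: cball_center.
- by rewrite lt_min => /andP[hm _] y hy; apply: hc; exact: le_trans hy (ltW hm).
- by [].
- by move: p; rewrite /cball/= sub0r vabsN lt_min leNgt => /negbTE ->; rewrite andbF.
- by case: p; rewrite xE; exact: cball_center.
- by move=> _; exact: cball_center.
Qed.

Let small_balls_gen : @measurable _ (borel F) = <<s small_balls >>.
Proof.
apply/seteqP; split; last first.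
  apply: smallest_sub; first exact: smallest_sigma_algebra.
  move=> A [->|[->|[c [d [d0 _ ->]]]]]; first exact: measurable0.
    exact: measurable_set1F.
  exact: measurable_cball.
apply: smallest_sub; first exact: smallest_sigma_algebra.
have [g [gs gb]] := small_balls_basis => U oU.
pose W k : set F := if pselect (g k `<=` U) then g k else set0.
have -> : U = \bigcup_k W k.
  apply/seteqP; split=> [x Ux|x [k _]]; last first.
    by rewrite /W; case: pselect => p //=; exact: p.
  have [k gU gx] := gb U x oU Ux; exists k => //.
  by rewrite /W; case: pselect => p.
apply: (@bigcupT_measurable _ (g_sigma_algebraType small_balls)) => k.
rewrite /W; case: pselect => p /=; last exact: measurable0.
exact: sub_sigma_algebra.
Qed.

(** Uniqueness of a measure given on an intersection-stable generating family, finite on a countable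
    cover. On the balls of the family the density |a| |r|^-2 is constant, so everything reduces to
    the preimage of one ball. *)
Lemma haar_inversion (A : set (borel F)) : measurable A -> A `<=` [set~ 0] ->
  dx A = (\int[dx]_(x in [set~ 0%R] `&` (fun r : F => a / r)%R @^-1` A)
            (vabs a * vabs x ^- 2)%:E)%E.
Proof.
move=> mA A0; have mD : measurable D := measurable_neq0.
(* With [dx] cut down to F^x both sides are measures on all Borel sets, and both vanish on {0}. *)
suff : mrestr dx mD A = wpush dx mphi mh mD h0 A.
  by rewrite /mrestr setIidl// => ->.
have [g [gs gb]] := small_balls_basis.
have small_fin B : small_balls B -> (dx (B `&` D) < +oo)%E.
  move=> [->|[->|[c [d [d0 _ ->]]]]]; first by rewrite set0I measure0.
    by rewrite setICr measure0.
  apply: le_lt_trans (haar_cball_lty c d0); apply: le_measure; rewrite ?inE//.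
  - by apply: measurableI => //; exact: measurable_cball.
  - exact: measurable_cball.
apply: (measure_unique small_balls g) => //.
- apply/seteqP; split=> // x _.
  by have [k _ gx] := gb setT x openT I; exists k.
- move=> B [->|[->|[c [d [d0 cd ->]]]]]; first by rewrite !measure0.
    rewrite /= /mrestr /wpush setICr measure0 (_ : _ `&` _ = set0) ?integral_set0//.
    apply/seteqP; split=> // r [/eqP r0]; rewrite /phi/preimage/= => /eqP.
    by rewrite mulf_eq0 invr_eq0 (negPf a0) (negPf r0).
  have c0 : c != 0 by rewrite -vabs_gt0 (le_lt_trans _ cd)// vabs_ge0.
  have vc x y : vabs y < vabs x -> cball x y `<=` [set z | vabs z = vabs x].
    by move=> yx z hz; rewrite /= -(subrK x z) vabsDr// (le_lt_trans hz).
  rewrite /= /mrestr setIidl; last first.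
    move=> z /(vc _ _ cd) /= vz z0; move: cd; rewrite -vz z0 vabs0 ltNge vabs_ge0//.
  (* The map r -> a / r exchanges the ball of center c and radius |d| with that of center a / c and
     radius |a d / c^2|, its derivative having absolute value |a| / |c|^2 there. *)
  pose c' := a / c; pose d' := a * d / c ^+ 2.
  have c'0 : c' != 0 by rewrite mulf_neq0 ?invr_neq0.
  have d'0 : d' != 0 by rewrite !mulf_neq0 ?invr_neq0 ?expf_neq0.
  have cd' : vabs d' < vabs c'.
    have -> : d' = c' * (d / c) by rewrite /c' /d'; field.
    rewrite vabsM vabs_div gtr_pMr ?vabs_gt0// ltr_pdivrMr ?vabs_gt0//.
    by rewrite mul1r.
  have BE : D `&` phi @^-1` cball c d = cball c' d'.
    apply/seteqP; split=> [x [/eqP x0]|x hx].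
      rewrite /preimage/phi/= => hx; have /= vx := vc _ _ cd _ hx.
      have vx' : vabs x = vabs c' by rewrite /c' vabs_div -vx vabs_div invf_div mulrC divfK// gt_eqF// vabs_gt0.
      rewrite /cball/=; have -> : x - c' = - (x * (a / x - c)) / c.
        by rewrite /c'; field; rewrite x0 c0.
      rewrite vabs_div vabsN vabsM vx' ler_pdivrMr ?vabs_gt0//.
      have -> : vabs d' * vabs c = vabs c' * vabs d.
        by rewrite -!vabsM; congr vabs; rewrite /c' /d'; field.
      by rewrite ler_wpM2l ?vabs_ge0.
    have /= vx := vc _ _ cd' _ hx.
    have x0 : x != 0 by rewrite -vabs_gt0 vx vabs_gt0.
    split; first exact/eqP.
    rewrite /preimage/phi/cball/=; have -> : a / x - c = - (c * (x - c')) / x.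
      by rewrite /c'; field; rewrite x0 c0.
    rewrite vabs_div vabsN vabsM vx ler_pdivrMr ?vabs_gt0//.
    have -> : vabs d * vabs c' = vabs c * vabs d'.
      by rewrite -!vabsM; congr vabs; rewrite /c' /d'; field.
    by rewrite ler_wpM2l ?vabs_ge0.
  rewrite /wpush BE haar_cball//.
  rewrite (eq_integral (cst (vabs a * vabs c' ^- 2)%:E)); last first.
    by move=> x /set_mem /(vc _ _ cd') /= vx; rewrite /h vx.
  rewrite integral_cst ?haar_cball//; last exact: measurable_cball.
  rewrite -EFinM mulrA; congr (_ * _)%:E.
  rewrite -vabsX -vabsV -!vabsM; congr vabs; rewrite /c' /d'; field.
  by rewrite a0 c0.
- by move=> k; exact: small_fin.
Qed.

End inversion.

End haar.

(** * Orthogonality relations of the additive character *)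

Section additive_character.
Context (R : realType) (F : nonarchLocalFieldType R).
Variables (psi : F -> cplx R) (dx : {measure set (borel F) -> \bar R}).
Hypotheses (hpsi : is_unitary_char psi) (psiO : has_conductor_O psi).
Hypothesis hdx : is_haar dx.
Implicit Types x y c d : F.

Lemma cmod_psi x : cmod (psi x) = 1.
Proof. by apply/(@complexI R); rewrite -normc_cmod (psi_unitary hpsi). Qed.

Lemma psi_int x : vabs x <= 1 -> psi x = 1.
Proof.
move=> hx; rewrite -[x]mulr1; apply: (psiO x).2 => //.
by rewrite /ring_of_integers/= vabs1.
Qed.

Lemma psi0 : psi 0 = 1. Proof. by rewrite psi_int// vabs0. Qed.

Lemma psi_neq0 x : psi x != 0.
Proof.
by apply/eqP => h; have := cmod_psi x; rewrite h cmod0 => /esym/eqP; rewrite oner_eq0.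
Qed.

Lemma psiN x : psi (- x) = (psi x)^-1.
Proof.
by apply: (mulfI (psi_neq0 x)); rewrite -(psiD hpsi) subrr psi0 divff// psi_neq0.
Qed.

Lemma conj_psi x : conjc (psi x) = psi (- x).
Proof.
rewrite psiN; apply: (mulfI (psi_neq0 x)); rewrite divff ?psi_neq0//.
by have := sqr_normc (psi x); rewrite (psi_unitary hpsi) expr1n => <-.
Qed.

Lemma psi_near x y : vabs (x - y) <= 1 -> psi x = psi y.
Proof. by move=> h; rewrite -(subrK y x) (psiD hpsi) psi_int// mul1r. Qed.

Lemma psi_nontrivial_ball c y : 1 < vabs (c * y) ->
  exists2 t, vabs t <= vabs c & psi (t * y) != 1.
Proof.
move=> cy; apply: contrapT => h.
have : ring_of_integers (c * y).
  apply/psiO => z hz; apply: contrapT => hz1; apply: h; exists (c * z).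
    by rewrite vabsM ler_piMr ?vabs_ge0.
  by rewrite mulrAC; exact/eqP.
by rewrite /ring_of_integers/= leNgt cy.
Qed.

(** Translating by some a in the ball with psi(a y) != 1 multiplies the integral by psi(a y) and
    leaves it unchanged. *)
Lemma cint_cball_psi c y : c != 0 -> 1 < vabs (c * y) ->
  cint dx (cball 0 c) (fun t => psi (t * y)) = 0.
Proof.
move=> c0 cy; have [a ac pa] := psi_nontrivial_ball cy.
have mc := measurable_cball 0 c0.
have y0 : y != 0.
  by apply/eqP => y0; move: cy; rewrite y0 mulr0 vabs0 ltNge ler01.
have ip : cintegrable dx (cball 0 c) (fun t => psi (t * y)).
  apply: (bounded_cintegrable (M := 1)) => //.
  - exact: haar_cball_lty.
  - apply: locally_constant_cmeasurable => // x _; apply/nbhs_cballP.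
    exists y^-1; first by rewrite invr_neq0.
    move=> z hz _; apply: psi_near; rewrite -mulrBl vabsM.
    by rewrite -ler_pdivlMr ?vabs_gt0// mul1r -vabsV.
  - by move=> x _; rewrite cmod_psi.
have := cint_cball_translate hdx c0 ac ip.
rewrite [RHS](@eq_cint R _ (borel F) dx _ _ (fun x : F => psi (a * y) * psi (x * y))); last first.
  by move=> x _; rewrite mulrDl addrC (psiD hpsi).
rewrite cintZ// => /eqP; rewrite -{1}[cint _ _ _]mul1r -subr_eq0 -mulrBl mulf_eq0.
by rewrite subr_eq0 eq_sym (negPf pa) => /eqP.
Qed.

(** Orthogonality on the finite group c O / d O. The nontrivial case is read off the integral over
    the ball, of which the sum is a multiple because psi(t y) depends on t modulo d only. *)
Lemma char_sum c d ts y : d != 0 -> ball_reps c d ts -> vabs (d * y) <= 1 ->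
  \sum_(t <- ts) psi (t * y) = (size ts)%:R * (vabs (c * y) <= 1)%R%:R.
Proof.
move=> d0 h dy; have [cy|cy] := leP (vabs (c * y)) 1.
  rewrite mulr1 big_seq (eq_bigr (fun=> 1)) => [|t ht]; last first.
    apply: psi_int; apply: le_trans cy; rewrite !vabsM ler_wpM2r ?vabs_ge0//.
    exact: reps_in h _ ht.
  by rewrite -big_seq big_const_seq count_predT iter_addr addr0.
have c0 : c != 0.
  by rewrite -vabs_gt0 (lt_le_trans _ (ball_reps_le h))// vabs_gt0.
rewrite mulr0; have := cint_cball_psi c0 cy.
rewrite (cint_cball_sum hdx d0 h); last first.
  move=> x z _ _ xz; apply: psi_near; rewrite -mulrBl; apply: le_trans dy.
  by rewrite !vabsM ler_wpM2r ?vabs_ge0.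
rewrite -mulr_sumr => /eqP; rewrite mulf_eq0 => /orP[/eqP/(congr1 (@complex.Re R))/=|].
  move=> /eqP; rewrite mulf_eq0 gt_eqF ?vabs_gt0//= gt_eqF//.
  exact: volO_gt0.
by move=> /eqP h0; rewrite -[RHS]h0; apply: eq_bigr => t _; rewrite add0r.
Qed.

End additive_character.

Section domination.
Context (R : realType) (F : nonarchLocalFieldType R).
Variables (dx : {measure set (borel F) -> \bar R}).
Hypothesis hdx : is_haar dx.

(** The minimum of 1 and |r|^-2 for r != 0: boundedness of the transforms is used near 0, the weight
    |r|^2 against the decay |s|^-4 at infinity. *)
Definition dominator (r : F) : R := if vabs r <= 1 then 1 else vabs r ^- 2.

Lemma vabs_locally_constant (x : F) : x != 0 -> \forall y \near x, vabs y = vabs x :> R.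
Proof.
move=> x0; have [d d0 hd] := @vabs_small R F (vabs x) ltac:(by rewrite vabs_gt0).
apply/nbhs_cballP; exists d => // y hy.
by rewrite -(subrK x y) vabsDr// (le_lt_trans hy).
Qed.

(** The tail |r|^-2 on |r| > 1 is dominated by the image of the indicator of O under r -> 1 / r,
    Jacobian included; so a sum of two integrable functions dominates. *)
Lemma dominator_integrable : dx.-integrable [set~ 0] (EFin \o dominator).
Proof.
have mD : measurable ([set~ 0] : set (borel F)) by exact: measurable_neq0.
have mO : measurable (cball (0 : F) 1 : set (borel F)) by apply: measurable_cball; exact: oner_neq0.
have finO : (dx (cball (0%R : F) 1%R) < +oo)%E by apply: haar_cball_lty => //; exact: oner_neq0.
have iO : dx.-integrable [set~ 0] (EFin \o (\1_(cball (0 : F) 1) : borel F -> R)).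
  apply/integrableP; split; first exact/measurable_EFinP/measurable_indic.
  rewrite (eq_integral (EFin \o (\1_(cball (0 : F) 1) : borel F -> R))); last first.
    by move=> x _ /=; rewrite ger0_norm.
  rewrite integral_indic//; apply: le_lt_trans finO; apply: le_measure; rewrite ?inE//.
  exact: measurableI.
have a0 : (1 : F) != 0 := oner_neq0 F.
pose D : set (borel F) := [set~ (0 : F)].
have mh : measurable_fun D (fun r : borel F => vabs (1 : F) * vabs (r : F) ^- 2).
  apply: locally_constant_measurable => // x /eqP x0.
  by apply: filterS (vabs_locally_constant x0) => y -> _.
have mphi : measurable_fun D (fun r : borel F => 1 / (r : F) : borel F).
  by apply: borel_measurable_fun => // x /eqP x0; exact: continuous_divr.
have h0 (r : borel F) : 0 <= vabs (1 : F) * vabs (r : F) ^- 2 :> R.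
  by rewrite mulr_ge0 ?invr_ge0 ?exprn_ge0 ?vabs_ge0.
have phiD (r : borel F) : D r -> D (1 / (r : F)).
  by move=> /eqP r0 /eqP; rewrite mul1r invr_eq0 (negPf r0).
have iI := integrable_change mD mD mphi phiD mh h0 (haar_inversion hdx a0) iO.
have := integrableD mD iO iI; apply: le_integrable => //.
  apply/measurable_EFinP; apply: locally_constant_measurable => // x /eqP x0.
  by apply: filterS (vabs_locally_constant x0) => y hy _; rewrite /dominator hy.
move=> x /eqP x0 /=; rewrite /dominator !indicE lee_fin.
have cE y : (y \in cball (0 : F) 1) = (vabs y <= 1).
  by apply/idP/idP => [/set_mem|h]; rewrite ?inE /cball/= subr0 vabs1.
rewrite !cE vabs_div vabs1 mul1r; have [x1|x1] := leP (vabs (x : F) : R) 1.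
  rewrite normr1 ger0_norm; first by rewrite lerDl mulr_ge0// invr_ge0 exprn_ge0 ?vabs_ge0.
  by rewrite addr_ge0// mulr_ge0// invr_ge0 exprn_ge0 ?vabs_ge0.
rewrite add0r [X in _ * X](_ : _ = 1) ?mulr1//.
by rewrite mul1r invf_le1 ?(ltW x1)// (lt_trans _ x1).
Qed.

End domination.

(** * The Jordan algebra in coordinates *)

Section octonions.
Context (R : realType) {F : nonarchLocalFieldType R}.
Implicit Types x y z a : oct F.

Definition oc (a b c d e f g h : F) : oct F := (mx2 a b c d, mx2 e f g h).

Lemma octE x : x = oc (x.1 0 0) (x.1 0 1) (x.1 1 0) (x.1 1 1)
                      (x.2 0 0) (x.2 0 1) (x.2 1 0) (x.2 1 1).
Proof. by case: x => A B; rewrite /oc /= -!mx2E. Qed.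

Lemma octP (P : oct F -> Prop) :
  (forall a b c d e f g h : F, P (oc a b c d e f g h)) -> forall x, P x.
Proof. by move=> hP x; rewrite [x]octE; exact: hP. Qed.

Definition oct_scale (k : F) x : oct F := (k *: x.1, k *: x.2).

(* The polar form of the norm, i.e. <x, y> = x \bar y + y \bar x. *)
Definition oct_pair x y : F := \tr (x.1 *m \adj y.1) - \tr (x.2 *m \adj y.2).

Lemma adj_mx2 (a b c d : F) : \adj (mx2 a b c d) = mx2 d (- b) (- c) a.
Proof.
apply/matrixP => i j; rewrite !mxE /cofactor !det_mx11 !mxE.
by case: i => [[|[|[]]]] // ?; case: j => [[|[|[]]]] // ? /=;
  rewrite -signr_odd /= ?expr0 ?expr1 ?mulN1r ?mul1r.
Qed.

Lemma add_mx2 (a b c d a' b' c' d' : F) :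
  mx2 a b c d + mx2 a' b' c' d' = mx2 (a + a') (b + b') (c + c') (d + d').
Proof. by apply/matrixP => i j; rewrite !mxE; case: ifP => _; case: ifP. Qed.

Lemma opp_mx2 (a b c d : F) : - mx2 a b c d = mx2 (- a) (- b) (- c) (- d).
Proof. by apply/matrixP => i j; rewrite !mxE; case: ifP => _; case: ifP. Qed.

Lemma scale_mx2 (k a b c d : F) :
  k *: mx2 a b c d = mx2 (k * a) (k * b) (k * c) (k * d).
Proof. by apply/matrixP => i j; rewrite !mxE; case: ifP => _; case: ifP. Qed.

Lemma tr_mx2 (a b c d : F) : \tr (mx2 a b c d) = a + d.
Proof. by rewrite /mxtrace !big_ord_recl big_ord0 !mxE /= addr0. Qed.

Lemma oc_mul (a b c d e f g h a' b' c' d' e' f' g' h' : F) :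
  oct_mul (oc a b c d e f g h) (oc a' b' c' d' e' f' g' h') =
  oc (a * a' + b * c' + (h' * e - f' * g)) (a * b' + b * d' + (h' * f - f' * h))
     (c * a' + d * c' + (e' * g - g' * e)) (c * b' + d * d' + (e' * h - g' * f))
     (e' * a + f' * c + (e * d' - f * c')) (e' * b + f' * d + (f * a' - e * b'))
     (g' * a + h' * c + (g * d' - h * c')) (g' * b + h' * d + (h * a' - g * b')).
Proof.
rewrite /oct_mul /oc /= !adj_mx2 !mul_mx2 !add_mx2.
by congr (mx2 _ _ _ _, mx2 _ _ _ _); ring.
Qed.

Lemma oc_conj (a b c d e f g h : F) : oct_conj (oc a b c d e f g h) =
  oc d (- b) (- c) a (- e) (- f) (- g) (- h).
Proof. by rewrite /oct_conj /oc /= adj_mx2 opp_mx2. Qed.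

Lemma oc_add (a b c d e f g h a' b' c' d' e' f' g' h' : F) :
  oc a b c d e f g h + oc a' b' c' d' e' f' g' h' =
  oc (a + a') (b + b') (c + c') (d + d') (e + e') (f + f') (g + g') (h + h').
Proof. by rewrite /oc -!add_mx2. Qed.

Lemma oc_scale (k a b c d e f g h : F) : oct_scale k (oc a b c d e f g h) =
  oc (k * a) (k * b) (k * c) (k * d) (k * e) (k * f) (k * g) (k * h).
Proof. by rewrite /oct_scale /oc /= !scale_mx2. Qed.

Lemma oc_pair (a b c d e f g h a' b' c' d' e' f' g' h' : F) :
  oct_pair (oc a b c d e f g h) (oc a' b' c' d' e' f' g' h') =
  a * d' - b * c' - c * b' + d * a' - (e * h' - f * g' - g * f' + h * e').
Proof. by rewrite /oct_pair /oc /= !adj_mx2 !mul_mx2 !tr_mx2; ring. Qed.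

Lemma oc_one : oct_one = oc 1 0 0 1 0 0 0 0.
Proof.
congr (_, _); apply/matrixP => i j; rewrite !mxE;
  by case: i => [[|[|[]]]] // ?; case: j => [[|[|[]]]] // ?.
Qed.

Definition ocE := (oc_mul, oc_conj, oc_add, oc_scale, oc_pair, oc_one).

End octonions.

Local Notation o0 := (0%R : 'I_3).
Local Notation o1 := (1%R : 'I_3).
Local Notation o2 := (2%:R%R : 'I_3).

Section albert.
Context (R : realType) {F : nonarchLocalFieldType R}.
Hypothesis two0 : (2 : F) != 0.
Implicit Types (p q r a : oct F) (X Y : omx F).

(** Coordinates on [jordan]: p, q, r are the entries (1,2), (1,3), (2,3). With octonions written out
    by [oc], identities in the Jordan algebra become polynomial identities over [F]. *)
Definition jmk (x1 x2 x3 : F) p q r : omx F := \matrix_(i, j)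
  if i == o0 then (if j == o0 then oct_scale x1 oct_one else if j == o1 then p else q)
  else if i == o1 then
    (if j == o0 then oct_conj p else if j == o1 then oct_scale x2 oct_one else r)
  else (if j == o0 then oct_conj q else if j == o1 then oct_conj r
        else oct_scale x3 oct_one).

Lemma ord3P (P : 'I_3 -> Prop) : P o0 -> P o1 -> P o2 -> forall i, P i.
Proof.
move=> h0 h1 h2 [[|[|[|//]]] h]; first by rewrite (_ : Ordinal h = o0)//; exact/val_inj.
  by rewrite (_ : Ordinal h = o1)//; exact/val_inj.
by rewrite (_ : Ordinal h = o2)//; exact/val_inj.
Qed.

Definition jd (i : 'I_3) X : F := (X i i).1 0 0.

Lemma oct_conjK p : oct_conj (oct_conj p) = p.
Proof. by rewrite [p]octE !ocE; congr oc; ring. Qed.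

Lemma oct_conj_scale_one k : oct_conj (oct_scale k oct_one) = oct_scale k oct_one :> oct F.
Proof. by rewrite !ocE; congr oc; ring. Qed.

Lemma jordan_jmk x1 x2 x3 p q r : jordan F (jmk x1 x2 x3 p q r).
Proof.
by elim/ord3P; elim/ord3P; rewrite !mxE /= ?oct_conjK ?oct_conj_scale_one.
Qed.

(** A diagonal entry equals its own conjugate, and 2 being invertible this leaves multiples of
    [oct_one] only. *)
Lemma jmkE X : jordan F X ->
  X = jmk (jd o0 X) (jd o1 X) (jd o2 X) (X o0 o1) (X o0 o2) (X o1 o2).
Proof.
move=> JX.
have dE i : X i i = oct_scale (jd i X) oct_one.
  have := JX i i; rewrite /jd [X i i]octE !ocE /= => -[].
  move=> /matrixP m1 /matrixP m2.
  have := (m1 0 0, m1 0 1, m1 1 0, m1 1 1).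
  have := (m2 0 0, m2 0 1, m2 1 0, m2 1 1); rewrite !mxE /=.
  have two t : t = - t -> t = 0 :> F.
    move=> h; have /eqP : 2 * t = 0 by rewrite mulr_natl mulr2n {1}h addNr.
    by rewrite mulf_eq0 (negPf two0) => /eqP.
  move=> [[[/two -> /two ->] /two ->] /two ->] [[[-> /two ->] /two ->] _].
  by rewrite !mulr0 !mulr1.
apply/matrixP; elim/ord3P; elim/ord3P; rewrite !mxE /= -?dE//; exact: JX.
Qed.

Lemma jprod_sumE X Y i j : jprod X Y i j = oct_scale 2^-1
  (\sum_k oct_mul (X i k) (Y k j) + \sum_k oct_mul (Y i k) (X k j)).
Proof.
have mulE (A B : omx F) : omx_mul A B i j = \sum_k oct_mul (A i k) (B k j).
  by rewrite /omx_mul mxE.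
have -> : jprod X Y i j = oct_scale 2^-1 ((omx_mul X Y + omx_mul Y X) i j).
  by rewrite /jprod /omx_scale mxE.
have -> : (omx_mul X Y + omx_mul Y X) i j = omx_mul X Y i j + omx_mul Y X i j.
  by rewrite mxE.
by rewrite !mulE.
Qed.

Lemma jprodE X Y i j : jprod X Y i j = oct_scale 2^-1
  (oct_mul (X i o0) (Y o0 j) + oct_mul (X i o1) (Y o1 j) + oct_mul (X i o2) (Y o2 j)
  + (oct_mul (Y i o0) (X o0 j) + oct_mul (Y i o1) (X o1 j) + oct_mul (Y i o2) (X o2 j))).
Proof.
have sum3 (f : 'I_3 -> oct F) : \sum_k f k = f o0 + f o1 + f o2.
  rewrite !big_ord_recl big_ord0 addr0 addrA.
  by congr (_ + f _ + f _); exact/val_inj.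
by rewrite jprod_sumE !sum3.
Qed.

Lemma jmk_entry x1 x2 x3 p q r : let X := jmk x1 x2 x3 p q r in
  (X o0 o0 = oct_scale x1 oct_one) * (X o0 o1 = p) * (X o0 o2 = q) *
  (X o1 o0 = oct_conj p) * (X o1 o1 = oct_scale x2 oct_one) * (X o1 o2 = r) *
  (X o2 o0 = oct_conj q) * (X o2 o1 = oct_conj r) * (X o2 o2 = oct_scale x3 oct_one).
Proof. by rewrite /= /jmk !mxE. Qed.

Lemma jprod_jmk x1 x2 x3 p q r y1 y2 y3 p' q' r' :
  jprod (jmk x1 x2 x3 p q r) (jmk y1 y2 y3 p' q' r') =
  jmk (x1 * y1 + 2^-1 * (oct_pair p p' + oct_pair q q'))
      (x2 * y2 + 2^-1 * (oct_pair p p' + oct_pair r r'))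
      (x3 * y3 + 2^-1 * (oct_pair q q' + oct_pair r r'))
      (oct_scale 2^-1 (oct_scale (x1 + x2) p' + oct_scale (y1 + y2) p +
        (oct_mul q (oct_conj r') + oct_mul q' (oct_conj r))))
      (oct_scale 2^-1 (oct_scale (x1 + x3) q' + oct_scale (y1 + y3) q +
        (oct_mul p r' + oct_mul p' r)))
      (oct_scale 2^-1 (oct_scale (x2 + x3) r' + oct_scale (y2 + y3) r +
        (oct_mul (oct_conj p) q' + oct_mul (oct_conj p') q))).
Proof.
apply/matrixP => i j; rewrite jprodE; move: i j; apply: ord3P; apply: ord3P; rewrite !jmk_entry.
all: elim/octP: p => a b c d e f g h; elim/octP: q => a1 b1 c1 d1 e1 f1 g1 h1.
all: elim/octP: r => a2 b2 c2 d2 e2 f2 g2 h2; elim/octP: p' => a' b' c' d' e' f' g' h'.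
all: elim/octP: q' => a1' b1' c1' d1' e1' f1' g1' h1'.
all: elim/octP: r' => a2' b2' c2' d2' e2' f2' g2' h2'.
all: rewrite !ocE; congr oc.
all: by field.
Qed.

End albert.

(** * Automorphisms of the Jordan algebra: exponentials and permutations *)

Section albert_automorphisms.
Context (R : realType) {F : nonarchLocalFieldType R}.
Hypothesis two0 : (2 : F) != 0.
Implicit Types (p q r a : oct F) (X Y : omx F).

(* The exponential of the nilpotent derivation X |-> AX - XA, where A is the
   skew-Hermitian matrix with A_12 = a, for a null octonion a. *)
Definition jexp a X : omx F :=
  let alpha := oct_pair a (X o0 o1) in
  jmk (jd o0 X + alpha) (jd o1 X - alpha) (jd o2 X)
    (X o0 o1 + oct_scale (jd o1 X - jd o0 X - alpha) a)
    (X o0 o2 + oct_mul a (X o1 o2)) (X o1 o2 - oct_mul (oct_conj a) (X o0 o2)).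

(* Two complementary totally isotropic subspaces of the octonions. *)
Definition oct_upper (a b e f : F) : oct F := oc a b 0 0 e f 0 0.
Definition oct_lower (c d g h : F) : oct F := oc 0 0 c d 0 0 g h.

Lemma jd_jmk x1 x2 x3 p q r : let X := jmk x1 x2 x3 p q r in
  (jd o0 X = x1) * (jd o1 X = x2) * (jd o2 X = x3).
Proof. by rewrite /= /jd !jmk_entry /= !mxE !mulr1. Qed.

Lemma jexp_jmk a x1 x2 x3 p q r : let alpha := oct_pair a p in
  jexp a (jmk x1 x2 x3 p q r) = jmk (x1 + alpha) (x2 - alpha) x3
    (p + oct_scale (x2 - x1 - alpha) a) (q + oct_mul a r) (r - oct_mul (oct_conj a) q).
Proof. by rewrite /jexp !jd_jmk !jmk_entry. Qed.

Lemma oc_opp (a b c d e f g h : F) : - oc a b c d e f g h =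
  oc (- a) (- b) (- c) (- d) (- e) (- f) (- g) (- h).
Proof. by rewrite /oc -!opp_mx2. Qed.

(** Null octonions of a special form: four free coordinates and vanishing norm by shape. This keeps
    identities polynomial without a side condition, and the two halves together contain a basis of
    the octonions. *)
Definition isotropic_oct a := (exists b c e f, a = oct_upper b c e f) \/
  (exists b c e f, a = oct_lower b c e f).

(** Expected of the exponential of a derivation; it is checked here as an identity in 52 scalar
    coordinates and four parameters, in which the nullity of a is built in. *)
Lemma jexp_jprod a X Y : isotropic_oct a -> jordan F X -> jordan F Y ->
  jexp a (jprod X Y) = jprod (jexp a X) (jexp a Y).
Proof.
move=> ha /(jmkE two0) -> /(jmkE two0) ->.
move: (jd _ X) (jd _ X) (jd _ X) (jd _ Y) (jd _ Y) (jd _ Y).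
move: (X o0 o1) (X o0 o2) (X o1 o2) (Y o0 o1) (Y o0 o2) (Y o1 o2).
move=> p q r p' q' r' x1 x2 x3 y1 y2 y3.
rewrite !jexp_jmk !(jprod_jmk two0) !jexp_jmk; congr jmk.
all: elim/octP: p => p1 p2 p3 p4 p5 p6 p7 p8; elim/octP: q => q1 q2 q3 q4 q5 q6 q7 q8.
all: elim/octP: r => r1 r2 r3 r4 r5 r6 r7 r8; elim/octP: p' => s1 s2 s3 s4 s5 s6 s7 s8.
all: elim/octP: q' => t1 t2 t3 t4 t5 t6 t7 t8; elim/octP: r' => u1 u2 u3 u4 u5 u6 u7 u8.
all: case: ha => -[a1 [a2 [a3 [a4 ->]]]]; rewrite /oct_upper /oct_lower !(ocE, oc_opp).
all: try congr oc.
all: by field.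
Qed.

End albert_automorphisms.

Section albert_group.
Context (R : realType) {F : nonarchLocalFieldType R}.
Hypothesis two0 : (2 : F) != 0.
Implicit Types (p q r a : oct F) (X Y : omx F).

Lemma isotropic_scale k a : isotropic_oct a -> isotropic_oct (oct_scale k a).
Proof.
move=> [[b [c [e [f ->]]]]|[b [c [e [f ->]]]]]; [left|right];
  exists (k * b), (k * c), (k * e), (k * f);
  by rewrite /oct_upper /oct_lower oc_scale !mulr0.
Qed.

Lemma isotropic_opp a : isotropic_oct a -> isotropic_oct (- a).
Proof.
move=> [[b [c [e [f ->]]]]|[b [c [e [f ->]]]]]; [left|right];
  exists (- b), (- c), (- e), (- f);
  by rewrite /oct_upper /oct_lower oc_opp !oppr0.
Qed.

Lemma jordan_jexp a X : jordan F (jexp a X).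
Proof. exact: jordan_jmk. Qed.

Lemma oc_zero : (0 : oct F) = oc 0 0 0 0 0 0 0 0.
Proof.
have h0 : (0 : 'M[F]_2) = mx2 0 0 0 0.
  by apply/matrixP => i j; rewrite !mxE; case: ifP => _; case: ifP.
by rewrite /oc -!h0.
Qed.

Lemma albert_ind (P : omx F -> Prop) :
  (forall x1 x2 x3 p q r, P (jmk x1 x2 x3 p q r)) -> forall X, jordan F X -> P X.
Proof. by move=> hP X /(jmkE two0) ->; exact: hP. Qed.

Lemma jmk_add x1 x2 x3 p q r y1 y2 y3 p' q' r' :
  jmk x1 x2 x3 p q r + jmk y1 y2 y3 p' q' r' =
  jmk (x1 + y1) (x2 + y2) (x3 + y3) (p + p') (q + q') (r + r') :> omx F.
Proof.
have addE (A B : omx F) i j : (A + B) i j = A i j + B i j by rewrite mxE.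
have cD (u v : oct F) : oct_conj u + oct_conj v = oct_conj (u + v).
  elim/octP: u => *; elim/octP: v => *; rewrite !ocE; congr oc; ring.
have sD (k l : F) : oct_scale k oct_one + oct_scale l oct_one =
    oct_scale (k + l) oct_one by rewrite !ocE; congr oc; ring.
apply/matrixP => i j; rewrite addE; move: i j.
by apply: ord3P; apply: ord3P; rewrite !jmk_entry.
Qed.

Lemma jmk_scale k x1 x2 x3 p q r : omx_scale k (jmk x1 x2 x3 p q r) =
  jmk (k * x1) (k * x2) (k * x3) (oct_scale k p) (oct_scale k q) (oct_scale k r) :> omx F.
Proof.
have sE (A : omx F) i j : omx_scale k A i j = oct_scale k (A i j) by rewrite mxE.
have cS (u : oct F) : oct_scale k (oct_conj u) = oct_conj (oct_scale k u).
  elim/octP: u => *; rewrite !ocE; congr oc; ring.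
have sS (l : F) : oct_scale k (oct_scale l oct_one) = oct_scale (k * l) oct_one.
  by rewrite !ocE; congr oc; ring.
apply/matrixP => i j; rewrite sE; move: i j.
by apply: ord3P; apply: ord3P; rewrite !jmk_entry.
Qed.

Lemma jmk0 : (0 : omx F) = jmk 0 0 0 0 0 0.
Proof.
have zE i j : (0 : omx F) i j = 0 by rewrite mxE.
have c0 : oct_conj (0 : oct F) = 0 by rewrite oc_zero !ocE; congr oc; ring.
have s0 : oct_scale 0 oct_one = 0 :> oct F by rewrite oc_zero !ocE; congr oc; ring.
apply/matrixP => i j; rewrite zE; move: i j.
by apply: ord3P; apply: ord3P; rewrite !jmk_entry.
Qed.

Lemma jmk_one : omx_one = jmk 1 1 1 0 0 0 :> omx F.
Proof.
have zE i j : (omx_one : omx F) i j = if i == j then oct_one else 0 by rewrite mxE.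
have c0 : oct_conj (0 : oct F) = 0 by rewrite oc_zero !ocE; congr oc; ring.
have s1 : oct_scale 1 oct_one = oct_one :> oct F by rewrite !ocE; congr oc; ring.
apply/matrixP => i j; rewrite zE; move: i j.
by apply: ord3P; apply: ord3P; rewrite !jmk_entry.
Qed.

Lemma jmk_je : je F = jmk 1 0 0 0 0 0 :> omx F.
Proof.
have zE i j : (je F : omx F) i j = if (i == 0) && (j == 0) then oct_one else 0.
  by rewrite mxE.
have c0 : oct_conj (0 : oct F) = 0 by rewrite oc_zero !ocE; congr oc; ring.
have s1 : oct_scale 1 oct_one = oct_one :> oct F by rewrite !ocE; congr oc; ring.
have s0 : oct_scale 0 oct_one = 0 :> oct F by rewrite oc_zero !ocE; congr oc; ring.
apply/matrixP => i j; rewrite zE; move: i j.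
by apply: ord3P; apply: ord3P; rewrite !jmk_entry.
Qed.

Lemma jtr_jmk x1 x2 x3 p q r : jtr (jmk x1 x2 x3 p q r) = x1 + x2 + x3 :> F.
Proof.
have reE k : oct_re (oct_scale k oct_one) = k :> F.
  by rewrite !ocE /oct_re /oc /= tr_mx2; field.
rewrite /jtr !big_ord_recl big_ord0 addr0 addrA.
have -> : lift (ord0 : 'I_3) ord0 = o1 by exact/val_inj.
have -> : lift (ord0 : 'I_3) (lift ord0 ord0) = o2 by exact/val_inj.
by rewrite !jmk_entry !reE.
Qed.

Lemma jpair_je X : jordan F X -> jpair (je F) X = jd o0 X.
Proof.
elim/albert_ind => x1 x2 x3 p q r.
have pair0 (u : oct F) : oct_pair 0 u = 0 by elim/octP: u => *; rewrite oc_zero !ocE; ring.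
rewrite /jpair jmk_je (jprod_jmk two0) jtr_jmk jd_jmk !pair0; ring.
Qed.

Lemma jordanD X Y : jordan F X -> jordan F Y -> jordan F (X + Y).
Proof.
elim/albert_ind => x1 x2 x3 p q r; elim/albert_ind => *; rewrite jmk_add; exact: jordan_jmk.
Qed.

Lemma jordanZ k X : jordan F X -> jordan F (omx_scale k X).
Proof. elim/albert_ind => *; rewrite jmk_scale; exact: jordan_jmk. Qed.

Lemma jordan_jprod X Y : jordan F X -> jordan F Y -> jordan F (jprod X Y).
Proof.
elim/albert_ind => x1 x2 x3 p q r; elim/albert_ind => *; rewrite (jprod_jmk two0); exact: jordan_jmk.
Qed.

Lemma jordan_one : jordan F omx_one.
Proof. rewrite jmk_one; exact: jordan_jmk. Qed.

Lemma jprod_scale k l X Y : jordan F X -> jordan F Y ->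
  jprod (omx_scale k X) (omx_scale l Y) = omx_scale (k * l) (jprod X Y).
Proof.
elim/albert_ind => x1 x2 x3 p q r; elim/albert_ind => y1 y2 y3 p' q' r'.
rewrite !(jprod_jmk two0, jmk_scale).
elim/octP: p => *; elim/octP: q => *; elim/octP: r => *.
elim/octP: p' => *; elim/octP: q' => *; elim/octP: r' => *.
rewrite !ocE; congr jmk; try congr oc; ring.
Qed.

Lemma jtr_scale k X : jordan F X -> jtr (omx_scale k X) = k * jtr X.
Proof. elim/albert_ind => *; rewrite jmk_scale !jtr_jmk; ring. Qed.

Lemma omx_scaleA k l X : omx_scale k (omx_scale l X) = omx_scale (k * l) X.
Proof. by apply/matrixP => i j; rewrite !mxE /= !scalerA. Qed.

Lemma omx_scale1 X : omx_scale 1 X = X.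
Proof. by apply/matrixP => i j; rewrite !mxE /= !scale1r -surjective_pairing. Qed.

Lemma omx_scaleDr k X Y : omx_scale k (X + Y) = omx_scale k X + omx_scale k Y.
Proof. by apply/matrixP => i j; rewrite !mxE /= !scalerDr. Qed.

Lemma omx_scaleN X : omx_scale (-1) X = - X.
Proof. by apply/matrixP => i j; rewrite !mxE /= !scaleN1r. Qed.

Lemma omx_scaler0 k : omx_scale k (0 : omx F) = 0.
Proof. by apply/matrixP => i j; rewrite !mxE /= !scaler0. Qed.

(** The adjoint rearranged into nested terms [omx_scale k X + Y], the shape in which linearity of
    group elements is stated. *)
Lemma jadjE X : jadj X = omx_scale (2%:R^-1 * (jtr X ^+ 2 - jtr (jprod X X))) omx_one
  + (omx_scale (- jtr X) X + jprod X X).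
Proof.
rewrite /jadj addrC; congr (_ + _); rewrite addrC; congr (_ + _).
by rewrite -omx_scaleN omx_scaleA mulN1r.
Qed.

Lemma jadj_scale k X : jordan F X -> jadj (omx_scale k X) = omx_scale (k ^+ 2) (jadj X).
Proof.
move=> JX; rewrite (jadjE (omx_scale k X)) (jadjE X) (jprod_scale k k JX JX).
rewrite (jtr_scale k JX) (jtr_scale (k * k) (jordan_jprod JX JX)).
move: (jtr X) (jtr (jprod X X)) (jprod X X) => t u Y.
rewrite !omx_scaleDr !omx_scaleA.
by congr (omx_scale _ _ + (omx_scale _ _ + omx_scale _ _)); ring.
Qed.

Lemma Omega_scale k X : k != 0 -> Omega F X -> Omega F (omx_scale k X).
Proof.
move=> k0 [JX X0 aX]; split; first exact: jordanZ.
  apply: contra_neq X0 => h; rewrite -[X]omx_scale1 -(mulVf k0) -omx_scaleA h.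
  exact: omx_scaler0.
by rewrite jadj_scale// aX omx_scaler0.
Qed.

(** The product, trace and unit determine the adjoint, so these three invariances show that [g]
    preserves [Omega] and each [Omega_ c]. *)
Record albert_aut (g : omx F -> omx F) : Prop := {
  aut_F4 : F4 g ;
  aut_tr : forall X, jordan F X -> jtr (g X) = jtr X ;
  aut_one : g omx_one = omx_one }.

Lemma aut_jordan g X : albert_aut g -> jordan F X -> jordan F (g X).
Proof. by move=> [[[[hg _ _] _] _] _ _]; exact: hg. Qed.

Lemma aut_linear g k X Y : albert_aut g -> jordan F X -> jordan F Y ->
  g (omx_scale k X + Y) = omx_scale k (g X) + g Y.
Proof. by move=> [[[_ hg] _] _ _]; exact: hg. Qed.

Lemma aut0 g : albert_aut g -> g 0 = 0.
Proof.
move=> hg; have J0 : jordan F 0 by rewrite jmk0; exact: jordan_jmk.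
have := aut_linear (-1) hg J0 J0.
by rewrite !omx_scaleN oppr0 addr0 addNr.
Qed.

Lemma aut_jprod g X Y : albert_aut g -> jordan F X -> jordan F Y ->
  g (jprod X Y) = jprod (g X) (g Y).
Proof. by move=> [[_ hg] _ _]; exact: hg. Qed.

Lemma aut_jadj g X : albert_aut g -> jordan F X -> jadj (g X) = g (jadj X).
Proof.
move=> hg JX; have JXX := jordan_jprod JX JX.
rewrite (jadjE (g X)) (jadjE X).
rewrite (aut_linear _ hg jordan_one (jordanD (jordanZ _ JX) JXX)).
rewrite (aut_linear _ hg JX JXX) (aut_one hg) -(aut_jprod hg JX JX).
by rewrite (aut_tr hg JX) (aut_tr hg JXX).
Qed.

Lemma aut_Omega g X : albert_aut g -> Omega F X -> Omega F (g X).
Proof.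
move=> hg [JX X0 aX]; split; first exact: aut_jordan.
  have J0 : jordan F 0 by rewrite jmk0; exact: jordan_jmk.
  have [[[[_ ginj _] _] _] _ _] := hg.
  by apply: contra_neq X0 => h; apply: ginj; rewrite ?inE// h aut0.
by rewrite aut_jadj// aX aut0.
Qed.

Lemma aut_Omega_ g c X : albert_aut g -> Omega_ c X -> Omega_ c (g X).
Proof.
move=> hg [OX tX]; split; first exact: aut_Omega.
by rewrite aut_tr//; case: OX.
Qed.

Lemma jexpNK a X : isotropic_oct a -> jordan F X -> jexp (- a) (jexp a X) = X.
Proof.
move=> ha; elim/albert_ind => x1 x2 x3 p q r; rewrite !jexp_jmk.
case: ha => -[b [c [e [f ->]]]].
  elim/octP: p => *; elim/octP: q => *; elim/octP: r => *.
  rewrite /oct_upper !(ocE, oc_opp); congr jmk; try congr oc; ring.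
elim/octP: p => *; elim/octP: q => *; elim/octP: r => *.
rewrite /oct_lower !(ocE, oc_opp); congr jmk; try congr oc; ring.
Qed.

Lemma jexp_aut a : isotropic_oct a -> albert_aut (jexp a).
Proof.
move=> ha; split.
- split; last by move=> X Y; exact: jexp_jprod.
  split.
    split.
    + by move=> X _; exact: jordan_jexp.
    + move=> X Y /set_mem JX /set_mem JY h.
      by rewrite -(jexpNK ha JX) h jexpNK.
    + move=> X JX; exists (jexp (- a) X); first exact: jordan_jexp.
      by rewrite -{1}[a]opprK jexpNK//; exact: isotropic_opp.
  move=> k X Y; elim/albert_ind => x1 x2 x3 p q r.
  elim/albert_ind => y1 y2 y3 p' q' r'.
  rewrite !(jmk_scale, jmk_add, jexp_jmk).
  elim/octP: a {ha} => *.
  elim/octP: p => *; elim/octP: q => *; elim/octP: r => *.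
  elim/octP: p' => *; elim/octP: q' => *; elim/octP: r' => *.
  rewrite !(ocE, oc_opp); congr jmk; try congr oc; ring.
- move=> X; elim/albert_ind => x1 x2 x3 p q r; rewrite jexp_jmk !jtr_jmk; ring.
- rewrite jmk_one jexp_jmk; elim/octP: a {ha} => *; rewrite !oc_zero.
  rewrite !(ocE, oc_opp); congr jmk; try congr oc; ring.
Qed.

(** Conjugation by a permutation matrix. *)
Definition jperm (s : 'I_3 -> 'I_3) X : omx F := \matrix_(i, j) X (s i) (s j).

Lemma jperm_aut s : injective s -> albert_aut (jperm s).
Proof.
move=> sI; have [t st ts] := injF_bij sI.
have pE X i j : jperm s X i j = X (s i) (s j) by rewrite mxE.
have ptE X i j : jperm t X i j = X (t i) (t j) by rewrite mxE.
split.
- split; last first.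
    move=> X Y _ _; apply/matrixP => i j.
    have sumE (A B : omx F) : \sum_k oct_mul (A (s i) k) (B k (s j)) =
        \sum_k oct_mul (jperm s A i k) (jperm s B k j).
      rewrite (reindex_inj sI); apply: eq_bigr => k _.
      by congr (oct_mul _ _); exact/esym/pE.
    transitivity (jprod X Y (s i) (s j)); first exact: pE.
    transitivity (oct_scale 2^-1 (\sum_k oct_mul (X (s i) k) (Y k (s j)) +
      \sum_k oct_mul (Y (s i) k) (X k (s j)))); first exact: jprod_sumE.
    by rewrite (sumE X Y) (sumE Y X); symmetry; exact: jprod_sumE.
  split.
    split.
    + by move=> X JX i j; rewrite !pE; exact: JX.
    + move=> X Y _ _ h; apply/matrixP => i j.
      by have := congr1 (fun Z : omx F => Z (t i) (t j)) h; rewrite /= !pE !ts.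
    + move=> X JX; exists (jperm t X); first by move=> i j; rewrite !ptE; exact: JX.
      by apply/matrixP => i j; rewrite pE ptE !st.
  by move=> k X Y _ _; apply/matrixP => i j; rewrite !mxE.
- move=> X _; rewrite /jtr [RHS](reindex_inj sI); apply: eq_bigr => i _.
  by rewrite pE.
- have oE i j : (omx_one : omx F) i j = if i == j then oct_one else 0 by rewrite mxE.
  by apply/matrixP => i j; rewrite pE !oE (inj_eq sI).
Qed.

(** The adjoint of x times the identity is x^2 times the identity. *)
Lemma Omega_scalar x : ~ Omega F (jmk x x x 0 0 0).
Proof.
have pair0 : oct_pair 0 0 = 0 :> F by rewrite oc_zero !ocE; ring.
move=> [_ X0]; rewrite jadjE jtr_jmk (jprod_jmk two0) jtr_jmk !pair0 jmk_one.
rewrite !jmk_scale !jmk_add => /(congr1 (jd o0)).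
rewrite jd_jmk jmk0 jd_jmk => h.
have xx : x ^+ 2 = 0 by rewrite -h; field.
case/eqP: X0; move/eqP: xx; rewrite expf_eq0 => /andP[_ /eqP ->].
by rewrite -jmk0.
Qed.

End albert_group.

(** * Continuity of the algebraic operations *)

Section field_limits.
Context (R : realType) (F : nonarchLocalFieldType R).
Context (I : Type) (G : set_system I) (FG : Filter G).
Implicit Types (f g : I -> F) (x y : F).

Lemma cvgFP f x : f @ G --> x <->
  forall c : F, c != 0 -> \forall i \near G, vabs (f i - x) <= vabs c.
Proof.
split=> [h c c0|h A /nbhs_cballP[c c0 hc]]; first exact: h (nbhs_cball x c0).
by have := h c c0; apply: filterS => i hi; exact: hc.
Qed.

Lemma cvgFD f g x y : f @ G --> x -> g @ G --> y -> (fun i => f i + g i) @ G --> x + y.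
Proof.
move=> /cvgFP hf /cvgFP hg; apply/cvgFP => c c0.
apply: filterS2 (hf c c0) (hg c c0) => i h1 h2.
by rewrite opprD addrACA; exact: vabsD_le.
Qed.

Lemma cvgFN f x : f @ G --> x -> (fun i => - f i) @ G --> - x.
Proof.
move=> /cvgFP hf; apply/cvgFP => c c0; apply: filterS (hf c c0) => i.
by rewrite -opprD vabsN.
Qed.

Lemma cvgFM f g x y : f @ G --> x -> g @ G --> y -> (fun i => f i * g i) @ G --> x * y.
Proof.
move=> /cvgFP hf /cvgFP hg; apply/cvgFP => c c0.
have aux (a : F) : exists2 d : F, d != 0 & forall z, vabs z <= vabs d -> vabs (z * a) <= vabs c.
  have [->|a0] := eqVneq a 0.
    by exists 1; [exact: oner_neq0|move=> z _; rewrite mulr0 vabs0 vabs_ge0].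
  exists (c / a) => [|z]; first by rewrite mulf_neq0 ?invr_neq0.
  by rewrite vabs_div vabsM ler_pdivlMr ?vabs_gt0.
have [d1 d10 h1] := aux y; have [d2 d20 h2] := aux x.
have [d3 d30 h3] : exists2 d : F, d != 0 & vabs d <= 1 /\ vabs d <= vabs c.
  have [d d0 hd] := @vabs_small R F (Num.min 1 (vabs c)) ltac:(by rewrite lt_min ltr01 vabs_gt0).
  by exists d => //; move: hd; rewrite lt_min => /andP[/ltW ? /ltW].
have [v1 vc] := h3.
near=> i.
have k1 : vabs (f i - x) <= vabs d1 by near: i; exact: hf.
have k2 : vabs (g i - y) <= vabs d2 by near: i; exact: hg.
have k3 : vabs (f i - x) <= vabs d3 by near: i; exact: hf.
have k4 : vabs (g i - y) <= vabs c by near: i; exact: hg.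
(* [d1] and [d2] control the two linear terms; [d3], of absolute value at most 1, controls the
   product of the errors. *)
have -> : f i * g i - x * y =
    (f i - x) * (g i - y) + ((f i - x) * y + (g i - y) * x) by ring.
apply: vabsD_le; last by apply: vabsD_le; [exact: h1|exact: h2].
rewrite vabsM -[leRHS]mul1r ler_pM ?vabs_ge0//.
exact: le_trans k3 v1.
Unshelve. all: by end_near. Qed.

End field_limits.

Section omx_limits.
Context (R : realType) (F : nonarchLocalFieldType R).
Context (I : Type) (G : set_system I) (FG : Filter G).

Lemma cvg_matrix (T : topologicalType) m n (f : I -> 'M[T]_(m, n)) (M : 'M[T]_(m, n)) :
  f @ G --> M <-> forall i j, (fun k => f k i j) @ G --> M i j.
Proof.
split=> [h i j A hA|h A [P hP PA]].
  have hQ : nbhs M [set N : 'M[T]_(m, n) | A (N i j)].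
    exists (fun i' j' => if (i' == i) && (j' == j) then A else setT).
      by move=> i' j'; case: ifP => [/andP[/eqP -> /eqP ->]//|_]; exact: filterT.
    by move=> N /(_ i j); rewrite !eqxx.
  exact: h _ hQ.
have : G [set l | forall k : 'I_m * 'I_n, P k.1 k.2 (f l k.1 k.2)].
  by apply: filter_forall => k; exact: (h k.1 k.2 _ (hP k.1 k.2)).
move=> hG; apply: (@filterS _ G FG _ (f @^-1` A) _ hG) => l hl.
by apply: PA => i j; exact: (hl (i, j)).
Qed.

Lemma cvg_oct (f : I -> oct F) (x : oct F) : f @ G --> x <->
  (forall i j, (fun k => (f k).1 i j) @ G --> x.1 i j) /\
  (forall i j, (fun k => (f k).2 i j) @ G --> x.2 i j).
Proof.
split=> [h|[/cvg_matrix h1 /cvg_matrix h2]].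
  by split; apply/cvg_matrix; [exact: (cvg_comp _ _ h cvg_fst)|exact: (cvg_comp _ _ h cvg_snd)].
have -> : f = (fun k => ((f k).1, (f k).2)).
  by apply/funext => k; rewrite -surjective_pairing.
by rewrite [x]surjective_pairing; exact: (@cvg_pair _ _ _ G _ _ FG _ _ _ _ h1 h2).
Qed.

Lemma cvg_oc (a b c d e f g h : I -> F) (a' b' c' d' e' f' g' h' : F) :
  a @ G --> a' -> b @ G --> b' -> c @ G --> c' -> d @ G --> d' ->
  e @ G --> e' -> f @ G --> f' -> g @ G --> g' -> h @ G --> h' ->
  (fun k => oc (a k) (b k) (c k) (d k) (e k) (f k) (g k) (h k)) @ G -->
  oc a' b' c' d' e' f' g' h'.
Proof.
move=> ha hb hc hd he hf hg hh.
have mx2_cvg (u v w z : I -> F) (u' v' w' z' : F) : u @ G --> u' -> v @ G --> v' ->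
    w @ G --> w' -> z @ G --> z' ->
    forall i j, (fun k => mx2 (u k) (v k) (w k) (z k) i j) @ G --> mx2 u' v' w' z' i j.
  move=> hu hv hw hz i j; rewrite mxE; under eq_fun do rewrite mxE.
  by case: ifP => _; case: ifP.
by apply/cvg_oct; split => i j; exact: mx2_cvg.
Qed.

Lemma cvg_octE (f : I -> oct F) (x : oct F) : f @ G --> x ->
  (forall i j, (fun k => (f k).1 i j) @ G --> x.1 i j) *
  (forall i j, (fun k => (f k).2 i j) @ G --> x.2 i j).
Proof. by move=> /cvg_oct[]. Qed.

Lemma cvg_octD (f g : I -> oct F) (x y : oct F) : f @ G --> x -> g @ G --> y ->
  (fun k => f k + g k) @ G --> x + y.
Proof.
move=> hf hg; have [f1 f2] := cvg_octE hf; have [g1 g2] := cvg_octE hg.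
rewrite [x]octE [y]octE oc_add.
under eq_fun do rewrite [f _]octE [g _]octE oc_add.
by do ?[exact: f1|exact: f2|exact: g1|exact: g2
  |apply: cvgFD|apply: cvgFN|apply: cvgFM|apply: cvg_oc].
Qed.

Lemma cvg_octN (f : I -> oct F) (x : oct F) : f @ G --> x -> (fun k => - f k) @ G --> - x.
Proof.
move=> hf; have [f1 f2] := cvg_octE hf.
rewrite [x]octE oc_opp; under eq_fun do rewrite [f _]octE oc_opp.
by do ?[exact: f1|exact: f2
  |apply: cvgFD|apply: cvgFN|apply: cvgFM|apply: cvg_oc].
Qed.

Lemma cvg_oct_scale (k : I -> F) (f : I -> oct F) (l : F) (x : oct F) : k @ G --> l -> f @ G --> x ->
  (fun i => oct_scale (k i) (f i)) @ G --> oct_scale l x.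
Proof.
move=> hk hf; have [f1 f2] := cvg_octE hf.
rewrite [x]octE oc_scale; under eq_fun do rewrite [f _]octE oc_scale.
by do ?[exact: hk|exact: f1|exact: f2
  |apply: cvgFD|apply: cvgFN|apply: cvgFM|apply: cvg_oc].
Qed.

Lemma cvg_oct_conj (f : I -> oct F) (x : oct F) : f @ G --> x ->
  (fun k => oct_conj (f k)) @ G --> oct_conj x.
Proof.
move=> hf; have [f1 f2] := cvg_octE hf.
rewrite [x]octE oc_conj; under eq_fun do rewrite [f _]octE oc_conj.
by do ?[exact: f1|exact: f2
  |apply: cvgFD|apply: cvgFN|apply: cvgFM|apply: cvg_oc].
Qed.

Lemma cvg_oct_mul (f g : I -> oct F) (x y : oct F) : f @ G --> x -> g @ G --> y ->
  (fun k => oct_mul (f k) (g k)) @ G --> oct_mul x y.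
Proof.
move=> hf hg; have [f1 f2] := cvg_octE hf; have [g1 g2] := cvg_octE hg.
rewrite [x]octE [y]octE oc_mul.
under eq_fun do rewrite [f _]octE [g _]octE oc_mul.
by apply: cvg_oc; do ?[exact: f1|exact: f2|exact: g1|exact: g2
  |apply: cvgFD|apply: cvgFN|apply: cvgFM].
Qed.

Lemma cvg_oct_pair (f g : I -> oct F) (x y : oct F) : f @ G --> x -> g @ G --> y ->
  (fun k => oct_pair (f k) (g k)) @ G --> oct_pair x y.
Proof.
move=> hf hg; have [f1 f2] := cvg_octE hf; have [g1 g2] := cvg_octE hg.
rewrite [x]octE [y]octE oc_pair.
under eq_fun do rewrite [f _]octE [g _]octE oc_pair.
by do ?[exact: f1|exact: f2|exact: g1|exact: g2
  |apply: cvgFD|apply: cvgFN|apply: cvgFM].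
Qed.

Lemma cvg_jmk (x1 x2 x3 : I -> F) (p q r : I -> oct F) (y1 y2 y3 : F) (p' q' r' : oct F) :
  x1 @ G --> y1 -> x2 @ G --> y2 -> x3 @ G --> y3 ->
  p @ G --> p' -> q @ G --> q' -> r @ G --> r' ->
  (fun k => jmk (x1 k) (x2 k) (x3 k) (p k) (q k) (r k)) @ G --> jmk y1 y2 y3 p' q' r'.
Proof.
move=> h1 h2 h3 hp hq hr; apply/cvg_matrix; apply: ord3P; apply: ord3P;
  rewrite !jmk_entry; under eq_fun do rewrite !jmk_entry.
all: do ?[assumption|exact: cvg_cst|apply: cvg_oct_conj|apply: cvg_oct_scale].
Qed.

Lemma cvg_jd (f : I -> omx F) (M : omx F) i : f @ G --> M -> (fun k => jd i (f k)) @ G --> jd i M.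
Proof. by move=> /cvg_matrix h; have [h1 _] := cvg_octE (h i i); exact: h1. Qed.

Lemma cvg_jexp (a : I -> oct F) (f : I -> omx F) (b : oct F) (M : omx F) :
  a @ G --> b -> f @ G --> M -> (fun k => jexp (a k) (f k)) @ G --> jexp b M.
Proof.
move=> ha hf; have hf' := (cvg_matrix _ _).1 hf.
have hp := hf' o0 o1; have hq := hf' o0 o2; have hr := hf' o1 o2.
have h0 := cvg_jd (i := o0) hf; have h1 := cvg_jd (i := o1) hf; have h2 := cvg_jd (i := o2) hf.
have hal := cvg_oct_pair ha hp.
have h01 := cvgFD FG (cvgFD FG h1 (cvgFN FG h0)) (cvgFN FG hal).
exact: (cvg_jmk (cvgFD FG h0 hal) (cvgFD FG h1 (cvgFN FG hal)) h2
  (cvg_octD hp (cvg_oct_scale h01 ha)) (cvg_octD hq (cvg_oct_mul ha hr))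
  (cvg_octD hr (cvg_octN (cvg_oct_mul (cvg_oct_conj ha) hq)))).
Qed.

Lemma cvg_jperm s (f : I -> omx F) (M : omx F) : f @ G --> M ->
  (fun k => jperm s (f k)) @ G --> jperm s M.
Proof.
move=> /cvg_matrix hf; apply/cvg_matrix => i j; rewrite mxE.
by under eq_fun do rewrite mxE; exact: hf.
Qed.

Lemma cvg_omx_scale (k : I -> F) (f : I -> omx F) (l : F) (M : omx F) : k @ G --> l -> f @ G --> M ->
  (fun i => omx_scale (k i) (f i)) @ G --> omx_scale l M.
Proof.
move=> hk /cvg_matrix hf; apply/cvg_matrix => i j; rewrite mxE.
by under eq_fun do rewrite mxE; exact: cvg_oct_scale.
Qed.

End omx_limits.

(** * Test functions *)

Section test_functions.
Context (R : realType) (F : nonarchLocalFieldType R) (T : ptopologicalType).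
Variable A : set T.
Implicit Types (f : T -> cplx R) (S : Type).

(* Locally constant functions on A with compact support; unlike for [Sc A],
   their values off A are irrelevant. *)
Definition test f := locally_constant_on A f /\
  exists K, [/\ compact K, K `<=` A & forall x, A x -> ~ K x -> f x = 0].

Lemma Sc_test f : Sc A f -> test f.
Proof. by move=> [_ [K [cK KA f0]] lf]; split => //; exists K; split => // x _; exact: f0. Qed.

Lemma eq_test f g : (forall x, A x -> f x = g x) -> test f -> test g.
Proof.
move=> fg [lf [K [cK KA f0]]]; split.
  by move=> x Ax; apply: filterS (lf x Ax) => y h Ay; rewrite -!fg// h.
by exists K; split => // x Ax nK; rewrite -fg// f0.
Qed.

Lemma test_Sc f : test f -> Sc A (patch (fun=> 0) A f).
Proof.
move=> [lf [K [cK KA f0]]]; split.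
- by move=> x nA; rewrite patchE memNset.
- exists K; split => // x nK; rewrite patchE; case: ifPn => // /set_mem Ax.
  exact: f0.
- move=> x Ax; apply: filterS (lf x Ax) => y h Ay.
  by rewrite /patch (mem_set Ax) (mem_set Ay) h.
Qed.

Lemma locally_constant_pair S S' (f : T -> S) (g : T -> S') S'' (op : S -> S' -> S'') :
  locally_constant_on A f -> locally_constant_on A g ->
  locally_constant_on A (fun x => op (f x) (g x)).
Proof.
move=> lf lg x Ax; apply: filterS2 (lf x Ax) (lg x Ax) => y h1 h2 Ay.
by rewrite h1// h2.
Qed.

Lemma testM f (g : T -> cplx R) : test f -> locally_constant_on A g ->
  test (fun x => f x * g x).
Proof.
move=> [lf [K [cK KA f0]]] lg; split; first exact: locally_constant_pair.
by exists K; split => // x Ax nK; rewrite f0// mul0r.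
Qed.

Lemma test_cmod f : test f -> test (fun x => ((cmod (f x))%:C)%C).
Proof.
move=> [lf [K [cK KA f0]]]; split.
  by move=> x Ax; apply: filterS (lf x Ax) => y h Ay; rewrite h.
by exists K; split => // x Ax nK; rewrite f0// cmod0.
Qed.

Lemma testD f g : test f -> test g -> test (fun x => f x + g x).
Proof.
move=> [lf [K [cK KA f0]]] [lg [K' [cK' KA' g0]]]; split.
  exact: (@locally_constant_pair _ _ f g _ +%R).
exists (K `|` K'); split; first exact: compactU.
  by move=> x [/KA|/KA'].
by move=> x Ax /not_orP[nK nK']; rewrite f0// g0// addr0.
Qed.

Lemma test_comp f (g g' : T -> T) : test f ->
  (forall x, A x -> {for x, continuous g}) -> (forall x, A x -> {for x, continuous g'}) ->
  (forall x, A x -> A (g x)) -> (forall x, A x -> A (g' x)) ->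
  (forall x, A x -> g' (g x) = x) -> (forall x, A x -> g (g' x) = x) ->
  test (f \o g).
Proof.
move=> [lf [K [cK KA f0]]] cg cg' gA gA' gK gK'; split.
  move=> x Ax; have H : nbhs x (g @^-1` [set y | A y -> f y = f (g x)]).
    exact: cg x Ax _ (lf (g x) (gA x Ax)).
  by apply: filterS H => y h Ay; exact: h (gA y Ay).
exists (g' @` K); split.
- apply: continuous_compact => //; apply: continuous_in_subspaceT => x /set_mem /KA.
  exact: cg'.
- by move=> _ [x /KA Ax <-]; exact: gA'.
- move=> x Ax nK /=; apply: f0; first exact: gA.
  by apply: contra_not nK => h; exists (g x) => //; exact: gK.
Qed.

(** By compactness of the support K, [g t] and its inverse [g' t] preserve the values of f on K for
    all small t. If x is off K but [g t x] is in K, the inverse is applied at [g t x]; if both are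
    off K, both values are 0. *)
Lemma test_small_invariance f (g g' : F -> T -> T) : test f ->
  (forall x, A x -> (fun z => g z.1 z.2) @ (0, x) --> x) ->
  (forall x, A x -> (fun z => g' z.1 z.2) @ (0, x) --> x) ->
  (\forall t \near 0, forall x, A x ->
     [/\ A (g t x), A (g' t x) & g' t (g t x) = x]) ->
  exists2 c : F, c != 0 & forall t, vabs t <= vabs c ->
    forall x, A x -> f (g t x) = f x.
Proof.
move=> [lf [K [cK KA f0]]] cg cg' hg.
have small (k : F -> T -> T) : (forall x, A x -> (fun z => k z.1 z.2) @ (0, x) --> x) ->
    (\forall t \near 0, forall x, A x -> A (k t x)) ->
    \forall t \near 0, forall x, K x -> f (k t x) = f x.
  move=> ck kA.
  have : \forall t \near (0 : F), K `<=` [set x | A x -> f (k t x) = f x].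
    apply: ((compact_near_coveringP K).1 cK F (nbhs (0 : F))
      (fun t x => A x -> f (k t x) = f x)) => x Kx.
    have Ax := KA x Kx; have lx := lf x Ax.
    have [[U V] [/= U0 Vx] UV] := ck x Ax _ lx.
    exists (V `&` [set y | A y -> f y = f x], U `&` [set t | forall x, A x -> A (k t x)]).
      by split => /=; apply: filterI.
    move=> [y t] [/= [Vy fy] [Ut kt]] Ay.
    by rewrite fy// (UV (t, y))//=; exact: kt.
  by apply: filterS => t h x Kx; apply: h => //; exact: KA.
have s1 : \forall t \near (0 : F), forall x, K x -> f (g t x) = f x.
  by apply: small cg _; apply: filterS hg => t h x /h[].
have s2 : \forall t \near (0 : F), forall x, K x -> f (g' t x) = f x.
  by apply: small cg' _; apply: filterS hg => t h x /h[].
have /nbhs_cballP[c c0 hc] : \forall t \near (0 : F),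
    (forall x, A x -> [/\ A (g t x), A (g' t x) & g' t (g t x) = x]) /\
    (forall x, K x -> f (g t x) = f x) /\ (forall x, K x -> f (g' t x) = f x).
  by apply: filterS3 hg s1 s2 => t.
exists c => // t tc x Ax.
have [|h [k1 k2]] := hc t; first by rewrite /cball/= subr0.
have [gx _ gK] := h x Ax.
have [Kx|nKx] := pselect (K x); first exact: k1.
have [Kg|nKg] := pselect (K (g t x)); first by rewrite -k2// gK.
by rewrite !f0.
Qed.

Section integrals.
Hypotheses (hT : hausdorff_space T) (mA : measurable (A : set (borel T))).
Variable mu : {measure set (borel T) -> \bar R}.
Hypothesis mu_radon : forall K : set T, compact K -> K `<=` A -> (mu K < +oo)%E.

Lemma test_bounded f : test f -> exists2 M : R, 0 <= M & forall x, A x -> cmod (f x) <= M.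
Proof.
move=> [lf [K [cK KA f0]]].
have : \forall M \near +oo, K `<=` [set x | A x -> cmod (f x) <= M].
  apply: ((compact_near_coveringP K).1 cK R (pinfty_nbhs R)
    (fun M x => A x -> cmod (f x) <= M)) => x Kx.
  exists ([set y | A y -> f y = f x], [set M | cmod (f x) <= M]).
    split => /=; first exact: lf (KA x Kx).
    by exists (cmod (f x)); split => //= M /ltW.
  by move=> [y M] /= [fy hM] Ay; rewrite fy.
move=> [M [_ hM]]; exists (`|M| + 1); first by rewrite addr_ge0.
move=> x Ax; have [Kx|nKx] := pselect (K x); last by rewrite f0// cmod0 addr_ge0.
apply: (hM (`|M| + 1)) => //.
by rewrite (le_lt_trans (ler_norm M))// ltrDl.
Qed.

Lemma test_integrable f : test f -> cintegrable mu A f.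
Proof.
move=> tf; have [M M0 hM] := test_bounded tf.
have [lf [K [cK KA f0]]] := tf.
have mK : measurable (K : set (borel T)) by apply: borel_closed; exact: compact_closed.
have mf := locally_constant_cmeasurable mA lf.
apply: (@le_cintegrable R _ (borel T) mu A f (fun x : borel T => M * \1_K x)) => //.
  move=> x Ax; rewrite indicE; have [Kx|nKx] := pselect (K x).
    by rewrite mem_set// mulr1 hM.
  by rewrite f0// memNset// mulr0 cmod0.
have : mu.-integrable A (EFin \o (\1_K : borel T -> R)).
  apply/integrableP; split; first exact/measurable_EFinP/measurable_indic.
  under eq_integral => x _ do rewrite /= ger0_norm// .
  rewrite integral_indic//; apply: le_lt_trans (mu_radon cK KA).
  by rewrite setIidl.
move=> /(integrableZl mA M); apply: eq_integrable => // x _ /=.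
Qed.

End integrals.

End test_functions.

(** * Decay of oscillatory integrals *)

Section omx_hausdorff.
Context (R : realType) (F : nonarchLocalFieldType R).

Lemma cvg_id_jd i (M : omx F) : jd i @ M --> jd i M.
Proof. exact: (cvg_jd (nbhs_filter M) (f := id) (fun C hC => hC)). Qed.

Lemma cvg_entry (M : omx F) i j : (fun N : omx F => N i j) @ M --> M i j.
Proof.
have /cvg_matrix h : (fun N : omx F => N) @ M --> M by exact: cvg_id.
exact: h.
Qed.

Lemma omx_hausdorff : hausdorff_space (omx F).
Proof.
move=> p q pq.
have coord (u : omx F -> F) : (forall M : omx F, u @ M --> u M) -> u p = u q.
  move=> cu; apply: (@metric_hausdorff R F) => A B hA hB.
  have [x [/= Ax Bx]] := pq _ _ (cu p A hA) (cu q B hB).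
  by exists (u x).
have oct_entry (M : omx F) i j := (cvg_octE (nbhs_filter M) (@cvg_entry M i j)).
apply/matrixP => i j; rewrite [p i j]surjective_pairing [q i j]surjective_pairing.
congr (_, _); apply/matrixP => k l.
  by apply: (coord (fun N => (N i j).1 k l)) => M; exact: (oct_entry M i j).1.
by apply: (coord (fun N => (N i j).2 k l)) => M; exact: (oct_entry M i j).2.
Qed.

Lemma cvg_pair_entry (a : oct F) (M : omx F) i j :
  (fun N : omx F => oct_pair a (N i j)) @ M --> oct_pair a (M i j).
Proof.
have hc : (fun _ : omx F => a) @ nbhs M --> a by exact: cvg_cst.
have he := @cvg_entry M i j.
exact: (cvg_oct_pair (nbhs_filter M) hc he).
Qed.

Lemma continuous_jexp (a : oct F) : continuous (@jexp R F a).
Proof.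
move=> M; have hc : (fun _ : omx F => a) @ nbhs M --> a by exact: cvg_cst.
exact: (cvg_jexp (nbhs_filter M) hc (f := id) (fun C hC => hC)).
Qed.

Lemma continuous_jperm s : continuous (@jperm R F s).
Proof.
by move=> M; exact: (cvg_jperm (nbhs_filter M) (f := id) (fun C hC => hC)).
Qed.

Lemma oct_pairZl k (a p : oct F) : oct_pair (oct_scale k a) p = k * oct_pair a p.
Proof. by elim/octP: a => *; elim/octP: p => *; rewrite !ocE; ring. Qed.

Lemma oct_pairZr k (a p : oct F) : oct_pair a (oct_scale k p) = k * oct_pair a p.
Proof. by elim/octP: a => *; elim/octP: p => *; rewrite !ocE; ring. Qed.

Lemma oct_pairDr (a p q : oct F) : oct_pair a (p + q) = oct_pair a p + oct_pair a q.
Proof. by elim/octP: a => *; elim/octP: p => *; elim/octP: q => *; rewrite !ocE; ring. Qed.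

Lemma oct_scaleA k l (a : oct F) : oct_scale k (oct_scale l a) = oct_scale (k * l) a.
Proof. by elim/octP: a => *; rewrite !ocE; congr oc; ring. Qed.

Lemma oct_scale1 (a : oct F) : oct_scale 1 a = a.
Proof. by elim/octP: a => *; rewrite !ocE; congr oc; ring. Qed.

Lemma oct_scale0 (a : oct F) : oct_scale 0 a = 0.
Proof. by elim/octP: a => *; rewrite oc_zero !ocE; congr oc; ring. Qed.

Lemma jexp0 (two0 : (2 : F) != 0) (X : omx F) : jordan F X -> jexp 0 X = X.
Proof.
elim/(albert_ind two0) => x1 x2 x3 p q r; rewrite jexp_jmk.
elim/octP: p => *; elim/octP: q => *; elim/octP: r => *.
by rewrite oc_zero !(ocE, oc_opp); congr jmk; try congr oc; ring.
Qed.

Lemma jexp01 (a : oct F) (X : omx F) :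
  jexp a X o0 o1 = X o0 o1 + oct_scale (jd o1 X - jd o0 X - oct_pair a (X o0 o1)) a.
Proof. by rewrite /jexp jmk_entry. Qed.

Lemma jexp_d (a : oct F) (X : omx F) :
  (jd o0 (jexp a X) = jd o0 X + oct_pair a (X o0 o1)) *
  (jd o1 (jexp a X) = jd o1 X - oct_pair a (X o0 o1)).
Proof. by rewrite /jexp !jd_jmk. Qed.

End omx_hausdorff.

Lemma sum_pred_le1 (R : realType) (T : eqType) (ts : seq T) (P : pred T) : uniq ts ->
  {in ts &, forall t u, P t -> P u -> t = u} -> \sum_(t <- ts) (P t)%:R <= 1 :> R.
Proof.
move=> uts h; rewrite -natr_sum; have -> : (\sum_(t <- ts) P t)%N = count P ts.
  by rewrite -sum1_count [in RHS]big_mkcond; apply: eq_bigr => t _; case: (P t).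
rewrite lern1 -size_filter.
have : uniq (seq.filter P ts) by exact: filter_uniq.
have : {in seq.filter P ts &, forall t u, t = u}.
  by move=> t u; rewrite !mem_filter => /andP[Pt ht] /andP[Pu hu]; exact: h.
case: (seq.filter P ts) => [|t [|u s]]//= hs /andP[].
by rewrite inE (hs t u) ?eqxx// !inE eqxx ?orbT.
Qed.

(** * Decay for abstract [A] and [mu], later [Omega] with [eta] and [Omega_ 1] with [omega 1] *)

Section decay.
Context (R : realType) (F : nonarchLocalFieldType R).
Hypothesis two0 : (2 : F) != 0.
Variables (psi : F -> cplx R) (dx : {measure set (borel F) -> \bar R}).
Hypotheses (hpsi : is_unitary_char psi) (psiO : has_conductor_O psi).
Hypothesis hdx : is_haar dx.
Variable A : set (omx F).
Hypotheses (AOmega : A `<=` Omega F) (mA : measurable (A : set (borel (omx F)))).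
Hypothesis Aaut : forall g, albert_aut g -> forall X, A X -> A (g X).
Variable mu : {measure set (borel (omx F)) -> \bar R}.
Hypothesis mu_radon :
  forall K : set (omx F), compact K -> K `<=` A -> (mu K < +oo)%E.

Implicit Types (f : omx F -> cplx R) (w : omx F -> R) (a b : oct F).

Let AJ X : A X -> jordan F X. Proof. by move=> /AOmega[]. Qed.

Lemma test_comp_jexp a f : isotropic_oct a -> test A f -> test A (f \o jexp a).
Proof.
move=> ha tf; apply: (test_comp (g' := jexp (- a))) => //.
- by move=> X _; exact: continuous_jexp.
- by move=> X _; exact: continuous_jexp.
- by apply: Aaut; exact: jexp_aut.
- by apply: Aaut; apply: jexp_aut => //; exact: isotropic_opp.
- by move=> X /AJ JX; exact: jexpNK.
- by move=> X /AJ JX; rewrite -{1}[a]opprK jexpNK//; exact: isotropic_opp.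
Qed.

Lemma test_comp_jperm s f : injective s -> test A f -> test A (f \o jperm s).
Proof.
move=> sI tf; have [t st ts] := injF_bij sI.
apply: (test_comp (g' := jperm t)) => //.
- by move=> X _; exact: continuous_jperm.
- by move=> X _; exact: continuous_jperm.
- by apply: Aaut; exact: jperm_aut.
- by apply: Aaut; apply: jperm_aut => //; exact: can_inj ts.
- by move=> X _; apply/matrixP => i j; rewrite !mxE !ts.
- by move=> X _; apply/matrixP => i j; rewrite !mxE !st.
Qed.

Hypothesis jexp_inv : forall a f, isotropic_oct a -> test A f ->
  cint mu A (f \o jexp a) = cint mu A f.
Hypothesis jperm_inv : forall s f, injective s -> test A f ->
  cint mu A (f \o jperm s) = cint mu A f.

Let ti f : test A f -> cintegrable mu A f.
Proof. by move=> tf; apply: test_integrable => //; exact: omx_hausdorff. Qed.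

Lemma lc_coord (S : Type) (phi : F -> S) (u : omx F -> F) :
  (forall z, \forall z' \near z, phi z' = phi z) ->
  (forall M : omx F, u @ M --> u M) -> locally_constant_on A (phi \o u).
Proof.
move=> hphi cu X _; have H : nbhs X (u @^-1` [set z | phi z = phi (u X)]).
  exact: cu X _ (hphi (u X)).
by apply: filterS H.
Qed.

Lemma lc_le (c : F) : c != 0 ->
  forall z : F, \forall z' \near z, (vabs z' <= vabs c)%R = (vabs z <= vabs c)%R.
Proof.
move=> c0 z; apply/nbhs_cballP; exists c => // y hy; apply/idP/idP => h.
  by rewrite -(subrK y z); apply: vabsD_le => //; rewrite vabsBC.
by rewrite -(subrK z y); exact: vabsD_le.
Qed.

Lemma lc_psi (s : F) : s != 0 -> forall z : F, \forall z' \near z, psi (s * z') = psi (s * z).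
Proof.
move=> s0 z; apply/nbhs_cballP; exists s^-1; first by rewrite invr_neq0.
move=> y hy; apply: (psi_near hpsi psiO); rewrite -mulrBr vabsM mulrC.
by rewrite -ler_pdivlMr ?vabs_gt0// mul1r -vabsV.
Qed.

Definition phase (s : F) (X : omx F) : cplx R := psi (s * jd o0 X).

Lemma lc_phase s : s != 0 -> locally_constant_on A (phase s).
Proof. by move=> s0; apply: (lc_coord (lc_psi s0)) => M; exact: cvg_id_jd. Qed.

Lemma lc_pair_le a (i j : 'I_3) (c : F) : c != 0 ->
  locally_constant_on A (fun X => (vabs (oct_pair a (X i j)) <= vabs c)%R).
Proof. by move=> c0; apply: (lc_coord (lc_le c0)) => M; exact: cvg_pair_entry. Qed.

(** A continuous u is bounded on the compact support: t u(X) tends to 0 with t, uniformly there. The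
    bound e lets further constraints on d be imposed. *)
Lemma test_supp_bounded f (u : omx F -> F) (e : F) : test A f -> e != 0 ->
  (forall M : omx F, u @ M --> u M) ->
  exists2 d : F, d != 0 & vabs d <= vabs e /\
    forall X, A X -> f X != 0 -> vabs (d * u X) <= 1.
Proof.
move=> [_ [K [cK KA f0]]] e0 cu.
have : \forall t \near (0 : F), K `<=` [set X | vabs (t * u X) <= 1].
  apply: ((compact_near_coveringP K).1 cK F (nbhs (0 : F))
    (fun t X => vabs (t * u X) <= 1)) => X _.
  have h : (fun z : omx F * F => z.2 * u z.1) @ (X, 0) --> 0 * u X.
    apply: cvgFM; first exact: cvg_snd.
    by apply: (@cvg_comp _ _ _ fst u _ (nbhs X)); [exact: cvg_fst|exact: cu].
  have hn := (cvgFP _ _ _).1 h 1 (oner_neq0 F).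
  have [[U V] [/= UX V0] UV] := hn; exists (U, V) => //= z hz.
  by have := UV z hz; rewrite /= mul0r subr0 vabs1.
move=> /nbhs_cballP[d d0 hd].
have [d' d'0 [h1 h2]] : exists2 d' : F, d' != 0 & vabs d' <= vabs e /\ vabs d' <= vabs d.
  by have [de|/ltW de] := leP (vabs d) (vabs e : R); [exists d|exists e].
exists d' => //; split => // X AX fX.
have KX : K X by apply: contrapT => nK; move: fX; rewrite f0// eqxx.
by apply: (hd d' _ X KX); rewrite /cball/= subr0.
Qed.

Lemma jexp_small_invariance a f : isotropic_oct a -> test A f ->
  exists2 c : F, c != 0 & forall t, vabs t <= vabs c ->
    forall X, A X -> f (jexp (oct_scale t a) X) = f X.
Proof.
move=> ha tf.
have cvg_scale (X : omx F) :
    (fun z : F * omx F => oct_scale z.1 a) @ nbhs ((0 : F), X) --> (0 : oct F).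
  rewrite -(oct_scale0 a).
  have h1 : (fun z : F * omx F => z.1) @ nbhs ((0 : F), X) --> (0 : F) by exact: cvg_fst.
  have h2 : (fun _ : F * omx F => a) @ nbhs ((0 : F), X) --> a by exact: cvg_cst.
  exact: (cvg_oct_scale (nbhs_filter ((0 : F), X)) h1 h2).
have cvg2 (X : omx F) : (fun z : F * omx F => z.2) @ nbhs ((0 : F), X) --> X.
  exact: cvg_snd.
apply: (test_small_invariance (g := fun t X => jexp (oct_scale t a) X)
  (g' := fun t X => jexp (- oct_scale t a) X) tf).
- move=> X AX; rewrite -{2}(jexp0 two0 (AJ AX)).
  exact: (cvg_jexp (nbhs_filter ((0 : F), X)) (cvg_scale X) (cvg2 X)).
- move=> X AX; rewrite -{2}(jexp0 two0 (AJ AX)) -[X in jexp X _]oppr0.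
  have h := cvg_octN (nbhs_filter ((0 : F), X)) (cvg_scale X).
  exact: (cvg_jexp (nbhs_filter ((0 : F), X)) h (cvg2 X)).
- apply/nbhs_cballP; exists 1; first exact: oner_neq0.
  move=> t _ X AX; have hta := isotropic_scale t ha; split.
  + by apply: Aaut => //; exact: jexp_aut.
  + by apply: Aaut => //; apply: jexp_aut => //; exact: isotropic_opp.
  + by apply: jexpNK => //; exact: AJ.
Qed.

Lemma jexp_pair a b t X : oct_pair a b = 0 ->
  oct_pair a (jexp (oct_scale t b) X o0 o1) = oct_pair a (X o0 o1).
Proof. by move=> ab; rewrite jexp01 oct_pairDr !oct_pairZr ab !mulr0 addr0. Qed.

Lemma phase_jexp a t s X :
  phase s (jexp (oct_scale t a) X) = phase s X * psi (t * (s * oct_pair a (X o0 o1))).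
Proof. by rewrite /phase jexp_d oct_pairZl mulrDr (psiD hpsi) mulrCA. Qed.

Lemma test_indic f (P : omx F -> bool) : test A f -> locally_constant_on A P ->
  test A (fun X => f X * (P X)%:R).
Proof.
move=> tf lP; apply: testM => // X AX; apply: filterS (lP X AX) => Y h AY.
by rewrite h.
Qed.

(* Averaging over the one-parameter group generated by a, which shifts x_11
   linearly with speed <a, x_12>, kills everything outside a small
   neighbourhood of <a, x_12> = 0. *)
Lemma localise a (c s : F) f : isotropic_oct a -> c != 0 -> s != 0 -> test A f ->
  (forall t, vabs t <= vabs c -> forall X, A X -> f (jexp (oct_scale t a) X) = f X) ->
  cint mu A (fun X => f X * phase s X) =
  cint mu A (fun X => f X * (vabs (oct_pair a (X o0 o1)) <= vabs (c * s)^-1)%R%:R * phase s X).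
Proof.
move=> ha c0 s0 tf finv.
have [d d0 [dc hd]] := test_supp_bounded tf c0
  (fun M => @cvg_pair_entry R F a M o0 o1).
(* The average runs over c O modulo e' O, where e' is so small that psi(t s <a, x_12>) depends only
   on the class of t for every X in the support. *)
pose e := d / s; have e0 : e != 0 by rewrite mulf_neq0 ?invr_neq0.
have [e' e'0 [e'c e'e]] := vabs_min c0 e0.
have [ts hts] := exists_ball_reps e'0 e'c.
have tfs := testM tf (lc_phase s0).
have N0 : (size ts)%:R != 0 :> cplx R.
  rewrite pnatr_eq0; apply/eqP => sz; have := reps_size hts.
  by rewrite sz mul0r => /esym/eqP; rewrite gt_eqF// vabs_gt0.
have cs0 : (c * s)^-1 != 0 by rewrite invr_neq0// mulf_neq0.
apply: (mulfI N0).
transitivity (\sum_(t <- ts) cint mu A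
    ((fun X => f X * phase s X) \o jexp (oct_scale t a))).
  rewrite (eq_bigr (fun=> cint mu A (fun X => f X * phase s X))); last first.
    by move=> t _; apply: jexp_inv => //; exact: isotropic_scale.
  by rewrite big_const_seq count_predT iter_addr addr0 mulr_natl.
rewrite -cint_sum//; last first.
  by move=> t; apply: ti; apply: test_comp_jexp => //; exact: isotropic_scale.
rewrite -cintZ//; last first.
  apply: ti; apply: testM; last exact: lc_phase.
  by apply: test_indic => //; exact: lc_pair_le.
apply: eq_cint => X AX /=.
rewrite big_seq (eq_bigr (fun t => f X * phase s X * psi (t * (s * oct_pair a (X o0 o1))))); last first.
  move=> t ht; rewrite phase_jexp finv ?mulrA//; exact: reps_in hts _ ht.
rewrite -big_seq -mulr_sumr.
have [f0|f0] := eqVneq (f X) 0; first by rewrite f0 !mul0r mulr0.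
rewrite (char_sum hpsi psiO hdx e'0 hts); last first.
  apply: le_trans (hd X AX f0).
  have -> : d * oct_pair a (X o0 o1) = e * (s * oct_pair a (X o0 o1)).
    by rewrite /e; field.
  by rewrite [leLHS]vabsM [leRHS]vabsM; apply: ler_wpM2r => //; exact: vabs_ge0.
have -> : (vabs (c * (s * oct_pair a (X o0 o1))) <= 1)%R =
    (vabs (oct_pair a (X o0 o1)) <= vabs (c * s)^-1)%R.
  rewrite mulrA vabsM mulrC -ler_pdivlMr ?vabs_gt0 ?mulf_neq0//.
  by rewrite mul1r vabsV.
by rewrite mulrCA [in RHS]mulrAC.
Qed.

Definition near_null (e : F) (l : seq (oct F)) (X : omx F) : bool :=
  all (fun a => vabs (oct_pair a (X o0 o1)) <= vabs e) l.

Lemma lc_near_null (e : F) l : e != 0 -> locally_constant_on A (near_null e l).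
Proof.
move=> e0; elim: l => [|a l ih] X AX; first exact: filterS filterT.
by apply: filterS2 (lc_pair_le a o0 o1 e0 AX) (ih X AX) => Y h1 h2 AY /=; rewrite h1// h2.
Qed.

Lemma near_null_jexp e l b t X : (forall a, a \in l -> oct_pair a b = 0) ->
  near_null e l (jexp (oct_scale t b) X) = near_null e l X.
Proof.
by move=> lb; apply: eq_in_all => a al /=; rewrite jexp_pair// lb.
Qed.

(** Iteration of [localise]. The vectors being mutually orthogonal, an indicator already inserted is
    invariant under the exponentials still to be used. *)
Lemma localise_seq (l : seq (oct F)) (c s : F) f : c != 0 -> s != 0 -> test A f ->
  (forall a, a \in l -> isotropic_oct a) ->
  (forall a b, a \in l -> b \in l -> oct_pair a b = 0) ->
  (forall a, a \in l -> forall t, vabs t <= vabs c ->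
    forall X, A X -> f (jexp (oct_scale t a) X) = f X) ->
  cint mu A (fun X => f X * phase s X) =
  cint mu A (fun X => f X * (near_null (c * s)^-1 l X)%:R * phase s X).
Proof.
move=> c0 s0; have cs0 : (c * s)^-1 != 0 by rewrite invr_neq0// mulf_neq0.
elim: l f => [|a l ih] f tf hl ll finv.
  by apply: eq_cint => X _; rewrite mulr1.
rewrite (localise (a := a) (c := c))//; last 2 first.
- by apply: hl; rewrite mem_head.
- by apply: finv; rewrite mem_head.
rewrite ih.
- by apply: eq_cint => X _; congr (_ * _); rewrite -mulrA -natrM mulnb.
- by apply: test_indic => //; exact: lc_pair_le.
- by move=> b hb; apply: hl; rewrite inE hb orbT.
- by move=> b b' hb hb'; apply: ll; rewrite inE ?hb ?hb' orbT.
- move=> b hb t tc X AX; rewrite finv ?inE ?hb ?orbT// jexp_pair//.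
  by apply: ll; rewrite inE ?eqxx ?hb ?orbT.
Qed.

Let rint w := Rintegral mu A w.
Let rtest w := test A (fun X => ((w X)%:C)%C).

Let rint_jexp a w : isotropic_oct a -> rtest w -> rint (w \o jexp a) = rint w.
Proof.
move=> ha tw; have := jexp_inv ha tw.
have -> : (fun X : omx F => ((w X)%:C)%C) \o jexp a = (fun X => ((((w \o jexp a) X)%:C)%C : cplx R)) by [].
by rewrite !cint_real => -[].
Qed.

Let rti w : rtest w -> mu.-integrable A (EFin \o w).
Proof. by move=> /ti[]. Qed.

Lemma cmod_cint_test f w : test A f -> rtest w ->
  (forall X, A X -> cmod (f X) <= w X) -> cmod (cint mu A f) <= 2 * rint w.
Proof.
move=> tf tw fw.
exact: (@cmod_cint_le R _ (borel (omx F)) mu A f w mA (ti tf) (rti tw) fw).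
Qed.

Lemma rtest_indic w (P : omx F -> bool) : rtest w -> locally_constant_on A P ->
  rtest (fun X => w X * (P X)%:R).
Proof.
move=> tw lP; apply: eq_test (test_indic tw lP) => X _.
by rewrite rmorphM rmorph_nat.
Qed.

Let rtest_rint_sum (ts : seq F) (w : F -> omx F -> R) : (forall t, rtest (w t)) ->
  rtest (fun X => \sum_(t <- ts) w t X) /\
  rint (fun X => \sum_(t <- ts) w t X) = \sum_(t <- ts) rint (w t).
Proof.
move=> tw; elim: ts => [|t ts [ih1 ih2]].
  have z0 : test A (fun=> 0 : cplx R).
    split; first by move=> X _; exact: filterS filterT.
    by exists set0; split => //; exact: compact0.
  split; first by apply: eq_test z0 => X _; rewrite big_nil.
  rewrite big_nil /rint (@eq_Rintegral _ _ _ _ _ (fun=> 0)) => [|X _].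
    by rewrite /Rintegral integral0.
  by rewrite big_nil.
split.
  by apply: eq_test (testD (tw t) ih1) => X _; rewrite big_cons rmorphD.
rewrite big_cons -ih2 /rint -RintegralD//; last 2 first.
- exact: rti (tw t).
- exact: rti ih1.
by apply: eq_Rintegral => X _; rewrite big_cons.
Qed.

Lemma rtest_jexp a w : isotropic_oct a -> rtest w -> rtest (w \o jexp a).
Proof. by move=> ha tw; exact: test_comp_jexp ha tw. Qed.

(* The translates of {|<a, x_12>| <= |e|} under the one-parameter group of the
   dual vector b are disjoint, which bounds its mass. *)
Lemma volume_step a b (c rho e : F) w : isotropic_oct b -> oct_pair a b = 1 ->
  c != 0 -> rho != 0 -> e != 0 -> vabs e <= vabs (c * rho) ->
  rtest w -> (forall X, 0 <= w X) ->
  (forall t, vabs t <= vabs c -> forall X, A X -> w (jexp (oct_scale t b) X) = w X) ->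
  (forall X, A X -> w X != 0 -> vabs rho <= vabs (jd o1 X - jd o0 X)) ->
  (forall X, A X -> w X != 0 -> vabs (c * oct_pair b (X o0 o1)) < vabs rho) ->
  rint (fun X => w X * (vabs (oct_pair a (X o0 o1)) <= vabs e)%R%:R) <=
    vabs e / vabs (c * rho) * rint w.
Proof.
move=> hb ab c0 rho0 e0 ec tw w0 winv wrho wb.
have er0 : e / rho != 0 by rewrite mulf_neq0 ?invr_neq0.
have erc : vabs (e / rho) <= vabs c.
  by rewrite vabs_div ler_pdivrMr ?vabs_gt0// -vabsM.
(* Times t in c O modulo e / rho: there are |c rho| / |e| classes, the inverse of the factor to be
   gained. *)
have [ts hts] := exists_ball_reps er0 erc.
pose g X := w X * (vabs (oct_pair a (X o0 o1)) <= vabs e)%R%:R.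
have tg : rtest g by apply: rtest_indic => //; exact: lc_pair_le.
have sz : (size ts)%:R = vabs (c * rho) / vabs e :> R.
  have := reps_size hts; rewrite vabs_div vabsM => <-.
  have ve : vabs e != 0 :> R by rewrite gt_eqF// vabs_gt0.
  have vr : vabs rho != 0 :> R by rewrite gt_eqF// vabs_gt0.
  by field; rewrite ve vr.
have tgt t : rtest (fun X => g (jexp (oct_scale t b) X)).
  by apply: rtest_jexp tg; exact: isotropic_scale.
suff : (size ts)%:R * rint g <= rint w.
  rewrite sz -ler_pdivlMl ?divr_gt0 ?vabs_gt0 ?mulf_neq0//.
  by rewrite invf_div.
have -> : (size ts)%:R * rint g = rint (fun X => \sum_(t <- ts) g (jexp (oct_scale t b) X)).
  transitivity (\sum_(t <- ts) rint (g \o jexp (oct_scale t b))).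
    rewrite (eq_bigr (fun=> rint g)); last first.
      by move=> t _; apply: rint_jexp => //; exact: isotropic_scale.
    by rewrite big_const_seq count_predT iter_addr addr0 mulr_natl.
  by have [_ ->] := rtest_rint_sum ts tgt.
apply: le_Rintegral => //.
- by apply: rti; have [] := rtest_rint_sum ts tgt.
- exact: rti.
move=> X AX.
have [w0X|w0X] := eqVneq (w X) 0.
  rewrite big_seq big1 ?w0X// => t ht.
  by rewrite /g winv ?w0X ?mul0r//; exact: reps_in hts _ ht.
set al := oct_pair a (X o0 o1); set D := jd o1 X - jd o0 X.
set be := oct_pair b (X o0 o1).
have key t : oct_pair a (jexp (oct_scale t b) X o0 o1) = al + (D - t * be) * t.
  rewrite jexp01 oct_pairDr; congr (_ + _).
  by rewrite oct_scaleA oct_pairZr ab mulr1 oct_pairZl.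
rewrite big_seq (eq_bigr (fun t => w X * (vabs (al + (D - t * be) * t) <= vabs e)%R%:R)); last first.
  move=> t ht; rewrite /g winv//; last exact: reps_in hts _ ht.
  by rewrite key.
rewrite -big_seq -mulr_sumr -[leRHS]mulr1 ler_wpM2l//.
apply: sum_pred_le1; first exact: reps_uniq hts.
move=> t u ht hu h1 h2.
apply: (reps_inj hts) => //; rewrite vabs_div ler_pdivlMr ?vabs_gt0//.
(* At time t the pairing with a is al + (D - t be) t. Two of its values differ by (t - u) (D - (t +
   u) be), where D dominates by [wb]; if both are at most |e|, then |t - u| <= |e| / |rho|. *)
have tu : vabs (D - (t + u) * be) = vabs D.
  rewrite addrC -mulNr vabsDr//; apply: lt_le_trans (wrho X AX w0X).
  apply: le_lt_trans (wb X AX w0X); rewrite !vabsM ler_wpM2r ?vabs_ge0//.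
  by rewrite vabsN; apply: vabsD_le; [exact: reps_in hts _ ht|exact: reps_in hts _ hu].
apply: (@le_trans _ _ (vabs (t - u) * vabs D)).
  by rewrite ler_wpM2l ?vabs_ge0// wrho.
rewrite -tu -vabsM; have -> : (t - u) * (D - (t + u) * be) =
    al + (D - t * be) * t - (al + (D - u * be) * u) by ring.
exact: vabsB_le.
Qed.

(** Triangular duality: the exponential of b moves the pairing with its own a, while the conditions
    attached to the later vectors must stay unchanged. *)
Fixpoint dual_seq (l : seq (oct F * oct F)) : Prop :=
  if l is ab :: l' then
    [/\ isotropic_oct ab.2, oct_pair ab.1 ab.2 = 1,
        forall a, a \in map fst l' -> oct_pair a ab.2 = 0 & dual_seq l']
  else True.

(** Each pair contributes one factor |e| / |c rho|: [volume_step] is applied to w multiplied by the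
    indicator of the remaining conditions. *)
Lemma volume_seq l (c rho e : F) w : dual_seq l ->
  c != 0 -> rho != 0 -> e != 0 -> vabs e <= vabs (c * rho) ->
  rtest w -> (forall X, 0 <= w X) ->
  (forall b, b \in map snd l -> forall t, vabs t <= vabs c ->
     forall X, A X -> w (jexp (oct_scale t b) X) = w X) ->
  (forall X, A X -> w X != 0 -> vabs rho <= vabs (jd o1 X - jd o0 X)) ->
  (forall b, b \in map snd l -> forall X, A X -> w X != 0 ->
     vabs (c * oct_pair b (X o0 o1)) < vabs rho) ->
  rint (fun X => w X * (near_null e (map fst l) X)%:R) <=
    (vabs e / vabs (c * rho)) ^+ size l * rint w.
Proof.
move=> dl c0 rho0 e0 ec tw w0 winv wrho wb.
elim: l dl winv wb => [_ _ _|[a b] l ih [hb ab lb dl] winv wb].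
  rewrite expr0 mul1r /rint le_eqVlt; apply/orP; left; apply/eqP.
  by apply: eq_Rintegral => X _; rewrite mulr1.
pose w' X := w X * (near_null e (map fst l) X)%:R.
have w'0 X : w' X != 0 -> w X != 0.
  by apply: contra_neq => wX; rewrite /w' wX mul0r.
have th0 : 0 <= vabs e / vabs (c * rho) :> R by rewrite divr_ge0 ?vabs_ge0.
have -> : rint (fun X => w X * (near_null e (map fst ((a, b) :: l)) X)%:R) =
    rint (fun X => w' X * (vabs (oct_pair a (X o0 o1)) <= vabs e)%R%:R).
  apply: eq_Rintegral => X _; rewrite /w' -mulrA -natrM mulnb.
  by congr (_ * (nat_of_bool _)%:R); rewrite andbC.
apply: (@le_trans _ _ (vabs e / vabs (c * rho) * rint w')).
  apply: (volume_step (b := b)) => //.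
  - by apply: rtest_indic => //; exact: lc_near_null.
  - by move=> X; rewrite mulr_ge0.
  - move=> t tc X AX; rewrite /w' winv ?mem_head//.
    by rewrite near_null_jexp.
  - by move=> X AX /w'0; exact: wrho.
  - by move=> X AX /w'0; apply: wb => //; exact: mem_head.
rewrite (_ : size _ = (size l).+1)// exprS -[leRHS]mulrA; apply: ler_wpM2l => //.
apply: ih => //.
- by move=> b' hb'; apply: winv; rewrite inE hb' orbT.
- by move=> b' hb'; apply: wb; rewrite inE hb' orbT.
Qed.

(** A basis of the upper isotropic subspace with its dual basis in the lower one; the signs are
    those of [oct_pair]. Its length 4 is the decay exponent. *)
Definition hyperbolic_pairs : seq (oct F * oct F) :=
  [:: (oct_upper 1 0 0 0, oct_lower 0 1 0 0); (oct_upper 0 1 0 0, oct_lower (-1) 0 0 0);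
      (oct_upper 0 0 1 0, oct_lower 0 0 0 (-1)); (oct_upper 0 0 0 1, oct_lower 0 0 1 0)].

Lemma hyperbolic_dual : dual_seq hyperbolic_pairs.
Proof.
have lowI c d g h : isotropic_oct (oct_lower c d g h : oct F).
  by right; exists c, d, g, h.
do !split => //=; try by rewrite !ocE; ring.
- by move=> a; rewrite !inE => /or3P[] /eqP ->; rewrite !ocE; ring.
- by move=> a; rewrite !inE => /orP[] /eqP ->; rewrite !ocE; ring.
- by move=> a; rewrite !inE => /eqP ->; rewrite !ocE; ring.
Qed.

Lemma hyperbolic_fst a : a \in map fst hyperbolic_pairs ->
  exists x y z t : F, a = oct_upper x y z t.
Proof.
by rewrite !inE => /or4P[] /eqP ->; [exists 1, 0, 0, 0|exists 0, 1, 0, 0|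
  exists 0, 0, 1, 0|exists 0, 0, 0, 1].
Qed.

Lemma hyperbolic_snd a : a \in map snd hyperbolic_pairs ->
  exists x y z t : F, a = oct_lower x y z t.
Proof.
by rewrite !inE => /or4P[] /eqP ->; [exists 0, 1, 0, 0|exists (-1), 0, 0, 0|
  exists 0, 0, 0, (-1)|exists 0, 0, 1, 0].
Qed.

Lemma common_small_invariance (l : seq (oct F)) f : test A f ->
  (forall a, a \in l -> isotropic_oct a) ->
  exists2 c : F, c != 0 & forall a, a \in l -> forall t, vabs t <= vabs c ->
    forall X, A X -> f (jexp (oct_scale t a) X) = f X.
Proof.
move=> tf; elim: l => [_|a l ih hl]; first by exists 1; rewrite ?oner_neq0.
have [c c0 hc] := ih (fun b hb => hl b (mem_behead (s := a :: l) hb)).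
have [d d0 hd] := jexp_small_invariance (hl a (mem_head a l)) tf.
have [e e0 [ec ed]] := vabs_min c0 d0.
exists e; first by [].
move=> b; rewrite inE => /predU1P[->|hb] t te; first exact: (hd t (le_trans te ed)).
by apply: hc => //; exact: le_trans te ec.
Qed.

Lemma common_bound (l : seq (oct F)) f (e : F) : test A f -> e != 0 ->
  exists2 d : F, d != 0 & vabs d <= vabs e /\
    forall b, b \in l -> forall X, A X -> f X != 0 -> vabs (d * oct_pair b (X o0 o1)) <= 1.
Proof.
move=> tf e0; elim: l => [|b l [d d0 [de hd]]]; first by exists e.
have [d' d'0 [dd' hd']] := test_supp_bounded tf d0
  (fun M => @cvg_pair_entry R F b M o0 o1).
exists d' => //; split; first exact: le_trans dd' de.
move=> b'; rewrite inE => /predU1P[->//|hb'] X AX fX.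
apply: le_trans (hd b' hb' X AX fX); rewrite !vabsM.
by apply: ler_wpM2r => //; exact: vabs_ge0.
Qed.

Definition decays f := exists C : R, forall s : F, s != 0 ->
  cmod (cint mu A (fun X => f X * phase s X)) <= C * vabs s ^- 4.

(** Localising along the upper basis confines x_12 to pairings of size at most 1 / |c s|; the volume
    bound along the lower basis then gives the fourth power of [th s], a multiple of |s|^-1. *)
Lemma decays_diag (rho : F) f : test A f -> rho != 0 ->
  (forall X, A X -> f X != 0 -> vabs rho <= vabs (jd o1 X - jd o0 X)) -> decays f.
Proof.
move=> tf rho0 frho.
have [c1 c10 hc1] := common_small_invariance
  (l := map fst hyperbolic_pairs ++ map snd hyperbolic_pairs) tf ltac:(
  by move=> a; rewrite mem_cat => /orP[/hyperbolic_fst|/hyperbolic_snd]; [left|right]).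
have [k k0 k1] := @vabs_small R F 1 ltr01.
have [d d0 [dc hd]] := common_bound (map snd hyperbolic_pairs) tf c10.
(* c is small enough for invariance of f, and at most |d rho k|, so that |c <b, x_12>| <= |rho k| on
   the support; |k| < 1 makes the comparison with |rho| strict. *)
have [c c0 [cc1 cd]] := vabs_min c10 (mulf_neq0 d0 (mulf_neq0 rho0 k0)).
pose w X := cmod (f X).
have tw : rtest w by exact: test_cmod.
have wf X : w X != 0 -> f X != 0.
  by apply: contra_neq => fX; rewrite /w fX cmod0.
have I0 : 0 <= rint w by apply: Rintegral_ge0 => X _; exact: cmod_ge0.
have crho0 : c * rho != 0 by rewrite mulf_neq0.
pose th (s : F) := vabs (c * s)^-1 / vabs (c * rho) : R.
exists (2 * rint w * (vabs c * vabs (c * rho)) ^- 4) => s s0.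
have thE : 2 * rint w * (vabs c * vabs (c * rho)) ^- 4 * vabs s ^- 4 = 2 * (th s ^+ 4 * rint w).
  rewrite /th vabsV (vabsM c s).
  have vc : vabs c != 0 :> R by rewrite gt_eqF// vabs_gt0.
  have vs : vabs s != 0 :> R by rewrite gt_eqF// vabs_gt0.
  have vr : vabs (c * rho) != 0 :> R by rewrite gt_eqF// vabs_gt0.
  by field; rewrite vc vs vr.
rewrite thE; have tfs := testM tf (lc_phase s0).
have cs0 : (c * s)^-1 != 0 by rewrite invr_neq0// mulf_neq0.
have cmod_phase z X : cmod (z * phase s X) = cmod z.
  by rewrite cmodM (cmod_psi hpsi) mulr1.
(* [volume_seq] requires [th s] at most 1; beyond that, for small s, the trivial bound is already
   smaller. *)
have [th1|th1] := leP (th s) 1; last first.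
  apply: (le_trans (cmod_cint_test tfs tw _)).
    by move=> X _; rewrite cmod_phase.
  rewrite ler_wpM2l// ler_peMl// exprn_ege1// ltW//.
rewrite (localise_seq (l := map fst hyperbolic_pairs) (c := c))//; last 3 first.
- by move=> a /hyperbolic_fst; left.
- move=> a b /hyperbolic_fst[a1 [a2 [a3 [a4 ->]]]] /hyperbolic_fst[b1 [b2 [b3 [b4 ->]]]].
  by rewrite !ocE; ring.
- move=> a ha t tc; apply: hc1; first by rewrite mem_cat ha.
  exact: le_trans tc cc1.
apply: (le_trans (cmod_cint_test (w := fun X => w X *
    (near_null (c * s)^-1 (map fst hyperbolic_pairs) X)%:R) _ _ _)).
- by apply: testM; [apply: test_indic => //; exact: lc_near_null|exact: lc_phase].
- by apply: rtest_indic => //; exact: lc_near_null.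
- by move=> X _; rewrite cmod_phase cmodM cmod_bool.
rewrite ler_wpM2l//; apply: (volume_seq (c := c) (rho := rho) (l := hyperbolic_pairs)) => //.
- exact: hyperbolic_dual.
- by move: th1; rewrite /th ler_pdivrMr ?vabs_gt0// mul1r.
- by move=> X; exact: cmod_ge0.
- move=> b hb t tc X AX; rewrite /w hc1//; first by rewrite mem_cat hb orbT.
  exact: le_trans tc cc1.
- by move=> X AX /wf; exact: frho.
- move=> b hb X AX /wf fX.
  apply: (@le_lt_trans _ _ (vabs (rho * k))).
    apply: (@le_trans _ _ (vabs (rho * k * (d * oct_pair b (X o0 o1))))).
      have -> : rho * k * (d * oct_pair b (X o0 o1)) = d * (rho * k) * oct_pair b (X o0 o1) by ring.
      by rewrite [leLHS]vabsM [leRHS]vabsM; apply: ler_wpM2r => //; exact: vabs_ge0.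
    by rewrite vabsM; apply: ler_piMr; [exact: vabs_ge0|exact: hd].
  by rewrite vabsM gtr_pMr// vabs_gt0.
Qed.

(** For |s| > 1 / |c rho| the integral vanishes: localisation keeps only |<a, x_12>| <= 1 / |c s| <
    |rho|, which misses the support. For smaller s the trivial bound suffices. *)
Lemma decays_pair a (rho : F) f : isotropic_oct a -> test A f -> rho != 0 ->
  (forall X, A X -> f X != 0 -> vabs rho <= vabs (oct_pair a (X o0 o1))) -> decays f.
Proof.
move=> ha tf rho0 frho.
have [c c0 hc] := jexp_small_invariance ha tf.
pose w X := cmod (f X).
have tw : rtest w by exact: test_cmod.
have I0 : 0 <= rint w by apply: Rintegral_ge0 => X _; exact: cmod_ge0.
have crho : 0 < vabs (c * rho) :> R by rewrite vabs_gt0 mulf_neq0.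
exists (2 * rint w * vabs (c * rho) ^- 4) => s s0.
have tfs := testM tf (lc_phase s0).
have vs : 0 < vabs s :> R by rewrite vabs_gt0.
have [h|h] := leP (vabs s) (vabs (c * rho))^-1.
  apply: (le_trans (cmod_cint_test tfs tw _)).
    by move=> X _; rewrite cmodM (cmod_psi hpsi) mulr1.
  rewrite -!mulrA ler_wpM2l// -exprVn -exprVn -exprMn ler_peMr// exprn_ege1//.
  by rewrite -ler_pdivrMl ?invr_gt0// mulr1 invrK -[leLHS]invrK lef_pV2 ?posrE ?invr_gt0.
rewrite (localise (a := a) (c := c))//.
rewrite (@eq_cint _ _ _ _ _ _ (fun=> 0)) => [|X AX].
  by rewrite cint0 cmod0 !mulr_ge0 ?invr_ge0 ?exprn_ge0 ?vabs_ge0.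
have [->|fX] := eqVneq (f X) 0; first by rewrite !mul0r.
rewrite (_ : (vabs (oct_pair a (X o0 o1)) <= vabs (c * s)^-1)%R = false) ?mulr0 ?mul0r//.
apply/negbTE; rewrite -ltNge; apply: lt_le_trans (frho X AX fX).
rewrite vabsV vabsM invfM mulrC ltr_pdivrMr ?vabs_gt0//.
rewrite -ltf_pV2 ?posrE ?invr_gt0 ?mulr_gt0 ?vabs_gt0// invrK.
by rewrite mulrC -vabsM.
Qed.

Lemma decaysD f (g : omx F -> cplx R) : test A f -> test A g -> decays f -> decays g ->
  decays (fun X => f X + g X).
Proof.
move=> tf tg [C hC] [C' hC']; exists (C + C') => s s0.
rewrite (@eq_cint R _ (borel (omx F)) mu A _ (fun X : omx F => f X * phase s X + g X * phase s X)); last first.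
  by move=> X _; rewrite mulrDl.
rewrite cintD//; last 2 first.
- by apply: ti; apply: testM => //; exact: lc_phase.
- by apply: ti; apply: testM => //; exact: lc_phase.
rewrite mulrDl; apply: (le_trans (cmodD _ _)); apply: lerD; [exact: hC|exact: hC'].
Qed.

Lemma eq_decays f (g : omx F -> cplx R) : (forall X, A X -> f X = g X) -> decays f -> decays g.
Proof.
move=> fg [C hC]; exists C => s s0.
by rewrite (@eq_cint R _ (borel (omx F)) mu A _ (fun X : omx F => f X * phase s X)) ?hC// => X AX; rewrite fg.
Qed.

Lemma decays_jperm s f : injective s -> s o0 = o0 -> test A f ->
  decays (f \o jperm s) -> decays f.
Proof.
move=> sI s0 tf [C hC]; exists C => r r0.
have <- : cint mu A (fun X => (f \o jperm s) X * phase r X) =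
    cint mu A (fun X => f X * phase r X).
  rewrite -(jperm_inv sI (testM tf (lc_phase r0))); apply: eq_cint => X _ /=.
  by congr (_ * psi (_ * _)); rewrite /jd mxE s0.
exact: hC.
Qed.

Lemma lc_vabs_le (rho : F) (u : omx F -> F) : rho != 0 ->
  (forall M : omx F, u @ M --> u M) ->
  locally_constant_on A (fun X => (vabs rho <= vabs (u X))%R).
Proof.
move=> rho0 cu.
apply: (@lc_coord _ (fun z : F => (vabs rho <= vabs z)%R) u _ cu) => z.
have [->|z0] := eqVneq z 0.
  have [d d0 hd] := @vabs_small R F (vabs rho) ltac:(by rewrite vabs_gt0).
  apply/nbhs_cballP; exists d => // y; rewrite /cball/= subr0 => hy.
  rewrite vabs0 (leNgt _ (vabs y)) (le_lt_trans hy hd); apply/esym/negbTE.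
  by rewrite -ltNge vabs_gt0.
by apply: filterS (vabs_locally_constant z0) => y ->.
Qed.

(** The set where |u| >= |rho| is open and closed, so cutting along it yields two test functions. *)
Lemma decays_split (u : omx F -> F) (rho : F) f : test A f -> rho != 0 ->
  (forall M : omx F, u @ M --> u M) ->
  (forall g : omx F -> cplx R, test A g -> (forall X, A X -> g X != 0 -> f X != 0 /\ vabs rho <= vabs (u X)) ->
     decays g) ->
  (forall g : omx F -> cplx R, test A g -> (forall X, A X -> g X != 0 -> f X != 0 /\ vabs (u X) < vabs rho) ->
     decays g) ->
  decays f.
Proof.
move=> tf rho0 cu h1 h2; have lu := lc_vabs_le rho0 cu.
have lu' : locally_constant_on A (fun X => ~~ (vabs rho <= vabs (u X))%R).
  by move=> X AX; apply: filterS (lu X AX) => Y h AY; rewrite h.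
have t1 := test_indic tf lu; have t2 := test_indic tf lu'.
apply: (eq_decays _ (decaysD t1 t2 (h1 _ t1 _) (h2 _ t2 _))).
- by move=> X _; case: leP => _; rewrite ?mulr1 ?mulr0 ?addr0 ?add0r.
- move=> X _; case: leP => hX; rewrite ?mulr1 ?mulr0 ?eqxx// => fX.
- move=> X _; case: leP => hX; rewrite ?mulr1 ?mulr0 ?eqxx// => fX.
Qed.

Lemma decays_cover (u : nat -> omx F -> F) (n : nat) f : test A f ->
  (forall i (M : omx F), u i @ M --> u i M) ->
  (forall X, A X -> exists2 i, (i < n)%N & u i X != 0) ->
  (forall i (rho : F) (g : omx F -> cplx R), (i < n)%N -> rho != 0 -> test A g ->
     (forall X, A X -> g X != 0 -> vabs rho <= vabs (u i X)) -> decays g) ->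
  decays f.
Proof.
move=> tf cu nz hdec.
have [rho rho0 hrho] : exists2 rho : F, rho != 0 & forall X, A X -> f X != 0 ->
    exists2 i, (i < n)%N & vabs rho <= vabs (u i X).
  have [_ [K [cK KA f0]]] := tf.
  have : \forall t \near (0 : F), K `<=` [set X | exists2 i, (i < n)%N &
      vabs t <= vabs (u i X)].
    apply: ((compact_near_coveringP K).1 cK F (nbhs (0 : F))
      (fun t X => exists2 i, (i < n)%N & vabs t <= vabs (u i X))).
    move=> X /KA AX; have [i ilt uX] := nz X AX.
    exists ([set Y | vabs (u i Y) = vabs (u i X) :> R], cball 0 (u i X)).
      split=> /=; last exact: nbhs_cball.
      exact: cu i X _ (vabs_locally_constant uX).
    by move=> [Y t] [/= hY]; rewrite /cball/= subr0 => ht; exists i => //; rewrite hY.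
  move=> /nbhs_cballP[rho rho0 hr]; exists rho => // X AX fX.
  have KX : K X by apply: contrapT => nK; move: fX; rewrite f0// eqxx.
  by apply: (hr rho _ X KX); rewrite /cball/= subr0.
(* m functions are left; on the support of g one of index at least k is large. *)
suff main : forall m k, (m + k = n)%N -> forall g : omx F -> cplx R, test A g ->
    (forall X, A X -> g X != 0 ->
       exists2 i, (k <= i < n)%N & vabs rho <= vabs (u i X)) -> decays g.
  by apply: (main n 0%N) => //; rewrite addn0.
elim=> [|m ih] k mk g tg hg.
  exists 0 => s s0; rewrite (@eq_cint R _ (borel (omx F)) mu A _ (fun=> 0)).
    by rewrite cint0 cmod0 mul0r.
  move=> X AX; have [->|gX] := eqVneq (g X) 0; first by rewrite mul0r.
  case: (hg X AX gX) => i.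
  by rewrite add0n in mk; rewrite mk => /andP[ni]; rewrite ltnNge ni.
apply: (decays_split (u := u k) (rho := rho)) => //.
- move=> h th hh; apply: (hdec k rho) => //.
    by rewrite -mk addSn ltnS leq_addl.
  by move=> X AX hX; have [] := hh X AX hX.
- move=> h th hh; apply: (ih k.+1) => //; first by rewrite addnS -addSn.
  move=> X AX hX; have [gX uX] := hh X AX hX.
  have [i /andP[ki ilt] ui] := hg X AX gX; exists i => //.
  rewrite ilt andbT ltn_neqAle ki andbT; apply/eqP => kE.
  by move: ui; rewrite -kE leNgt uX.
Qed.

Definition oct_basis (i : nat) : oct F :=
  nth 0 [:: oct_upper 1 0 0 0; oct_upper 0 1 0 0; oct_upper 0 0 1 0; oct_upper 0 0 0 1;
            oct_lower 1 0 0 0; oct_lower 0 1 0 0; oct_lower 0 0 1 0; oct_lower 0 0 0 1] i.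

Lemma oct_basis_isotropic i : isotropic_oct (oct_basis i).
Proof.
rewrite /oct_basis.
do 4 (case: i => [|i]; first by left; do 4 eexists; reflexivity).
do 4 (case: i => [|i]; first by right; do 4 eexists; reflexivity).
rewrite nth_default//; left; exists 0, 0, 0, 0.
by rewrite /oct_upper oc_zero.
Qed.

Lemma oct_pair_basis0 (p : oct F) :
  (forall i, (i < 8)%N -> oct_pair (oct_basis i) p = 0) -> p = 0.
Proof.
elim/octP: p => a b c d e f g h hp; rewrite oc_zero.
have := (hp 0%N isT, hp 1%N isT, hp 2%N isT, hp 3%N isT,
  hp 4%N isT, hp 5%N isT, hp 6%N isT, hp 7%N isT).
rewrite /oct_basis /= !ocE !(mul0r, mul1r, add0r, addr0, subr0, sub0r, oppr0).
case=> [[[[[[[h1 h2] h3] h4] h5] h6] h7] h8].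
have N0 (x : F) : - x = 0 -> x = 0 by move=> /eqP; rewrite oppr_eq0 => /eqP.
by congr oc; rewrite ?opprK in h1 h2 h3 h4 h5 h6 h7 h8 *; do ?[assumption|apply: N0].
Qed.

Definition swap23 (i : 'I_3) : 'I_3 := if i == o0 then o0 else if i == o1 then o2 else o1.

Lemma swap23_inj : injective swap23.
Proof. by apply: ord3P; apply: ord3P. Qed.

Definition cycle3 (i : 'I_3) : 'I_3 := if i == o0 then o1 else if i == o1 then o2 else o0.
Definition cycle3' (i : 'I_3) : 'I_3 := if i == o0 then o2 else if i == o1 then o0 else o1.

Lemma cycle3_inj : injective cycle3.
Proof. by apply: ord3P; apply: ord3P. Qed.

Lemma cycle3'_inj : injective cycle3'.
Proof. by apply: ord3P; apply: ord3P. Qed.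

Lemma jd_jperm s i (X : omx F) : jd i (jperm s X) = jd (s i) X.
Proof. by rewrite /jd mxE. Qed.

(** [G] is the exponential in position (2,3): it fixes x_11, hence the phase, and adds <a, x_23> to
    x_22. Where x_22 is close to x_11, composing with [G] moves the support to |x_22 - x_11| = |<a,
    x_23>| >= |rho|, the case of [decays_diag]. *)
Lemma decays_pair23 a (rho : F) f : isotropic_oct a -> test A f -> rho != 0 ->
  (forall X, A X -> f X != 0 -> vabs rho <= vabs (oct_pair a (X o1 o2))) -> decays f.
Proof.
move=> ha tf rho0 frho.
apply: (@decays_split (fun X => jd o1 X - jd o0 X) rho) => //.
- move=> M; exact: (cvgFD (nbhs_filter M) (@cvg_id_jd R F o1 M)
    (cvgFN (nbhs_filter M) (@cvg_id_jd R F o0 M))).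
- move=> g tg hg; apply: (decays_diag tg rho0) => X AX gX.
  by have [] := hg X AX gX.
move=> g tg hg.
pose G X := jperm cycle3' (jexp a (jperm cycle3 X)).
have AG X : A X -> A (G X).
  move=> AX; rewrite /G; apply: Aaut; first exact: jperm_aut cycle3'_inj.
  apply: Aaut; first exact: jexp_aut.
  by apply: Aaut AX; exact: jperm_aut cycle3_inj.
have t1 := test_comp_jperm cycle3'_inj tg.
have t2 := test_comp_jexp ha t1.
have t3 := test_comp_jperm cycle3_inj t2.
have G00 X : jd o0 (G X) = jd o0 X.
  by rewrite /G jd_jperm /jexp jd_jmk jd_jperm.
have G11 X : jd o1 (G X) = jd o1 X + oct_pair a (X o1 o2).
  by rewrite /G jd_jperm jexp_d jd_jperm mxE.
have Gp X : oct_pair a (G X o1 o2) = oct_pair a (X o1 o2).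
  have aa : oct_pair a a = 0.
    by case: ha => -[x [y [z [t ->]]]]; rewrite !ocE; ring.
  rewrite /G mxE -[cycle3' o1]/o0 -[cycle3' o2]/o1 -[a in jexp a _]oct_scale1.
  by rewrite jexp_pair// mxE.
have : decays (g \o G).
  apply: (decays_diag (rho := rho)) => // X AX gX.
  have [fX uX] := hg (G X) (AG X AX) gX.
  have := frho (G X) (AG X AX) fX; rewrite Gp => h; apply: (le_trans h).
  move: uX; rewrite G00 G11 => uX.
  have -> : jd o1 X - jd o0 X =
    (jd o1 X + oct_pair a (X o1 o2) - jd o0 X) + - oct_pair a (X o1 o2) by ring.
  by rewrite vabsDr vabsN//; exact: lt_le_trans uX h.
case=> C hC; exists C => s s0.
have -> : cint mu A (fun X => g X * phase s X) =
    cint mu A (fun X => (g \o G) X * phase s X); last exact: hC.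
have ph := lc_phase s0.
have tp := testM tg ph.
have u1 := test_comp_jperm cycle3'_inj tp.
have u2 := test_comp_jexp ha u1.
rewrite -(jperm_inv cycle3'_inj tp) -(jexp_inv ha u1) -(jperm_inv cycle3_inj u2).
by apply: eq_cint => X _; rewrite /= /phase -/(G X) G00.
Qed.

(** The functions u i vanish together only on scalar matrices, which [Omega] avoids. Exchanging the
    indices 2 and 3 preserves the phase and carries the cases of x_33 and x_13 to those of x_22 and
    x_12. *)
Lemma decays_test f : test A f -> decays f.
Proof.
move=> tf.
(* 26 coordinates on the Jordan algebra modulo scalars: two differences of diagonal entries, and
   eight for each of x_23, x_12, x_13. *)
pose u (i : nat) (X : omx F) : F :=
  if i == 0%N then jd o1 X - jd o0 X else if i == 1%N then jd o2 X - jd o0 X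
  else if (i < 10)%N then oct_pair (oct_basis (i - 2)) (X o1 o2)
  else if (i < 18)%N then oct_pair (oct_basis (i - 10)) (X o0 o1)
  else oct_pair (oct_basis (i - 18)) (X o0 o2).
apply: (decays_cover (u := u) (n := 26)) => //.
- move=> i M; rewrite /u; case: ifP => _.
    exact: (cvgFD (nbhs_filter M) (@cvg_id_jd R F o1 M)
      (cvgFN (nbhs_filter M) (@cvg_id_jd R F o0 M))).
  case: ifP => _.
    exact: (cvgFD (nbhs_filter M) (@cvg_id_jd R F o2 M)
      (cvgFN (nbhs_filter M) (@cvg_id_jd R F o0 M))).
  by case: ifP => _; [|case: ifP => _]; exact: cvg_pair_entry.
- move=> X AX; apply: contrapT => nz.
  have uz i : (i < 26)%N -> u i X = 0.
    move=> i26; apply: contrapT => /eqP ui; apply: nz; by exists i.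
  have d10 : jd o1 X = jd o0 X by apply/eqP; rewrite -subr_eq0; exact/eqP/(uz 0%N).
  have d20 : jd o2 X = jd o0 X by apply/eqP; rewrite -subr_eq0; exact/eqP/(uz 1%N).
  have e12 : X o1 o2 = 0.
    apply: oct_pair_basis0 => i i8; have h : (i + 2 < 26)%N by lia.
    have := uz _ h; rewrite /u.
    have -> : (i + 2 == 0)%N = false by lia.
    have -> : (i + 2 == 1)%N = false by lia.
    have -> : (i + 2 < 10)%N = true by lia.
    by rewrite addnK.
  have e01 : X o0 o1 = 0.
    apply: oct_pair_basis0 => i i8; have h : (i + 10 < 26)%N by lia.
    have := uz _ h; rewrite /u.
    have -> : (i + 10 == 0)%N = false by lia.
    have -> : (i + 10 == 1)%N = false by lia.
    have -> : (i + 10 < 10)%N = false by lia.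
    have -> : (i + 10 < 18)%N = true by lia.
    by rewrite addnK.
  have e02 : X o0 o2 = 0.
    apply: oct_pair_basis0 => i i8; have h : (i + 18 < 26)%N by lia.
    have := uz _ h; rewrite /u.
    have -> : (i + 18 == 0)%N = false by lia.
    have -> : (i + 18 == 1)%N = false by lia.
    have -> : (i + 18 < 10)%N = false by lia.
    have -> : (i + 18 < 18)%N = false by lia.
    by rewrite addnK.
  have := AOmega AX; rewrite [X](jmkE two0 (AJ AX)) d10 d20 e12 e01 e02.
  exact: Omega_scalar.
- move=> i rho g i26 rho0 tg hg; move: hg; rewrite /u.
  have swp h : test A h -> decays (h \o jperm swap23) -> decays h.
    by move=> th; apply: decays_jperm => //; exact: swap23_inj.
  have Asw X : A X -> A (jperm swap23 X).
    by move=> AX; apply: Aaut => //; exact/jperm_aut/swap23_inj.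
  have tsw := test_comp_jperm swap23_inj tg.
  case: (i == 0%N); first by move=> hg; exact: decays_diag tg rho0 hg.
  case: (i == 1%N).
    move=> hg; apply: swp => //; apply: (decays_diag tsw rho0) => X AX gX.
    by have := hg _ (Asw X AX) gX; rewrite !jd_jperm.
  case: (i < 10)%N; first by move=> hg; exact: decays_pair23 (oct_basis_isotropic _) tg rho0 hg.
  case: (i < 18)%N; first by move=> hg; exact: decays_pair (oct_basis_isotropic _) tg rho0 hg.
  move=> hg; apply: swp => //.
  apply: (decays_pair (oct_basis_isotropic (i - 18)) tsw rho0) => X AX gX.
  by have := hg _ (Asw X AX) gX; rewrite mxE.
Qed.

End decay.

(** * Measurability of [Omega], of its trace slices and of the fibres *)

Section omega_topology.
Context (R : realType) (F : nonarchLocalFieldType R).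
Hypothesis two0 : (2 : F) != 0.

Lemma cvg_omx_add (I : Type) (G : set_system I) (FG : Filter G) (f g : I -> omx F)
    (M N : omx F) : f @ G --> M -> g @ G --> N -> (fun k => f k + g k) @ G --> M + N.
Proof.
move=> /cvg_matrix hf /cvg_matrix hg; apply/cvg_matrix => i j; rewrite mxE.
under eq_fun do rewrite mxE.
exact: cvg_octD (hf i j) (hg i j).
Qed.

Lemma cvg_omx_opp (I : Type) (G : set_system I) (FG : Filter G) (f : I -> omx F)
    (M : omx F) : f @ G --> M -> (fun k => - f k) @ G --> - M.
Proof.
move=> /cvg_matrix hf; apply/cvg_matrix => i j; rewrite mxE.
under eq_fun do rewrite mxE.
exact: cvg_octN (hf i j).
Qed.

Lemma cvg_omx_mul (I : Type) (G : set_system I) (FG : Filter G) (f g : I -> omx F)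
    (M N : omx F) : f @ G --> M -> g @ G --> N ->
  (fun k => omx_mul (f k) (g k)) @ G --> omx_mul M N.
Proof.
move=> /cvg_matrix hf /cvg_matrix hg; apply/cvg_matrix => i j; rewrite mxE.
under eq_fun do rewrite mxE.
rewrite !big_ord_recl big_ord0 addr0.
under eq_fun do rewrite !big_ord_recl big_ord0 addr0.
exact: (cvg_octD FG (cvg_oct_mul FG (hf _ _) (hg _ _))
  (cvg_octD FG (cvg_oct_mul FG (hf _ _) (hg _ _)) (cvg_oct_mul FG (hf _ _) (hg _ _)))).
Qed.

Lemma cvg_jprod (I : Type) (G : set_system I) (FG : Filter G) (f g : I -> omx F)
    (M N : omx F) : f @ G --> M -> g @ G --> N ->
  (fun k => jprod (f k) (g k)) @ G --> jprod M N.
Proof.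
move=> hf hg; have hc : (fun _ : I => 2^-1 : F) @ G --> (2^-1 : F) by exact: cvg_cst.
exact: (cvg_omx_scale FG hc (cvg_omx_add FG (cvg_omx_mul FG hf hg) (cvg_omx_mul FG hg hf))).
Qed.

Lemma cvg_jtr (I : Type) (G : set_system I) (FG : Filter G) (f : I -> omx F)
    (M : omx F) : f @ G --> M -> (fun k => jtr (f k)) @ G --> jtr M.
Proof.
move=> /cvg_matrix hf; rewrite /jtr !big_ord_recl big_ord0 addr0.
under eq_fun do rewrite !big_ord_recl big_ord0 addr0.
have re (i : 'I_3) : (fun k => oct_re (f k i i)) @ G --> oct_re (M i i).
  have [h1 _] := cvg_octE FG (hf i i).
  have hc : (fun _ : I => 2^-1 : F) @ G --> (2^-1 : F) by exact: cvg_cst.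
  have tE (p : 'M[F]_2) : \tr p = p 0 0 + p 1 1 by rewrite [p]mx2E tr_mx2 !mxE.
  rewrite /oct_re tE; under eq_fun do rewrite tE.
  exact: cvgFM hc (cvgFD FG (h1 0 0) (h1 1 1)).
exact: (cvgFD FG (re _) (cvgFD FG (re _) (re _))).
Qed.

Lemma continuous_jtr : continuous (@jtr F : omx F -> F).
Proof. by move=> M; exact: (cvg_jtr (nbhs_filter M) (f := id) (fun C hC => hC)). Qed.

Lemma continuous_jadj : continuous (@jadj F : omx F -> omx F).
Proof.
move=> M; have FM := nbhs_filter M.
have hid : (fun X : omx F => X) @ nbhs M --> M by [].
have hp : (fun X : omx F => jprod X X) @ nbhs M --> jprod M M.
  exact: (cvg_jprod FM hid hid).
have htr : (fun X : omx F => jtr X) @ nbhs M --> jtr M by exact: (cvg_jtr FM hid).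
have htp : (fun X : omx F => jtr (jprod X X)) @ nbhs M --> jtr (jprod M M).
  exact: (cvg_jtr FM hp).
have hc : (fun _ : omx F => 2^-1 : F) @ nbhs M --> (2^-1 : F) by exact: cvg_cst.
have h1 : (fun _ : omx F => omx_one : omx F) @ nbhs M --> (omx_one : omx F) by exact: cvg_cst.
have h2 : (fun X : omx F => jprod X X - omx_scale (jtr X) X) @ nbhs M -->
    jprod M M - omx_scale (jtr M) M.
  have hs : (fun X : omx F => omx_scale (jtr X) X) @ nbhs M --> omx_scale (jtr M) M.
    by apply: (cvg_omx_scale FM); [exact: htr|exact: hid].
  exact: (cvg_omx_add FM hp (cvg_omx_opp FM hs)).
have h3 : (fun X : omx F => jtr X ^+ 2) @ nbhs M --> jtr M ^+ 2.
  by rewrite expr2; under eq_fun do rewrite expr2; exact: (cvgFM FM htr htr).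
have h4 : (fun X : omx F => 2^-1 * (jtr X ^+ 2 - jtr (jprod X X))) @ nbhs M -->
    2^-1 * (jtr M ^+ 2 - jtr (jprod M M)).
  exact: (cvgFM FM hc (cvgFD FM h3 (cvgFN FM htp))).
have h5 : (fun X : omx F => omx_scale (2^-1 * (jtr X ^+ 2 - jtr (jprod X X))) omx_one) @ nbhs M -->
    omx_scale (2^-1 * (jtr M ^+ 2 - jtr (jprod M M))) omx_one.
  by apply: (cvg_omx_scale FM); [exact: h4|exact: h1].
exact: (cvg_omx_add FM h2 h5).
Qed.

Lemma closed_fiber (T U : topologicalType) (hU : hausdorff_space U) (f : T -> U) (y : U) :
  continuous f -> closed [set x | f x = y].
Proof.
move=> cf; apply: (@closed_comp _ _ f [set y]) => //.
by apply: compact_closed => //; exact: compact_set1.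
Qed.

Lemma closed_jordan : closed (jordan F).
Proof.
have hO : hausdorff_space (oct F).
  move=> p q pq; have coord (u : oct F -> F) : (forall M : oct F, u @ M --> u M) -> u p = u q.
    move=> cu; apply: (@metric_hausdorff R F) => A B hA hB.
    by have [x [/= Ax Bx]] := pq _ _ (cu p A hA) (cu q B hB); exists (u x).
  have oct_entry (M : oct F) := (cvg_octE (nbhs_filter M) (f := id) (fun C hC => hC)).
  rewrite [p]surjective_pairing [q]surjective_pairing.
  congr (_, _); apply/matrixP => k l.
    by apply: (coord (fun N => N.1 k l)) => M; exact: (oct_entry M).1.
  by apply: (coord (fun N => N.2 k l)) => M; exact: (oct_entry M).2.
have -> : jordan F = \bigcap_(ij in [set: 'I_3 * 'I_3])
    [set X : omx F | X ij.1 ij.2 - oct_conj (X ij.2 ij.1) = 0].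
  apply/seteqP; split=> [X JX [i j] _ /=|X h i j]; first by rewrite JX subrr.
  by apply/eqP; rewrite -subr_eq0; exact/eqP/(h (i, j)).
apply: closed_bigI => -[i j] _ /=; apply: closed_fiber => // M.
have FM := nbhs_filter M.
exact: (cvg_octD FM (@cvg_entry R F M i j) (cvg_octN FM (cvg_oct_conj FM (@cvg_entry R F M j i)))).
Qed.

Lemma measurable_Omega : measurable (Omega F : set (borel (omx F))).
Proof.
have -> : Omega F = (jordan F `&` [set X | jadj X = 0]) `&` ~` [set 0].
  apply/seteqP; split=> [X [JX /eqP X0 aX]|X [[JX aX] X0]] //.
  by split => //; exact/eqP.
apply: (@measurableI _ (borel (omx F))); last first.
  apply: (@measurableC _ (borel (omx F))); apply: borel_closed.
  by apply: compact_closed; [exact: omx_hausdorff|exact: compact_set1].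
apply: borel_closed; apply: closedI; first exact: closed_jordan.
by apply: closed_fiber; [exact: omx_hausdorff|exact: continuous_jadj].
Qed.

Lemma closed_jtr (c : F) : closed [set X : omx F | jtr X = c].
Proof.
by apply: closed_fiber; [exact: (@metric_hausdorff R F)|exact: continuous_jtr].
Qed.

Lemma closed_jd i (c : F) : closed [set X : omx F | jd i X = c].
Proof.
apply: closed_fiber; first exact: (@metric_hausdorff R F).
by move=> M; exact: cvg_id_jd.
Qed.

Lemma measurable_Omega_ c : measurable (Omega_ c : set (borel (omx F))).
Proof.
have -> : Omega_ c = Omega F `&` [set X | jtr X = c] by [].
by apply: (@measurableI _ (borel (omx F)));
  [exact: measurable_Omega|apply: borel_closed; exact: closed_jtr].
Qed.

Lemma fibreE (t : F) : fibre t = Omega_ 1 `&` [set X | jd o0 X = t].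
Proof.
apply/seteqP; split=> X [OX]; have JX : jordan F X by case: OX => -[].
  by rewrite (jpair_je two0)// => <-.
by move=> <-; split => //; rewrite (jpair_je two0).
Qed.

Lemma measurable_fibre t : measurable (fibre t : set (borel (omx F))).
Proof.
rewrite fibreE; apply: (@measurableI _ (borel (omx F))); first exact: measurable_Omega_.
by apply: borel_closed; exact: closed_jd.
Qed.

Lemma test_closed_sub (T : ptopologicalType) (A C : set T) (f : T -> cplx R) :
  closed C -> test A f -> test (A `&` C) f.
Proof.
move=> cC [lf [K [cK KA f0]]]; split.
  by move=> x [Ax _]; apply: filterS (lf x Ax) => y h [Ay _]; exact: h.
exists (K `&` C); split.
- exact: compact_closedI.
- by move=> x [/KA Ax Cx].
- by move=> x [Ax Cx] nK; apply: f0 => // Kx; apply: nK.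
Qed.

End omega_topology.

(** Invariance of the measures is given for direct images; the image under g' of a subset of A is
    its preimage under g within A. *)
Lemma cint_bijection (R : realType) (T : ptopologicalType) (A : set T)
    (mu : {measure set (borel T) -> \bar R}) (g g' : T -> T) (f : T -> cplx R) :
  measurable (A : set (borel T)) -> (forall x, A x -> {for x, continuous g}) ->
  (forall x, A x -> A (g x)) -> (forall x, A x -> A (g' x)) ->
  (forall x, A x -> g' (g x) = x) -> (forall x, A x -> g (g' x) = x) ->
  (forall B : set (borel T), measurable B -> B `<=` A -> mu (g' @` B) = mu B) ->
  cintegrable mu A f -> cint mu A (f \o g) = cint mu A f.
Proof.
move=> mA cg gA gA' gK gK' hmu fi.
have mg : measurable_fun (A : set (borel T)) (g : borel T -> borel T).
  exact: borel_measurable_fun.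
rewrite [RHS](@cint_change _ _ _ _ _ mu mu A A g (fun=> 1) mA mA mg gA)//.
  by apply: eq_cint => x _; rewrite mul1r.
move=> B mB BA; rewrite integral_cst ?mul1e; last by exact: mg.
rewrite -[LHS](hmu B mB BA); congr (mu _).
apply/seteqP; split=> [_ [y By <-]|x [Ax Bgx]].
  have Ay := BA y By; split; first exact: gA'.
  by rewrite /preimage/= gK'.
by exists (g x) => //; exact: gK.
Qed.

(** * Invariance and homogeneity of the integrals *)

Section measures.
Context (R : realType) (F : nonarchLocalFieldType R).
Hypothesis two0 : (2 : F) != 0.
Variable dx : {measure set (borel F) -> \bar R}.
Variable eta : {measure set (borel (omx F)) -> \bar R}.
Hypothesis eta_spec : is_eta eta.
Variable omega : F -> {measure set (borel (omx F)) -> \bar R}.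
Hypothesis omega_spec : is_omega dx eta omega.
Implicit Types (f : omx F -> cplx R).

Let hO := @omx_hausdorff R F.

Lemma eta_compact (K : set (omx F)) : compact K -> K `<=` Omega F -> (eta K < +oo)%E.
Proof. by have [_] := eta_radon eta_spec; exact. Qed.

Lemma omega_compact (c : F) (K : set (omx F)) : c != 0 -> compact K -> K `<=` Omega_ c ->
  (omega c K < +oo)%E.
Proof. by move=> c0; have [_] := omega_radon omega_spec c0; exact. Qed.

Lemma eta_integrable f : test (Omega F) f -> cintegrable eta (Omega F) f.
Proof.
by apply: test_integrable => //; [exact: measurable_Omega|exact: eta_compact].
Qed.

Lemma omega_integrable_test (c : F) f : c != 0 -> test (Omega_ c) f ->
  cintegrable (omega c) (Omega_ c) f.
Proof.
move=> c0; apply: test_integrable => //; first exact: measurable_Omega_.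
by move=> K; exact: omega_compact.
Qed.

Lemma test_Omega_ (c : F) f : test (Omega F) f -> test (Omega_ c) f.
Proof. by move=> tf; apply: test_closed_sub tf; exact: closed_jtr. Qed.

Lemma Omega__jordan (c : F) (X : omx F) : Omega_ c X -> jordan F X.
Proof. by move=> [[]]. Qed.

Lemma omega_jexp (c : F) (a : oct F) f : c != 0 -> isotropic_oct a -> test (Omega_ c) f ->
  cint (omega c) (Omega_ c) (f \o jexp a) = cint (omega c) (Omega_ c) f.
Proof.
move=> c0 ha tf; have ha' := isotropic_opp ha.
apply: (cint_bijection (g' := jexp (- a))).
- exact: measurable_Omega_.
- by move=> X _; exact: continuous_jexp.
- by move=> X; apply: aut_Omega_ => //; exact: jexp_aut.
- by move=> X; apply: aut_Omega_ => //; exact: jexp_aut.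
- by move=> X /Omega__jordan JX; exact: jexpNK.
- by move=> X /Omega__jordan JX; rewrite -{1}[a]opprK jexpNK.
- by move=> B mB BA; apply: (omega_invariant omega_spec c0) => //; apply: aut_F4; exact: jexp_aut.
- exact: omega_integrable_test.
Qed.

Lemma omega_jperm (c : F) s f : c != 0 -> injective s -> test (Omega_ c) f ->
  cint (omega c) (Omega_ c) (f \o jperm s) = cint (omega c) (Omega_ c) f.
Proof.
move=> c0 sI tf; have [t st ts] := injF_bij sI.
have tI : injective t by exact: can_inj ts.
apply: (cint_bijection (g' := jperm t)).
- exact: measurable_Omega_.
- by move=> X _; exact: continuous_jperm.
- by move=> X; apply: aut_Omega_ => //; exact: jperm_aut.
- by move=> X; apply: aut_Omega_ => //; exact: jperm_aut.
- by move=> X _; apply/matrixP => i j; rewrite !mxE !ts.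
- by move=> X _; apply/matrixP => i j; rewrite !mxE !st.
- by move=> B mB BA; apply: (omega_invariant omega_spec c0) => //; apply: aut_F4; exact: jperm_aut.
- exact: omega_integrable_test.
Qed.

Definition slice f (c : F) : cplx R := cint (omega c) (Omega_ c) f.

Lemma slice_patch f (c : F) : slice (patch (fun=> 0) (Omega F) f) c = slice f c.
Proof.
apply: eq_cint => X [OX _]; rewrite /patch mem_set//.
Qed.

Lemma disintegration f : test (Omega F) f ->
  cint eta (Omega F) f = cint dx [set~ 0] (slice f).
Proof.
move=> tf; have := omega_disintegration omega_spec (test_Sc tf).
rewrite (@eq_cint _ _ _ eta _ _ f) => [->|X OX]; last by rewrite /patch mem_set.
by apply: eq_cint => c _; rewrite -[RHS]slice_patch.
Qed.

Lemma slice_integrable f : test (Omega F) f -> cintegrable dx [set~ 0] (slice f).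
Proof.
move=> tf; have := omega_integrable omega_spec (test_Sc tf).
by apply: eq_cintegrable; [exact: measurable_neq0|move=> c _; exact: slice_patch].
Qed.

Lemma slice_continuous f (c : F) : test (Omega F) f -> c != 0 -> {for c, continuous (slice f)}.
Proof.
move=> tf c0; have := omega_continuous omega_spec (test_Sc tf) c0.
have -> // : (fun a => cint (omega a) (Omega_ a) (patch (fun=> 0) (Omega F) f)) = slice f.
by apply/funext => a; exact: slice_patch.
Qed.

(** Quasi-invariance of [eta] would leave an unknown constant; the exact invariance of each
    [omega c] passes to [eta] by disintegration. *)
Lemma eta_jexp (a : oct F) f : isotropic_oct a -> test (Omega F) f ->
  cint eta (Omega F) (f \o jexp a) = cint eta (Omega F) f.
Proof.
move=> ha tf; have tf' : test (Omega F) (f \o jexp a).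
  exact: (test_comp_jexp two0 (fun _ h => h) (fun g hg X => @aut_Omega R F two0 g X hg) ha tf).
rewrite (disintegration tf') (disintegration tf); apply: eq_cint => c /eqP c0.
by apply: omega_jexp => //; exact: test_Omega_.
Qed.

Lemma eta_jperm s f : injective s -> test (Omega F) f ->
  cint eta (Omega F) (f \o jperm s) = cint eta (Omega F) f.
Proof.
move=> sI tf; have tf' : test (Omega F) (f \o jperm s).
  exact: (test_comp_jperm (fun g hg X => @aut_Omega R F two0 g X hg) sI tf).
rewrite (disintegration tf') (disintegration tf); apply: eq_cint => c /eqP c0.
by apply: omega_jperm => //; exact: test_Omega_.
Qed.

Lemma continuous_omx_scale (a : F) : continuous (@omx_scale F a : omx F -> omx F).
Proof.
move=> M; have hc : (fun _ : omx F => a) @ nbhs M --> a by exact: cvg_cst.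
exact: (cvg_omx_scale (nbhs_filter M) hc (f := id) (fun C hC => hC)).
Qed.

Lemma scaleK (a : F) : a != 0 -> cancel (@omx_scale F a) (@omx_scale F a^-1).
Proof. by move=> a0 X; rewrite omx_scaleA mulVf// omx_scale1. Qed.

Lemma test_scale (a : F) f : a != 0 -> test (Omega F) f -> test (Omega F) (f \o omx_scale a).
Proof.
move=> a0 tf; have a'0 : a^-1 != 0 by rewrite invr_neq0.
apply: (test_comp (g' := omx_scale a^-1) tf).
- by move=> X _; exact: continuous_omx_scale.
- by move=> X _; exact: continuous_omx_scale.
- by move=> X; exact: Omega_scale.
- by move=> X; exact: Omega_scale.
- by move=> X _; exact: scaleK.
- by move=> X _; rewrite -{1}[a]invrK; exact: scaleK.
Qed.

Lemma eta_scale (a : F) f : a != 0 -> test (Omega F) f ->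
  cint eta (Omega F) f = ((vabs a ^+ 12)%:C)%C * cint eta (Omega F) (f \o omx_scale a).
Proof.
move=> a0 tf; have a'0 : a^-1 != 0 by rewrite invr_neq0.
have mO := @measurable_Omega R F.
have mg : measurable_fun (Omega F : set (borel (omx F))) (omx_scale a : borel (omx F) -> borel (omx F)).
  by apply: borel_measurable_fun => // X _; exact: continuous_omx_scale.
rewrite -cintZ//; last by apply: eta_integrable; exact: test_scale.
have sO (X : omx F) : Omega F X -> Omega F (omx_scale a X) by exact: Omega_scale.
have h0 (X : omx F) : 0 <= vabs a ^+ 12 by rewrite exprn_ge0 ?vabs_ge0.
have nuE (B : set (borel (omx F))) : measurable B -> B `<=` Omega F ->
    eta B = (\int[eta]_(X in Omega F `&` omx_scale a @^-1` B) (vabs a ^+ 12)%:E)%E.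
  move=> mB BO; rewrite integral_cst; last exact: mg.
  rewrite -(eta_homogeneous eta_spec a0); last exact: mg.
  congr (eta _); apply/seteqP; split=> [X BX|_ [X [_ BX] <-]]; last by exact: BX.
  exists (omx_scale a^-1 X); last by rewrite -{1}[a]invrK scaleK.
  split; first exact: (Omega_scale two0 a'0 (BO X BX)).
  by rewrite /preimage/= -{1}[a]invrK scaleK.
exact: (cint_change mO mO mg sO (measurable_cst _) h0 nuE (eta_integrable tf)).
Qed.

End measures.

(** * The transfer formula *)

Section transform.
Context (R : realType) (F : nonarchLocalFieldType R).
Variables (psi : F -> cplx R).
Hypotheses (hpsi : is_unitary_char psi) (psiO : has_conductor_O psi).
Variable A : set (omx F).
Hypothesis mA : measurable (A : set (borel (omx F))).
Variable mu : {measure set (borel (omx F)) -> \bar R}.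
Hypothesis mu_radon :
  forall K : set (omx F), compact K -> K `<=` A -> (mu K < +oo)%E.
Implicit Types (f : omx F -> cplx R).

Let ti f : test A f -> cintegrable mu A f.
Proof. by move=> tf; exact: (test_integrable (@omx_hausdorff R F) mA mu_radon tf). Qed.

Definition transform f (s : F) : cplx R := cint mu A (fun X => f X * phase psi s X).

Lemma test_phase f s : s != 0 -> test A f -> test A (fun X => f X * phase psi s X).
Proof. by move=> s0 tf; apply: testM tf _; exact: lc_phase. Qed.

(** x_11 is bounded on the support of f, so psi(s x_11) depends only on s modulo a fixed lattice. *)
Lemma transform_uniform f : test A f ->
  exists2 d : F, d != 0 & forall s s', vabs (s - s') <= vabs d -> transform f s = transform f s'.
Proof.
move=> tf; have [d d0 [_ hd]] := test_supp_bounded tf (oner_neq0 F) (fun M => @cvg_id_jd R F o0 M).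
exists d => // s s' hs; apply: eq_cint => X AX.
have [->|fX] := eqVneq (f X) 0; first by rewrite !mul0r.
congr (_ * _); apply: (psi_near hpsi psiO); rewrite -mulrBl vabsM.
have := hd X AX fX; rewrite vabsM; apply: le_trans.
by apply: ler_wpM2r => //; exact: vabs_ge0.
Qed.

Lemma transform_bounded f : test A f ->
  exists2 C : R, 0 <= C & forall s, s != 0 -> cmod (transform f s) <= C.
Proof.
move=> tf; exists (2 * Rintegral mu A (fun X => cmod (f X))).
  by rewrite mulr_ge0// Rintegral_ge0// => X _; exact: cmod_ge0.
move=> s s0; apply: cmod_cint_le => //; first by apply: ti; exact: test_phase.
  by apply: cintegrable_cmod => //; exact: ti.
by move=> X _; rewrite cmodM (cmod_psi hpsi) mulr1.
Qed.

End transform.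

Section kernel.
Context (R : realType) (F : nonarchLocalFieldType R).
Variables (psi : F -> cplx R) (dx : {measure set (borel F) -> \bar R}).
Hypotheses (hpsi : is_unitary_char psi) (psiO : has_conductor_O psi).
Hypothesis hdx : is_haar dx.
Variable a : F.
Hypothesis a0 : a != 0.
Implicit Types G : F -> cplx R.

(** Integrand of the action of [w] after rescaling by a, with |r|^2 dr = |r|^3 d^x r. G will be an
    [eta_transform], a [mean] of such, or [omega_transform]. *)
Definition kernel G (r : F) : cplx R := G (r / a) * psi r^-1 * ((vabs r ^+ 2)%:C)%C.

Lemma kernel_cmeasurable G (d : F) : d != 0 ->
  (forall s s', vabs (s - s') <= vabs d -> G s = G s') ->
  cmeasurable ([set~ 0] : set (borel F)) (kernel G).
Proof.
move=> d0 hG; apply: locally_constant_cmeasurable; first exact: measurable_neq0.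
move=> r /eqP r0.
have h1 : \forall r' \near r, G (r' / a) = G (r / a).
  apply/nbhs_cballP; exists (d * a); first exact: mulf_neq0.
  move=> r' hr; apply: hG; rewrite -mulrBl vabs_div ler_pdivrMr ?vabs_gt0// -vabsM.
  exact: hr.
have h2 : \forall r' \near r, psi r'^-1 = psi r^-1.
  have h : nbhs r ((fun r' : F => 1 / r') @^-1` cball (1 / r) 1).
    exact: (@continuous_divr R F 1 (oner_neq0 F) r r0 _ (@nbhs_cball R F _ 1 (oner_neq0 F))).
  apply: filterS h => r'; rewrite /preimage/cball/= !mul1r vabs1; exact: psi_near.
apply: filterS3 h1 h2 (vabs_locally_constant r0) => r' e1 e2 e3 _.
by rewrite /kernel e1 e2 e3.
Qed.

Lemma kernel_bound G (C0 C1 : R) (r : F) : 0 <= C0 -> 0 <= C1 -> r != 0 ->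
  (forall s, s != 0 -> cmod (G s) <= C0) ->
  (forall s, s != 0 -> cmod (G s) <= C1 * vabs s ^- 4) ->
  cmod (kernel G r) <= (C0 + C1 * vabs a ^+ 4) * dominator (r : F).
Proof.
move=> C00 C10 r0 h0 h1; have s0 : r / a != 0 by rewrite mulf_neq0// invr_neq0.
have vr : 0 < vabs r :> R by rewrite vabs_gt0.
have va : 0 < vabs a :> R by rewrite vabs_gt0.
rewrite /kernel !cmodM (cmod_psi hpsi) mulr1 cmod_real ger0_norm ?exprn_ge0 ?vabs_ge0//.
rewrite /dominator; have [r1|r1] := leP (vabs r : R) 1.
  rewrite mulr1; apply: (@le_trans _ _ (C0 * 1)).
    apply: ler_pM => //; [exact: cmod_ge0|by rewrite exprn_ge0 ?vabs_ge0|exact: h0|].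
    by rewrite expr_le1// vabs_ge0.
  by rewrite mulr1 lerDl mulr_ge0// exprn_ge0// vabs_ge0.
apply: (@le_trans _ _ (C1 * vabs (r / a) ^- 4 * vabs r ^+ 2)).
  by apply: ler_wpM2r; [rewrite exprn_ge0 ?vabs_ge0|exact: h1].
rewrite mulrDl [X in _ <= X]addrC.
have -> : C1 * vabs (r / a) ^- 4 * vabs r ^+ 2 = C1 * vabs a ^+ 4 * vabs r ^- 2.
  by rewrite vabs_div; field; rewrite !gt_eqF.
by rewrite lerDl mulr_ge0// invr_ge0 exprn_ge0// vabs_ge0.
Qed.

Lemma dominatorZ_integrable (K : R) :
  dx.-integrable [set~ 0] (EFin \o (fun r : borel F => K * dominator (r : F))).
Proof.
have := integrableZl (@measurable_neq0 R F) K (dominator_integrable hdx).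
by apply: eq_integrable => //; exact: measurable_neq0.
Qed.

Lemma kernel_integrable G (d : F) (C0 C1 : R) : 0 <= C0 -> 0 <= C1 -> d != 0 ->
  (forall s s', vabs (s - s') <= vabs d -> G s = G s') ->
  (forall s, s != 0 -> cmod (G s) <= C0) ->
  (forall s, s != 0 -> cmod (G s) <= C1 * vabs s ^- 4) ->
  cintegrable dx [set~ 0] (kernel G).
Proof.
move=> C00 C10 d0 hG h0 h1.
have mD : measurable ([set~ 0] : set (borel F)) by exact: measurable_neq0.
have b (r : borel F) : [set~ (0 : F)] r -> cmod (kernel G r) <= (C0 + C1 * vabs a ^+ 4) * dominator (r : F).
  by move=> /eqP r0; exact: kernel_bound.
exact: (le_cintegrable mD (kernel_cmeasurable d0 hG) b (dominatorZ_integrable _)).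
Qed.

End kernel.

(** * Slices of [Omega] near trace 1 *)

Section slices.
Context (R : realType) (F : nonarchLocalFieldType R).
Hypothesis two0 : (2 : F) != 0.
Variable dx : {measure set (borel F) -> \bar R}.
Hypothesis hdx : is_haar dx.
Variable eta : {measure set (borel (omx F)) -> \bar R}.
Hypothesis eta_spec : is_eta eta.
Variable omega : F -> {measure set (borel (omx F)) -> \bar R}.
Hypothesis omega_spec : is_omega dx eta omega.
Implicit Types (f h : omx F -> cplx R) (u c : F).

Lemma lc_jtr_ball (A : set (omx F)) u c : c != 0 ->
  locally_constant_on A (fun X => (vabs (jtr X - u) <= vabs c)%R).
Proof.
move=> c0; apply: (@lc_coord R F A _ (fun z : F => (vabs (z - u) <= vabs c)%R)).
  move=> z; have /nbhs_cballP[d d0 hd] := lc_le c0 (z - u).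
  apply/nbhs_cballP; exists d => // y hy; apply: hd.
  by rewrite /cball/= opprB addrA subrK.
by move=> M; exact: continuous_jtr.
Qed.

Lemma eta_ball h u c : test (Omega F) h -> c != 0 -> vabs c < vabs u ->
  cint eta (Omega F) (fun X => h X * (vabs (jtr X - u) <= vabs c)%R%:R) =
  cint dx (cball u c) (slice omega h).
Proof.
move=> th c0 cu.
have tb := test_indic th (lc_jtr_ball (A := Omega F) u c0).
rewrite (disintegration omega_spec tb).
have b0 : [set~ (0 : F)] `&` cball u c = cball u c.
  apply/setIidr => y hy /= y0; move: hy.
  by rewrite y0 /cball/= sub0r vabsN leNgt cu.
rewrite -{}[in RHS]b0 -cint_indic; last exact: measurable_neq0.
apply: eq_cint => y /eqP y0; rewrite /slice -cintZ; first last.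
- by apply: (omega_integrable_test omega_spec) => //; exact: test_Omega_.
- exact: measurable_Omega_.
apply: eq_cint => X [_ ->]; rewrite mulrC; congr ((nat_of_bool _)%:R * _).
by apply/idP/idP => [/mem_set|/set_mem].
Qed.

(** Continuity of the slices in the trace: the mass of h over a small ball of traces around u is the
    slice at u times the volume, up to an arbitrarily small proportion of that volume. *)
Lemma eta_ball_near h u (e : R) : test (Omega F) h -> u != 0 -> 0 < e ->
  exists2 d : F, d != 0 & forall c, c != 0 -> vabs c <= vabs d ->
    cmod (cint eta (Omega F) (fun X => h X * (vabs (jtr X - u) <= vabs c)%R%:R)
          - slice omega h u * ((vabs c * volO dx)%:C)%C) <= 2 * (e * (vabs c * volO dx)).
Proof.
move=> th u0 e0; set z := slice omega h u.
have hz : \forall y \near u, cmod (slice omega h y - z) <= e.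
  have hc : slice omega h @ u --> z := slice_continuous omega_spec th u0.
  have e0' : 0 < ((e%:C)%C : cplx R) by rewrite ltcR.
  have H : \forall y \near u, `|z - slice omega h y| < ((e%:C)%C : cplx R).
    exact: (cvgrPdist_lt _ _).1 hc _ e0'.
  apply: filterS H => y.
  by rewrite distrC normc_cmod ltcR => /ltW.
have [d1 d10 hd1] : exists2 d : F, d != 0 & cball u d `<=` [set y | cmod (slice omega h y - z) <= e].
  exact/nbhs_cballP.
have [d2 d20 hd2] := @vabs_small R F (vabs u) ltac:(by rewrite vabs_gt0).
have [d d0 [dd1 dd2]] := vabs_min d10 d20.
exists d => // c c0 cd.
have cu : vabs c < vabs u := le_lt_trans (le_trans cd dd2) hd2.
rewrite (eta_ball th c0 cu).
have mB := @measurable_cball R F u c c0.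
have iS : cintegrable dx (cball u c) (slice omega h).
  have [ir ii] := slice_integrable omega_spec th.
  have sub : cball u c `<=` [set~ (0 : F)].
    by move=> y hy /= y0; move: hy; rewrite y0 /cball/= sub0r vabsN leNgt cu.
  by split; [exact: (integrableS (@measurable_neq0 R F) mB sub ir)|
    exact: (integrableS (@measurable_neq0 R F) mB sub ii)].
have iZ w : cintegrable dx (cball u c) (fun=> w).
  by apply: (bounded_cintegrable (M := cmod w)) => //; exact: haar_cball_lty.
have -> : z * ((vabs c * volO dx)%:C)%C = - cint dx (cball u c) (fun=> - z).
  by rewrite cint_cst// haar_cball//= mulNr opprK.
rewrite opprK -cintD//.
have -> : e * (vabs c * volO dx) = Rintegral dx (cball u c) (fun=> e).
  by rewrite Rintegral_cst// haar_cball.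
apply: cmod_cint_le => //; first exact: cintegrableD.
  apply/integrableP; split; first exact/measurable_EFinP/measurable_cst.
  by rewrite /= integral_cst// lte_mul_pinfty// ?lee_fin//; exact: haar_cball_lty.
by move=> y hy; apply: hd1; apply: le_trans hy _; exact: le_trans cd dd1.
Qed.

(** Scaling by u preserves [eta] because |u| = 1, and maps the traces within |c| of 1 to those
    within |c| of u. The ball integrals coincide, and the slices follow by shrinking c. *)
Lemma slice_unit_scale h u : test (Omega F) h -> vabs u = 1 :> R ->
  slice omega h u = slice omega (h \o omx_scale u) 1.
Proof.
move=> th u1; have u0 : u != 0 by rewrite -(@vabs_gt0 R) u1.
have th' := test_scale two0 u0 th.
suff H e : 0 < e -> cmod (slice omega h u - slice omega (h \o omx_scale u) 1) <= 4 * e.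
  apply/subr0_eq/cmod_eq0/eqP; rewrite eq_le cmod_ge0 andbT; apply/ler_addgt0Pl => e e0.
  by rewrite addr0; have := H (e / 4) ltac:(by rewrite divr_gt0); rewrite mulrCA divff// mulr1.
move=> e0.
have [d1 d10 h1] := eta_ball_near th u0 e0.
have [d2 d20 h2] := eta_ball_near th' (oner_neq0 F) e0.
have [c c0 [cd1 cd2]] := vabs_min d10 d20.
have {h1} := h1 c c0 cd1; have {h2} := h2 c c0 cd2.
have -> : cint eta (Omega F) (fun X => h X * (vabs (jtr X - u) <= vabs c)%R%:R) =
    cint eta (Omega F) (fun X => (h \o omx_scale u) X * (vabs (jtr X - 1) <= vabs c)%R%:R).
  rewrite (eta_scale two0 eta_spec u0 (test_indic th (lc_jtr_ball (A := Omega F) u c0))).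
  rewrite u1 expr1n mul1r; apply: eq_cint => X [JX _ _] /=; congr (_ * (nat_of_bool (_ <= _))%:R).
  rewrite jtr_scale//; move: (jtr X) => t.
  have -> : u * t - u = u * (t - 1) by ring.
  by rewrite vabsM u1 mul1r.
set E := cint eta _ _; set z := slice _ _ u; set w := slice _ _ 1; set V := vabs c * volO dx.
have V0 : 0 < V by rewrite mulr_gt0 ?vabs_gt0 ?volO_gt0.
move=> h2 h1; rewrite -(ler_pM2r V0).
have -> : cmod (z - w) * V = cmod ((E - w * (V%:C)%C) + (z * (V%:C)%C - E)).
  have -> : (E - w * (V%:C)%C) + (z * (V%:C)%C - E) = (z - w) * (V%:C)%C by ring.
  by rewrite cmodM cmod_real ger0_norm// ltW.
apply: (le_trans (cmodD _ _)).
rewrite -[cmod (z * _ - E)](_ : cmod (E - z * (V%:C)%C) = _); last first.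
  by rewrite -opprB -mulN1r cmodM -[X in cmod X](rmorphN1 (real_complex R)) cmod_real normrN1 mul1r.
by apply: (le_trans (lerD h2 h1)); rewrite le_eqVlt; apply/orP; left; apply/eqP; ring.
Qed.

Lemma scale_small_invariance h : test (Omega F) h ->
  exists2 c : F, c != 0 & vabs c < 1 /\ forall u, vabs (u - 1) <= vabs c ->
    vabs u = 1 :> R /\ forall X, Omega F X -> h (omx_scale u X) = h X.
Proof.
move=> th.
have h1 (X : omx F) : (fun z : F * omx F => 1 + z.1) @ nbhs ((0 : F), X) --> (1 + 0 : F).
  apply: cvgFD; first exact: cvg_cst.
  exact: cvg_fst.
have h2 (X : omx F) : (fun z : F * omx F => 1 / (1 + z.1)) @ nbhs ((0 : F), X) --> (1 / 1 : F).
  have hd : (fun r : F => 1 / r) @ (1 + 0 : F) --> (1 / 1 : F).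
    by rewrite addr0; exact: (@continuous_divr R F 1 (oner_neq0 F) 1 (oner_neq0 F)).
  exact: (@cvg_comp _ _ _ (fun z : F * omx F => 1 + z.1) (fun r : F => 1 / r) _ _ _ (h1 X) hd).
have h3 (X : omx F) : (fun z : F * omx F => z.2) @ nbhs ((0 : F), X) --> X.
  exact: cvg_snd.
have vt (t : F) : vabs t < 1 :> R -> vabs (1 + t) = 1 :> R.
  by move=> t1; rewrite addrC vabsDr vabs1.
have vt0 (t : F) : vabs t < 1 :> R -> 1 + t != 0.
  by move=> t1; rewrite -(@vabs_gt0 R) vt.
have [e e0 e1] := @vabs_small R F 1 ltr01.
have [c c0 hc] : exists2 c : F, c != 0 & forall t, vabs t <= vabs c ->
    forall X, Omega F X -> h (omx_scale (1 + t) X) = h X.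
  apply: (test_small_invariance (g := fun t => omx_scale (1 + t))
    (g' := fun t => omx_scale (1 / (1 + t))) th).
  - move=> X _; rewrite -{2}[X]omx_scale1 -{2}[1]addr0.
    exact: (cvg_omx_scale (nbhs_filter ((0 : F), X)) (h1 X) (h3 X)).
  - move=> X _; rewrite -{2}[X]omx_scale1 -[X in omx_scale X]divr1.
    exact: (cvg_omx_scale (nbhs_filter ((0 : F), X)) (h2 X) (h3 X)).
  - apply/nbhs_cballP; exists e; [exact: e0|move=> t; rewrite /cball/= subr0 => te X OX].
    have t0 := vt0 _ (le_lt_trans te e1).
    split; [exact: Omega_scale| |by rewrite omx_scaleA mul1r mulVf// omx_scale1].
    by apply: Omega_scale => //; rewrite mul1r invr_neq0.
have [d d0 [dc de]] := vabs_min c0 e0.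
exists d => //; split; first exact: le_lt_trans de e1.
move=> u ud; have uE : u = 1 + (u - 1) by ring.
rewrite uE; split; first by apply: vt; apply: le_lt_trans e1; exact: le_trans de.
by move=> X; apply: hc; exact: le_trans ud dc.
Qed.

End slices.

(** As psi has conductor O, the Fourier transform of the indicator of O is its multiple by the
    volume; inversion at 0 says that this volume has square 1. *)
Lemma selfdual_volO (R : realType) (F : nonarchLocalFieldType R) (psi : F -> cplx R)
    (dx : {measure set (borel F) -> \bar R}) :
  is_unitary_char psi -> has_conductor_O psi -> is_selfdual_haar dx psi ->
  volO dx = 1.
Proof.
move=> hpsi psiO [hdx hsd].
have one0 : (1 : F) != 0 by exact: oner_neq0.
pose B : set F := cball 0 1; pose f (x : F) : cplx R := (x \in B)%:R.
have mB : measurable (B : set (borel F)) by exact: measurable_cball.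
have BE x : B x <-> vabs x <= 1 by rewrite /B /cball/= subr0 vabs1.
have Sf : Sc setT f.
  split; [by move=> x /(_ I)| |move=> x _].
    exists B; split => //; first exact: compact_cball.
    by move=> x nB; rewrite /f memNset.
  have [xB|xB] := pselect (B x).
    apply: filterS (open_nbhs_nbhs (conj (@open_cball R F 0 1 one0) xB)) => y yB _.
    by rewrite /f !mem_set.
  apply: filterS (open_nbhs_nbhs (conj (@open_cballC R F 0 1 one0) xB)) => y yB _.
  by rewrite /f !memNset.
have volB : dx B = (volO dx)%:E by rewrite /B haar_cball// vabs1 mul1r.
have ff y : fourier dx psi f y = ((volO dx)%:C)%C * f y.
  rewrite /fourier cint_indic ?setTI; last exact: measurableT.
  have [yB|yB] := pselect (B y).
    transitivity (cint dx B (fun=> 1)); last by rewrite cint_cst// volB /f mem_set// mul1r mulr1.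
    apply: eq_cint => x /BE x1; apply: (psi_int psiO); rewrite vabsM -[leRHS]mulr1.
    by apply: ler_pM; rewrite ?vabs_ge0//; exact/BE.
  rewrite /f memNset// mulr0; apply: (cint_cball_psi hpsi psiO hdx) => //.
  by rewrite mul1r ltNge; apply/negP => /BE.
have fE : fourier dx psi f = fun y => ((volO dx)%:C)%C * f y by apply/funext.
have := hsd f Sf 0; rewrite fE oppr0 /f mem_set; last by apply/BE; rewrite vabs0.
have -> : fourier dx psi (fun y : F => ((volO dx)%:C)%C * (y \in B)%:R) 0 = ((volO dx ^+ 2)%:C)%C.
  transitivity (cint dx setT (fun x : F => (x \in B)%:R * ((volO dx)%:C)%C)).
    by apply: eq_cint => x _; rewrite mulr0 (psi0 psiO) mulr1 mulrC.
  rewrite cint_indic ?setTI; last exact: measurableT.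
  by rewrite cint_cst// volB/= -rmorphM -expr2.
move=> /(congr1 (@complex.Re R))/= h2; apply/eqP.
by rewrite -(@eqrXn2 _ 2) ?expr1n ?h2// ltW// volO_gt0.
Qed.

Section whittaker.
Context (R : realType) (F : nonarchLocalFieldType R).
Hypothesis two0 : (2 : F) != 0.
Variables (psi : F -> cplx R) (dx : {measure set (borel F) -> \bar R}).
Hypotheses (hpsi : is_unitary_char psi) (psiO : has_conductor_O psi).
Hypotheses (hdx : is_haar dx) (vol1 : volO dx = 1).
Variable eta : {measure set (borel (omx F)) -> \bar R}.
Hypothesis eta_spec : is_eta eta.
Variable omega : F -> {measure set (borel (omx F)) -> \bar R}.
Hypothesis omega_spec : is_omega dx eta omega.
Implicit Types (f h : omx F -> cplx R) (a b s u : F).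

Definition twist f b (X : omx F) : cplx R := f X * psi (b * jtr X).

Lemma test_twist f b : test (Omega F) f -> test (Omega F) (twist f b).
Proof.
move=> tf; apply: testM tf _.
apply: (@lc_coord R F (Omega F) _ (fun z => psi (b * z)) (@jtr F)); last first.
  by move=> M; exact: continuous_jtr.
have [->|b0] := eqVneq b 0; last exact: lc_psi.
by move=> z; apply: filterE => y; rewrite !mul0r.
Qed.

Definition eta_transform f b s : cplx R := transform psi (Omega F) eta (twist f b) s.

Lemma phase_scale s a X : phase psi s (omx_scale a X) = phase psi (s * a) X.
Proof. by rewrite /phase /jd mxE /= mxE mulrA. Qed.

Lemma whittaker_wtn f a b : a != 0 -> test (Omega F) f ->
  whittaker psi dx eta f (wmx F *m tmx a *m nmx b) =
  cint dx [set~ 0] (fun r : F => ((vabs a ^- 6)%:C)%C * kernel psi a (eta_transform f b) r).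
Proof.
move=> a0 tf; rewrite /whittaker (act_wtn dx eta hpsi b f a0) /act_w.
apply: eq_cint => r /eqP r0.
have va : vabs a != 0 :> R by rewrite gt_eqF// vabs_gt0.
have s0 : r / a != 0 by rewrite mulf_neq0// invr_neq0.
have tg := test_phase hpsi psiO s0 (test_twist b tf).
have -> : cint eta (Omega F) (fun X => act_t a (act_n psi b f) X * psi (r * jpair (je F) X)) =
    ((vabs a ^- 6)%:C)%C * eta_transform f b (r / a).
  (* [act_t] contributes |a|^6, and the substitution of a x for x in [eta] contributes |a|^-12. *)
  transitivity (((vabs a ^+ 6)%:C)%C * cint eta (Omega F)
      ((fun Y => twist f b Y * phase psi (r / a) Y) \o omx_scale a)).
    rewrite -cintZ; first last.
    - by apply: (eta_integrable eta_spec); exact: test_scale.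
    - exact: measurable_Omega.
    apply: eq_cint => X [JX _ _]; rewrite /act_t /act_n /twist /= phase_scale// divfK//.
    rewrite jpair_je// -/(phase psi r X) -!mulrA; congr (_ * _).
    by rewrite mulrCA mulrA.
  rewrite /eta_transform /transform (eta_scale two0 eta_spec a0 tg) mulrA -rmorphM.
  by congr ((_)%:C%C * _); field.
rewrite /kernel -!mulrA; congr (_ * (_ * (_ * _))).
rewrite -rmorphM; congr (_%:C)%C; have vr : vabs r != 0 :> R by rewrite gt_eqF// vabs_gt0.
by field.
Qed.

(** One lattice d serves for every s, because the trace is bounded on the support. It is normalised
    on Tr x - 1, the point where the characters are evaluated once psi(-b) is included. *)
Lemma twist_uniform f : test (Omega F) f -> exists2 d : F, d != 0 & vabs d <= 1 /\
  [/\ forall X, Omega F X -> f X != 0 -> vabs (d * (jtr X - 1)) <= 1,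
     forall b b', vabs (b - b') <= vabs d -> psi (- b) = psi (- b') &
     forall b b', vabs (b - b') <= vabs d -> eta_transform f b =1 eta_transform f b'].
Proof.
move=> tf; have cu (M : omx F) : (fun X : omx F => jtr X - 1) @ M --> jtr M - 1.
  apply: (@cvgFD R F _ (nbhs M) (nbhs_filter M) (@jtr F) (fun=> - 1)); first exact: continuous_jtr.
  exact: cvg_cst.
have [d d0 [d1 hd]] := test_supp_bounded tf (oner_neq0 F) cu.
exists d => //; rewrite vabs1 in d1; split => //; split => // b b' hb.
  by apply: (psi_near hpsi psiO); rewrite opprK addrC vabsBC (le_trans _ d1)// vabsBC.
move=> s; apply: eq_cint => X OX; rewrite /twist.
have [->|fX] := eqVneq (f X) 0; first by rewrite !mul0r.
congr (_ * _ * _); apply: (psi_near hpsi psiO); rewrite -mulrBl vabsM.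
apply: (@le_trans _ _ (vabs (d * jtr X))).
  by rewrite vabsM; apply: ler_wpM2r => //; exact: vabs_ge0.
have -> : d * jtr X = d * (jtr X - 1) + d by ring.
by apply: vabsD_le => //; exact: hd.
Qed.

(* The finite sum is the [b]-integral over the ball of radius |c| of the
   integrand of the orbital integral, before integration over [r]. *)
Lemma sum_eta_transform f (c d : F) ts (s : F) : test (Omega F) f -> s != 0 -> d != 0 ->
  (forall X, Omega F X -> f X != 0 -> vabs (d * (jtr X - 1)) <= 1) ->
  ball_reps c d ts -> 1 < vabs c ->
  \sum_(t <- ts) ((vabs d)%:C)%C * psi (- t) * eta_transform f t s =
  ((vabs c)%:C)%C * cint dx (cball 1 c^-1) (slice omega (fun X => f X * phase psi s X)).
Proof.
move=> tf s0 d0 hd hts c1; have tp := test_phase hpsi psiO s0 tf.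
have c0 : c != 0 by rewrite -(@vabs_gt0 R) (lt_trans _ c1).
rewrite -(eta_ball omega_spec tp); last by rewrite vabsV vabs1 invf_lt1// (lt_trans _ c1).
  transitivity (cint eta (Omega F) (fun X => \sum_(t <- ts)
      ((vabs d)%:C)%C * psi (- t) * (twist f t X * phase psi s X))).
    rewrite cint_sum; last first.
    - move=> t; apply: cintegrableZ; first exact: measurable_Omega.
      by apply: (eta_integrable eta_spec); apply: test_phase => //; exact: test_twist.
    - exact: measurable_Omega.
    apply: eq_bigr => t _; rewrite cintZ//; first exact: measurable_Omega.
    by apply: (eta_integrable eta_spec); apply: test_phase => //; exact: test_twist.
  rewrite -cintZ; first last.
  - apply: (eta_integrable eta_spec).
    by apply: test_indic => //; apply: lc_jtr_ball; rewrite invr_neq0.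
  - exact: measurable_Omega.
  apply: eq_cint => X OX; rewrite /twist.
  have [->|fX] := eqVneq (f X) 0.
    by rewrite !mul0r mulr0 big1// => t _; rewrite !mul0r mulr0.
  transitivity (f X * phase psi s X * ((vabs d)%:C)%C * \sum_(t <- ts) psi (t * (jtr X - 1))).
    rewrite mulr_sumr; apply: eq_bigr => t _.
    by rewrite mulrBr mulr1 (psiD hpsi); ring.
  rewrite (char_sum hpsi psiO hdx d0 hts (hd X OX fX)).
  have -> : (vabs (c * (jtr X - 1)) <= 1)%R = (vabs (jtr X - 1) <= vabs c^-1)%R.
    by rewrite vabsM vabsV -ler_pdivlMl ?mulr1// vabs_gt0.
  have -> : ((vabs c)%:C)%C = (size ts)%:R * ((vabs d)%:C)%C :> cplx R.
    by rewrite -(reps_size hts) rmorphM rmorph_nat.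
  ring.
by rewrite invr_neq0.
Qed.

End whittaker.

(** * Pointwise limit and uniform majorant of the means *)

Section orbital.
Context (R : realType) (F : nonarchLocalFieldType R).
Hypothesis two0 : (2 : F) != 0.
Variables (psi : F -> cplx R) (dx : {measure set (borel F) -> \bar R}).
Hypotheses (hpsi : is_unitary_char psi) (psiO : has_conductor_O psi).
Hypotheses (hdx : is_haar dx) (vol1 : volO dx = 1).
Variable eta : {measure set (borel (omx F)) -> \bar R}.
Hypothesis eta_spec : is_eta eta.
Variable omega : F -> {measure set (borel (omx F)) -> \bar R}.
Hypothesis omega_spec : is_omega dx eta omega.
Implicit Types (f h : omx F -> cplx R) (a b s u : F).

Definition omega_transform f s : cplx R := transform psi (Omega_ 1) (omega 1) f s.

Lemma eta_decays f : test (Omega F) f -> decays psi (Omega F) eta f.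
Proof.
move=> tf; exact: (decays_test two0 hpsi psiO hdx (fun X (h : Omega F X) => h) (@measurable_Omega R F)
  (fun g hg X => @aut_Omega R F two0 g X hg) (fun K => @eta_compact R F eta eta_spec K)
  (fun b : oct F => @eta_jexp R F two0 dx eta omega omega_spec b)
  (fun p => @eta_jperm R F two0 dx eta omega omega_spec p) tf).
Qed.

Lemma omega_decays f : test (Omega F) f -> decays psi (Omega_ 1) (omega 1) f.
Proof.
have one0 : (1 : F) != 0 := oner_neq0 F.
move=> tf; exact: (decays_test two0 hpsi psiO hdx (fun X (h : Omega_ 1 X) => h.1)
  (@measurable_Omega_ R F 1) (fun g hg X => @aut_Omega_ R F two0 g 1 X hg)
  (fun K => @omega_compact R F dx eta omega omega_spec 1 K one0)
  (fun (b : oct F) h => @omega_jexp R F two0 dx eta omega omega_spec 1 b h one0)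
  (fun p h => @omega_jperm R F two0 dx eta omega omega_spec 1 p h one0) (test_Omega_ 1 tf)).
Qed.

Lemma decays_pos (A : set (omx F)) (mu : {measure set (borel (omx F)) -> \bar R}) f :
  decays psi A mu f -> exists2 C : R, 0 <= C &
    forall s, s != 0 -> cmod (transform psi A mu f s) <= C * vabs s ^- 4.
Proof.
move=> [C hC]; exists `|C|; first exact: normr_ge0.
move=> s s0; apply: (le_trans (hC s s0)); apply: ler_wpM2r; last exact: ler_norm.
by rewrite invr_ge0 exprn_ge0// vabs_ge0.
Qed.

Lemma eta_kernel_integrable a f b : a != 0 -> test (Omega F) f ->
  cintegrable dx [set~ 0] (kernel psi a (eta_transform psi eta f b)).
Proof.
move=> a0 tf; have tb := test_twist hpsi psiO b tf.
have [d d0 hd] := transform_uniform hpsi psiO eta tb.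
have [C0 C00 h0] := transform_bounded hpsi psiO (@measurable_Omega R F) (eta_compact eta_spec) tb.
have [C1 C10 h1] := decays_pos (eta_decays tb).
exact: (kernel_integrable hpsi psiO hdx a0 C00 C10 d0 hd h0 h1).
Qed.

Lemma omega_kernel_integrable a f : a != 0 -> test (Omega F) f ->
  cintegrable dx [set~ 0] (kernel psi a (omega_transform f)).
Proof.
move=> a0 tf; have one0 : (1 : F) != 0 := oner_neq0 F.
have t1 := test_Omega_ 1 tf.
have [d d0 hd] := transform_uniform hpsi psiO (omega 1) t1.
have [C0 C00 h0] := transform_bounded hpsi psiO (@measurable_Omega_ R F 1)
  (fun K => @omega_compact R F dx eta omega omega_spec 1 K one0) t1.
have [C1 C10 h1] := decays_pos (omega_decays tf).
exact: (kernel_integrable hpsi psiO hdx a0 C00 C10 d0 hd h0 h1).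
Qed.

(** Scaling by u near 1 preserves f and only rescales the phase, so the slice at u is W(s u). Since
    |s u| = |s|, the bounds for trace 1 hold with a neighbourhood of 1 that does not depend on s. *)
Lemma slice_bound f : test (Omega F) f ->
  exists2 c : F, c != 0 & vabs c < 1 /\ exists C0 C1 : R, [/\ 0 <= C0, 0 <= C1 &
    forall u s, vabs (u - 1) <= vabs c -> s != 0 ->
      let z := slice omega (fun X => f X * phase psi s X) u in
      cmod z <= C0 /\ cmod z <= C1 * vabs s ^- 4].
Proof.
move=> tf; have one0 : (1 : F) != 0 := oner_neq0 F.
have [c c0 [c1 hc]] := scale_small_invariance two0 tf.
have t1 := test_Omega_ 1 tf.
have [C0 C00 h0] := transform_bounded hpsi psiO (@measurable_Omega_ R F 1)
  (fun K => @omega_compact R F dx eta omega omega_spec 1 K one0) t1.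
have [C1 C10 h1] := decays_pos (omega_decays tf).
exists c => //; split => //; exists C0, C1; split => // u s hu s0.
have [u1 fu] := hc u hu; have u0 : u != 0 by rewrite -(@vabs_gt0 R) u1.
have us0 : s * u != 0 by exact: mulf_neq0.
have -> : slice omega (fun X => f X * phase psi s X) u = omega_transform f (s * u).
  rewrite (slice_unit_scale two0 hdx eta_spec omega_spec (test_phase hpsi psiO s0 tf) u1).
  by apply: eq_cint => X [OX _] /=; rewrite phase_scale fu.
split; first exact: h0.
by have := h1 _ us0; rewrite vabsM u1 mulr1.
Qed.

Lemma ball_integral_bound (c : F) (C : R) (G : F -> cplx R) : c != 0 ->
  cintegrable dx (cball 1 c) G -> (forall u, vabs (u - 1) <= vabs c -> cmod (G u) <= C) ->
  cmod (((vabs c^-1)%:C)%C * cint dx (cball 1 c) G) <= 2 * C.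
Proof.
move=> c0 iG hG; have mB := @measurable_cball R F 1 c c0.
rewrite cmodM cmod_real ger0_norm ?vabs_ge0//.
have hC : dx.-integrable (cball 1 c) (EFin \o (fun=> C)).
  apply/integrableP; split; first exact/measurable_EFinP/measurable_cst.
  by rewrite /= integral_cst// lte_mul_pinfty// ?lee_fin//; exact: haar_cball_lty.
have vc : vabs c != 0 :> R by rewrite gt_eqF// vabs_gt0.
have := cmod_cint_le mB iG hC hG; rewrite Rintegral_cst// haar_cball//= vol1 mulr1 => h.
rewrite vabsV mulrC ler_pdivrMr ?vabs_gt0//.
by apply: (le_trans h); rewrite mulrA.
Qed.

(** Finite sum for the integral of psi(-b) H_b(s) over a ball; [sum_eta_transform] identifies it
    with the mean of the slices over a dual ball around trace 1. *)
Definition mean f (d : F) (ts : seq F) s : cplx R :=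
  \sum_(t <- ts) ((vabs d)%:C)%C * psi (- t) * eta_transform psi eta f t s.

Lemma slice_ball_integrable h (c : F) : test (Omega F) h -> c != 0 -> vabs c < 1 ->
  cintegrable dx (cball 1 c) (slice omega h).
Proof.
move=> th c0 c1; have [ir ii] := slice_integrable omega_spec th.
have mB := @measurable_cball R F 1 c c0.
have sub : cball 1 c `<=` [set~ (0 : F)].
  by move=> y hy /= y0; move: hy; rewrite y0 /cball/= sub0r vabsN vabs1 leNgt c1.
by split; [exact: (integrableS (@measurable_neq0 R F) mB sub ir)|
    exact: (integrableS (@measurable_neq0 R F) mB sub ii)].
Qed.

(** Here f times the phase is scale invariant near 1, so the averaged slices all equal the slice at
    1. The radius e depends on s, hence the need for a separate majorant. *)
Lemma mean_omega f (d : F) (s : F) : test (Omega F) f -> s != 0 -> d != 0 ->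
  (forall X, Omega F X -> f X != 0 -> vabs (d * (jtr X - 1)) <= 1) ->
  exists2 e : F, e != 0 & forall (c : F) ts, ball_reps c d ts -> 1 < vabs c ->
    vabs c^-1 <= vabs e -> mean f d ts s = omega_transform f s.
Proof.
move=> tf s0 d0 hd; have tp := test_phase hpsi psiO s0 tf.
have [e e0 [e1 he]] := scale_small_invariance two0 tp.
exists e => // c ts hts c1 ce.
have c0 : c != 0 by rewrite -(@vabs_gt0 R) (lt_trans _ c1).
rewrite /mean (sum_eta_transform hpsi psiO hdx eta_spec omega_spec tf s0 d0 hd hts c1).
transitivity (((vabs c)%:C)%C * cint dx (cball 1 c^-1) (fun=> omega_transform f s)).
  congr (_ * _); apply: eq_cint => u hu; have hu' := le_trans hu ce.
  have [u1 fu] := he u hu'.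
  rewrite (slice_unit_scale two0 hdx eta_spec omega_spec tp u1).
  by apply: eq_cint => X [OX _]; exact: fu.
have c'0 : c^-1 != 0 by rewrite invr_neq0.
rewrite cint_cst; last exact: measurable_cball.
rewrite haar_cball//= vol1 mulr1 mulrCA -rmorphM vabsV divff ?mulr1//.
by rewrite gt_eqF// vabs_gt0.
Qed.

Lemma mean_bound f (d : F) : test (Omega F) f -> d != 0 ->
  (forall X, Omega F X -> f X != 0 -> vabs (d * (jtr X - 1)) <= 1) ->
  exists2 e : F, e != 0 & exists C0 C1 : R, [/\ 0 <= C0, 0 <= C1 &
    forall (c : F) ts s, ball_reps c d ts -> 1 < vabs c -> vabs c^-1 <= vabs e -> s != 0 ->
      cmod (mean f d ts s) <= C0 /\ cmod (mean f d ts s) <= C1 * vabs s ^- 4].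
Proof.
move=> tf d0 hd; have [e e0 [e1 [C0 [C1 [C00 C10 h]]]]] := slice_bound tf.
exists e => //; exists (2 * C0), (2 * C1); split; rewrite ?mulr_ge0//.
move=> c ts s hts c1 ce s0.
have c0 : c != 0 by rewrite -(@vabs_gt0 R) (lt_trans _ c1).
have c'0 : c^-1 != 0 by rewrite invr_neq0.
have tp := test_phase hpsi psiO s0 tf.
have iS := slice_ball_integrable tp c'0 (le_lt_trans ce e1).
rewrite /mean (sum_eta_transform hpsi psiO hdx eta_spec omega_spec tf s0 d0 hd hts c1).
rewrite -{1 3}[c]invrK -mulrA.
split; apply: ball_integral_bound => // u hu.
  exact: (h u s (le_trans hu ce) s0).1.
exact: (h u s (le_trans hu ce) s0).2.
Qed.

End orbital.

(** * The orbital integral as a limit *)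

Section orbital_limit.
Context (R : realType) (F : nonarchLocalFieldType R).
Hypothesis two0 : (2 : F) != 0.
Variable pi : F.
Hypothesis pi_unif : is_uniformizer (@vabs R F) pi.
Variables (psi : F -> cplx R) (dx : {measure set (borel F) -> \bar R}).
Hypotheses (hpsi : is_unitary_char psi) (psiO : has_conductor_O psi).
Hypotheses (hdx : is_haar dx) (vol1 : volO dx = 1).
Variable eta : {measure set (borel (omx F)) -> \bar R}.
Hypothesis eta_spec : is_eta eta.
Variable omega : F -> {measure set (borel (omx F)) -> \bar R}.
Hypothesis omega_spec : is_omega dx eta omega.
Implicit Types (f : omx F -> cplx R).

Lemma uniformizer_ball n :
  [set pi ^- n * y | y in @ring_of_integers R F] = cball 0 (pi ^- n).
Proof.
have p0 : pi ^+ n != 0 by rewrite expf_neq0// (uniformizer_neq0 pi_unif).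
apply/seteqP; split=> [_ [y y1 <-]|x].
  rewrite /cball/= subr0 vabsM -[leRHS]mulr1; apply: ler_pM; rewrite ?vabs_ge0//.
rewrite /cball/= subr0 => hx; exists (pi ^+ n * x); last by rewrite mulKf.
by rewrite /ring_of_integers/= vabsM mulrC -ler_pdivlMr ?vabs_gt0// mul1r -vabsV.
Qed.

Lemma kernel_sum a (ts : seq F) (z : F -> cplx R) (G : F -> F -> cplx R) (r : F) :
  kernel psi a (fun s => \sum_(t <- ts) z t * G t s) r =
  \sum_(t <- ts) z t * kernel psi a (G t) r.
Proof. by rewrite /kernel !mulr_suml; apply: eq_bigr => t _; rewrite !mulrA. Qed.

Lemma cint_cball_sum1 (x c d : F) ts (G : F -> cplx R) : d != 0 -> ball_reps c d ts ->
  (forall y z, cball x c y -> cball x c z -> vabs (y - z) <= vabs d -> G y = G z) ->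
  cint dx (cball x c) G = \sum_(t <- ts) ((vabs d)%:C)%C * G (x + t).
Proof. by move=> d0 hts hG; rewrite (cint_cball_sum hdx d0 hts hG) vol1 mulr1. Qed.

Lemma mean_kernel_integrable f (a d : F) ts : test (Omega F) f -> a != 0 ->
  cintegrable dx [set~ 0] (kernel psi a (mean psi eta f d ts)).
Proof.
move=> tf a0; have mD : measurable ([set~ 0] : set (borel F)) by exact: measurable_neq0.
have iK t := eta_kernel_integrable two0 hpsi psiO hdx eta_spec omega_spec t a0 tf.
have iS := cintegrable_sum ts mD (fun t => cintegrableZ (((vabs d)%:C)%C * psi (- t)) mD (iK t)).
by apply: eq_cintegrable iS => // r _; rewrite /mean kernel_sum.
Qed.

(** Modulo d the integrand is constant in b, so the integral over b is a finite sum and enters the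
    integral over r by linearity. *)
Lemma orbital_sum f (a d : F) n ts : test (Omega F) f -> a != 0 -> d != 0 -> vabs d <= 1 ->
  ball_reps (pi ^- n) d ts ->
  (forall b b', vabs (b - b') <= vabs d -> psi (- b) = psi (- b')) ->
  (forall b b', vabs (b - b') <= vabs d -> eta_transform psi eta f b =1 eta_transform psi eta f b') ->
  cint dx [set pi ^- n * y | y in @ring_of_integers R F]
    (fun b : F => whittaker psi dx eta f (wmx F *m tmx a *m nmx b) * conjc (psi b)) =
  cint dx [set~ 0] (fun r : F => ((vabs a ^- 6)%:C)%C * kernel psi a (mean psi eta f d ts) r).
Proof.
move=> tf a0 d0 d1 hts hN hH; rewrite uniformizer_ball.
have mD : measurable ([set~ 0] : set (borel F)) by exact: measurable_neq0.
have iK b := eta_kernel_integrable two0 hpsi psiO hdx eta_spec omega_spec b a0 tf.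
transitivity (cint dx (cball 0 (pi ^- n)) (fun b : F =>
    ((vabs a ^- 6)%:C)%C * cint dx [set~ 0] (kernel psi a (eta_transform psi eta f b)) * psi (- b))).
  apply: eq_cint => b _; rewrite (whittaker_wtn two0 dx hpsi psiO eta_spec b a0 tf).
  by rewrite cintZ// (conj_psi hpsi psiO).
rewrite (cint_cball_sum1 d0 hts); last first.
  move=> b b' _ _ hb; have e : cint dx [set~ 0] (kernel psi a (eta_transform psi eta f b)) =
      cint dx [set~ 0] (kernel psi a (eta_transform psi eta f b')).
    by apply: eq_cint => r _; rewrite /kernel (hH b b' hb).
  by rewrite e (hN b b' hb).
transitivity (cint dx [set~ 0] (fun r : F => \sum_(t <- ts)
    (((vabs d)%:C)%C * psi (- t) * ((vabs a ^- 6)%:C)%C) * kernel psi a (eta_transform psi eta f t) r)).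
  rewrite (cint_sum ts mD (fun t => cintegrableZ (((vabs d)%:C)%C * psi (- t) * ((vabs a ^- 6)%:C)%C) mD (iK t))).
  apply: eq_bigr => t _; rewrite (cintZ _ mD (iK t)) add0r.
  move: (cint _ _ _) (psi _) (_%:C)%C (_%:C)%C => x y z w; ring.
apply: eq_cint => r _; rewrite /mean kernel_sum mulr_sumr; apply: eq_bigr => t _.
by ring.
Qed.

Lemma orbital_integralE f (a : F) : Sc (Omega F) f -> a != 0 ->
  orbital_integral psi dx pi (whittaker psi dx eta f) a =
  ((vabs a ^- 6)%:C)%C * cint dx [set~ 0] (kernel psi a (omega_transform psi omega f)).
Proof.
move=> /Sc_test tf a0; rewrite /orbital_integral (negPf a0).
have mD : measurable ([set~ 0] : set (borel F)) by exact: measurable_neq0.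
have [d d0 [d1 [hd hN hH]]] := twist_uniform hpsi psiO eta tf.
have [e e0 [C0 [C1 [C00 C10 hb]]]] := mean_bound two0 hpsi psiO hdx vol1 eta_spec omega_spec tf d0 hd.
have p0 n : pi ^- n != 0 by rewrite invr_neq0// expf_neq0// (uniformizer_neq0 pi_unif).
have /andP[vp0 vp1] := proj1 pi_unif.
have hreps n : exists ts, ball_reps (pi ^- n) d ts.
  apply: exists_ball_reps => //; rewrite vabsV vabsX (le_trans d1)//.
  by rewrite invf_ge1 ?exprn_gt0// exprn_ile1// ltW.
have [ts hts] := choice hreps.
have [N hN0] : exists n, vabs pi ^+ n < vabs e.
  by apply: (expr_lt_eps (proj1 pi_unif)); rewrite vabs_gt0.
(* The sequence is shifted by N + 1: N brings the dual radius below |e|, and the extra 1 keeps the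
   radius of the ball above 1 even for n = N = 0. *)
have c1 n : 1 < vabs (pi ^- (n + N.+1)) :> R.
  by rewrite vabsV vabsX invf_gt1 ?exprn_gt0// exprn_ilt1// ?addnS// ltW.
have ce n : vabs (pi ^- (n + N.+1))^-1 <= vabs e.
  rewrite invrK vabsX (le_trans _ (ltW hN0))//.
  by apply: ler_wiXn2l; rewrite ?(ltW vp0) ?(ltW vp1)// -addSnnS leq_addl.
pose z : cplx R := ((vabs a ^- 6)%:C)%C.
pose h n (r : F) := z * kernel psi a (mean psi eta f d (ts n)) r.
pose g (r : F) := z * kernel psi a (omega_transform psi omega f) r.
have iw := omega_kernel_integrable two0 hpsi psiO hdx omega_spec a0 tf.
have lim_h : (fun n => cint dx [set~ 0] (h (n + N.+1)%N)) @ \oo --> cint dx [set~ 0] g.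
  apply: (@cvg_cint R _ _ dx [set~ 0] (fun n => h (n + N.+1)%N) g
    (fun r : F => (vabs a ^- 6 * (C0 + C1 * vabs a ^+ 4)) * dominator (r : F))) => //.
  - move=> n; apply: (@cintegrable_measurable _ _ _ dx).
    by apply: cintegrableZ => //; exact: mean_kernel_integrable.
  - by apply: (@cintegrable_measurable _ _ _ dx); exact: cintegrableZ.
  - exact: dominatorZ_integrable.
  - move=> n r /eqP r0; rewrite /h /z cmodM cmod_real -mulrA ger0_norm; last first.
      by rewrite invr_ge0 exprn_ge0// vabs_ge0.
    apply: ler_wpM2l; first by rewrite invr_ge0 exprn_ge0// vabs_ge0.
    apply: kernel_bound => // s s0.
      exact: (hb _ _ s (hts _) (c1 n) (ce n) s0).1.
    exact: (hb _ _ s (hts _) (c1 n) (ce n) s0).2.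
  - move=> r /eqP r0; have s0 : r / a != 0 by rewrite mulf_neq0// invr_neq0.
    have [e' e'0 he'] := mean_omega two0 hpsi psiO hdx vol1 eta_spec omega_spec tf s0 d0 hd.
    have [M hM] : exists n, vabs pi ^+ n < vabs e'.
      by apply: (expr_lt_eps (proj1 pi_unif)); rewrite vabs_gt0.
    exists M => // n /= Mn; rewrite /h /g /kernel; congr (_ * (_ * _ * _)).
    apply: (he' _ _ (hts _) (c1 n)); rewrite invrK vabsX (le_trans _ (ltW hM))//.
    by apply: ler_wiXn2l; rewrite ?(ltW vp0) ?(ltW vp1)// (leq_trans Mn)// leq_addr.
apply: (cvg_lim (@cplx_hausdorff R)).
rewrite -[_ * _](cintZ _ mD iw) -(cvg_shiftn N.+1).
have <- : (fun n => cint dx [set~ 0] (h (n + N.+1)%N)) =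
    (fun n => cint dx [set pi ^- (n + N.+1) * y | y in @ring_of_integers R F]
      (fun b : F => whittaker psi dx eta f (wmx F *m tmx a *m nmx b) * conjc (psi b))).
  by apply/funext => n; rewrite (orbital_sum tf a0 d0 d1 (hts _) hN hH).
exact: lim_h.
Qed.

End orbital_limit.

Section inversion_formula.
Context (R : realType) (F : nonarchLocalFieldType R).
Variables (psi : F -> cplx R) (dx : {measure set (borel F) -> \bar R}).
Hypothesis hdx : is_haar dx.

Lemma cint_neq0 (f : F -> cplx R) : f 0 = 0 -> cint dx setT f = cint dx [set~ 0] f.
Proof.
move=> f0; rewrite -[in RHS](setTI [set~ (0 : F)]) -cint_indic; last exact: measurableT.
apply: eq_cint => x _; have [->|/eqP x0] := eqVneq (x : F) 0; first by rewrite f0 mulr0.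
by rewrite mem_set// mul1r.
Qed.

(* Substitution of [a / k] for [r]. *)
Lemma kernel_inversion (W : F -> cplx R) (a : F) : a != 0 ->
  cintegrable dx [set~ 0] (kernel psi a W) ->
  cint dx [set~ 0] (kernel psi a W) =
  ((vabs a ^+ 3)%:C)%C * cint dx setT (fun k : F =>
    W k^-1 * psi (k * a^-1) * ((vabs k ^- 4)%:C)%C).
Proof.
move=> a0 iK; have mD : measurable ([set~ 0] : set (borel F)) by exact: measurable_neq0.
pose D : set (borel F) := [set~ (0 : F)].
pose phi (k : borel F) : borel F := a / (k : F).
pose w (k : borel F) : R := vabs a * vabs (k : F) ^- 2.
have mw : measurable_fun D w.
  apply: locally_constant_measurable => // x /eqP x0.
  by apply: filterS (vabs_locally_constant x0) => y hy _; rewrite /w hy.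
have mphi : measurable_fun D phi.
  by apply: borel_measurable_fun => // x /eqP x0; exact: continuous_divr.
have w0 k : 0 <= w k by rewrite mulr_ge0 ?invr_ge0 ?exprn_ge0 ?vabs_ge0.
have phiD k : D k -> D (phi k).
  by move=> /eqP k0; apply/eqP; rewrite mulf_neq0 ?invr_neq0.
have hI := haar_inversion hdx a0.
have ic := cintegrable_change mD mD mphi phiD mw w0 hI iK.
have va : vabs a != 0 :> R by rewrite gt_eqF// vabs_gt0.
(* Since 0^-1 = 0, the factor |k|^-4 vanishes at k = 0 and the integral over F is the one over
   F^x. *)
rewrite (cint_change mD mD mphi phiD mw w0 hI iK) cint_neq0; last first.
  have -> : vabs (0 : F) ^- 4 = 0 :> R by rewrite vabs0 expr0n invr0.
  by rewrite rmorph0 mulr0.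
have e (k : F) : D k -> ((vabs a ^- 3)%:C)%C * (((w k)%:C)%C * kernel psi a W (phi k)) =
    W k^-1 * psi (k * a^-1) * ((vabs k ^- 4)%:C)%C.
  move=> /eqP k0; have vk : vabs k != 0 :> R by rewrite gt_eqF// vabs_gt0.
  rewrite /kernel /phi invf_div [a / k / a](_ : _ = k^-1); last by rewrite mulrAC divff// mul1r.
  move: (W k^-1) (psi (k / a)) => x y.
  (* The Jacobian |a| |k|^-2 times the weight |a / k|^2 is |a|^3 |k|^-4. *)
  rewrite [LHS](_ : _ = x * y * ((vabs a ^- 3 * w k * vabs (a / k) ^+ 2)%:C)%C).
    congr (_ * (_)%:C)%C; rewrite /w vabs_div; field; rewrite ?vk ?va//.
  by rewrite !rmorphM/=; ring.
rewrite -(@eq_cint R _ (borel F) dx _ _ _ e) (cintZ _ mD ic) mulrA -rmorphM divff ?mul1r//.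
exact: expf_neq0.
Qed.

End inversion_formula.

Section fibres.
Context (R : realType) (F : nonarchLocalFieldType R).
Hypothesis two0 : (2 : F) != 0.
Variables (psi : F -> cplx R) (dx : {measure set (borel F) -> \bar R}).
Hypotheses (hpsi : is_unitary_char psi) (psiO : has_conductor_O psi).
Variable omega : F -> {measure set (borel (omx F)) -> \bar R}.
Variable nu : F -> {measure set (borel (omx F)) -> \bar R}.
Hypothesis nu_spec : is_fibre_measure dx (omega 1) nu.
Implicit Types (f : omx F -> cplx R).

(** On the fibre over t the phase is the constant psi(t s). The functions are extended by zero
    because the axioms on [nu] concern such extensions. *)
Lemma fibre_integral_phase f (s t : F) : test (Omega_ (1 : F)) f ->
  fibre_integral nu (patch (fun=> 0) (Omega_ (1 : F)) (fun X => f X * phase psi s X)) t =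
  fibre_integral nu (patch (fun=> 0) (Omega_ (1 : F)) f) t * psi (t * s).
Proof.
move=> tf; rewrite /fibre_integral.
case: (boolP ((t != 0) && (t != 1))) => [/andP[t0 t1]|_]; last by rewrite mul0r.
have mt := measurable_fibre two0 t.
have tt : test (fibre t) f by rewrite fibreE//; apply: test_closed_sub tf; exact: closed_jd.
have it : cintegrable (nu t) (fibre t) f.
  have [_ rad] := nu_radon nu_spec t0 t1.
  exact: (test_integrable (@omx_hausdorff R F) mt rad tt).
have pE (g : omx F -> cplx R) X : fibre t X -> patch (fun=> 0) (Omega_ (1 : F)) g X = g X.
  by move=> [OX _]; rewrite /patch mem_set.
rewrite (@eq_cint _ _ _ (nu t) _ (patch (fun=> 0) (Omega_ (1 : F)) f) f) -?cintZr//; last exact: pE.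
apply: eq_cint => X hX; rewrite pE//; congr (_ * _).
by move: hX; rewrite fibreE// => -[_ /= jX]; rewrite /phase jX mulrC.
Qed.

Lemma omega_transform_fibres f (s : F) : s != 0 -> test (Omega F) f ->
  omega_transform psi omega f s =
  cint dx setT (fun t : F => fibre_integral nu (restr1 f) t * psi (t * s)).
Proof.
move=> s0 tf; have t1 := test_Omega_ 1 tf.
have tp := test_phase hpsi psiO s0 t1.
have := nu_normalised nu_spec (test_Sc tp).
rewrite (@eq_cint _ _ _ (omega 1) _ _ (fun X => f X * phase psi s X)); last first.
  by move=> X OX; rewrite /patch mem_set.
move=> e; rewrite /omega_transform /transform e; apply: eq_cint => t _.
exact: fibre_integral_phase.
Qed.

End fibres.

Section extension.
Context (R : realType) (F : nonarchLocalFieldType R).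
Hypothesis two0 : (2 : F) != 0.

(** Surjectivity of q, so that a transfer map is determined on all of [S_Spin9]: phi is extended to
    traces near 1 by X -> phi(X / Tr X), and by zero elsewhere. *)
Lemma restr1_onto (phi : omx F -> cplx R) : Sc (Omega_ (1 : F)) phi ->
  exists2 f, Sc (Omega F) f & restr1 f = phi.
Proof.
move=> [phi0 [K [cK KO phiK]] lphi].
have [c c0 c1] := @vabs_small R F 1 ltr01.
pose near1 (X : omx F) : bool := (vabs (jtr X - 1) <= vabs c)%R.
have tr0 (t : F) : vabs (t - 1) <= vabs c -> t != 0.
  move=> h; apply/eqP => t0; move: h; rewrite t0 sub0r vabsN vabs1.
  by rewrite leNgt c1.
pose m (X : omx F) := omx_scale (jtr X)^-1 X.
pose g (X : omx F) : cplx R := (near1 X)%:R * phi (m X).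
have mO X : Omega F X -> near1 X -> Omega_ 1 (m X).
  move=> OX /tr0 X0; split; first by apply: Omega_scale; rewrite ?invr_neq0.
  by rewrite /m jtr_scale ?mulVf//; case: OX.
have cm X : near1 X -> m @ X --> m X.
  move=> /tr0 X0; have hX : (fun Y : omx F => Y) @ nbhs X --> X by [].
  have ht : (fun Y : omx F => (jtr Y)^-1) @ nbhs X --> (jtr X)^-1.
    have hd : (fun r : F => 1 / r) @ (jtr X) --> 1 / jtr X.
      exact: (@continuous_divr R F 1 (oner_neq0 F) _ X0).
    have := @cvg_comp _ _ _ (@jtr F) (fun r : F => 1 / r) _ _ _ (@continuous_jtr R F X) hd.
    rewrite mul1r; have -> // : (fun r : F => 1 / r) \o jtr = fun Y : omx F => (jtr Y)^-1.
    by apply/funext => Y /=; rewrite mul1r.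
  exact: (cvg_omx_scale (nbhs_filter X) ht hX).
have lnear := lc_jtr_ball (A := Omega F) 1 c0.
have tg : test (Omega F) g.
  split=> [X OX|].
    have [nX|nX] := boolP (near1 X); last first.
      apply: filterS (lnear X OX) => Y h OY; rewrite /g /near1 h//.
      by rewrite -/(near1 X) (negPf nX) !mul0r.
    have H : nbhs X (m @^-1` [set Y | Omega_ 1 Y -> phi Y = phi (m X)]).
      exact: cm nX _ (lphi (m X) (mO X OX nX)).
    apply: filterS2 H (lnear X OX) => Y h1 h2 OY.
    have nY : near1 Y by rewrite /near1 h2.
    have e : phi (m Y) = phi (m X) := h1 (mO Y OY nY).
    by rewrite /g nY nX e.
  (* The support lies in the image of ball times K under scaling, compact and contained in [Omega]
     because the ball around 1 avoids 0. *)
  pose sc (z : F * omx F) : omx F := omx_scale z.1 z.2.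
  exists (sc @` (cball 1 c `*` K)); split.
  - apply: continuous_compact; last by apply: compact_setX => //; exact: compact_cball.
    apply: continuous_subspaceT => z.
    exact: (cvg_omx_scale (nbhs_filter z) (@cvg_fst _ _ _ _ _) (@cvg_snd _ _ _ _ _)).
  - move=> _ [[t Y] [/= /tr0 t0 /KO[OY _]] <-]; exact: Omega_scale.
  - move=> X OX nK; rewrite /g; have [nX|_] := boolP (near1 X); last by rewrite mul0r.
    rewrite phiK ?mulr0// => Km; apply: nK; exists (jtr X, m X); first by split.
    by rewrite /sc/= omx_scaleA divff ?omx_scale1//; exact: tr0.
exists (patch (fun=> 0) (Omega F) g); first exact: test_Sc.
apply/funext => X; rewrite /restr1 /patch; case: (boolP (X \in Omega_ 1)) => [/set_mem OX|nO].
  have [OX' X1] := OX; rewrite mem_set// /g /near1 /m X1 subrr vabs0 vabs_ge0 mul1r.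
  by rewrite invr1 omx_scale1.
by rewrite phi0// => OX; move: nO; rewrite mem_set.
Qed.

End extension.

Section transfer_formula.
Context (R : realType) (F : nonarchLocalFieldType R).
Hypothesis two0 : (2 : F) != 0.
Variable pi : F.
Hypothesis pi_unif : is_uniformizer (@vabs R F) pi.
Variables (psi : F -> cplx R) (dx : {measure set (borel F) -> \bar R}).
Hypotheses (hpsi : is_unitary_char psi) (psiO : has_conductor_O psi).
Hypothesis hdx : is_selfdual_haar dx psi.
Variable eta : {measure set (borel (omx F)) -> \bar R}.
Hypothesis eta_spec : is_eta eta.
Variable omega : F -> {measure set (borel (omx F)) -> \bar R}.
Hypothesis omega_spec : is_omega dx eta omega.
Variable nu : F -> {measure set (borel (omx F)) -> \bar R}.
Hypothesis nu_spec : is_fibre_measure dx (omega 1) nu.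

Definition double_fourier (phi : F -> cplx R) (a : F) : cplx R :=
  ((vabs a ^- 3)%:C)%C *
  cint dx setT (fun k : F =>
    cint dx setT (fun t : F => phi t * psi (t * k^-1))
    * psi (k * a^-1) * ((vabs k ^- 4)%:C)%C).

Lemma orbital_integral_double_fourier (f : omx F -> cplx R) (a : F) :
  Sc (Omega F) f -> a != 0 ->
  orbital_integral psi dx pi (whittaker psi dx eta f) a =
  double_fourier (fibre_integral nu (restr1 f)) a.
Proof.
move=> Sf a0; have tf := Sc_test Sf; have haar := hdx.1.
have vol1 := selfdual_volO hpsi psiO hdx.
have iw := omega_kernel_integrable two0 hpsi psiO haar omega_spec a0 tf.
rewrite (orbital_integralE two0 pi_unif hpsi psiO haar vol1 eta_spec omega_spec Sf a0).
rewrite (kernel_inversion haar a0 iw) mulrA -rmorphM.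
have va : vabs a != 0 :> R by rewrite gt_eqF// vabs_gt0.
have -> : vabs a ^- 6 * vabs a ^+ 3 = vabs a ^- 3 by field.
(* The comparison with the Fourier transform on fibres is available for s = 1 / k with k != 0; at k
   = 0 both integrands vanish through |k|^-4. *)
have z (W : F -> cplx R) : W 0^-1 * psi (0 * a^-1) * ((vabs (0 : F) ^- 4)%:C)%C = 0.
  have -> : vabs (0 : F) ^- 4 = 0 :> R by rewrite vabs0 expr0n invr0.
  by rewrite rmorph0 mulr0.
pose W (s : F) := cint dx setT (fun t : F => fibre_integral nu (restr1 f) t * psi (t * s)).
rewrite /double_fourier (cint_neq0 dx (z (omega_transform psi omega f))).
rewrite -[in RHS]/(W _) (cint_neq0 dx (z W)).
congr (_ * _); apply: eq_cint => k /eqP k0; congr (_ * _ * _).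
by apply: (omega_transform_fibres two0 hpsi psiO nu_spec) => //; rewrite invr_neq0.
Qed.

End transfer_formula.

Theorem theorem3p5 (R : realType) (F : nonarchLocalFieldType R)
    (charF0 : [pchar F] =i pred0)
    (pi : F) (pi_uniformizer : is_uniformizer (@vabs R F) pi)
    (psi : F -> cplx R) (psi_char : is_unitary_char psi)
    (psi_conductor : has_conductor_O psi)
    (dx : {measure set (borel F) -> \bar R})
    (dx_selfdual : is_selfdual_haar dx psi)
    (eta : {measure set (borel (omx F)) -> \bar R}) (eta_spec : is_eta eta)
    (omega : F -> {measure set (borel (omx F)) -> \bar R})
    (omega_spec : is_omega dx eta omega)
    (nu : F -> {measure set (borel (omx F)) -> \bar R})
    (nu_spec : is_fibre_measure dx (omega 1) nu) :
  (exists tpsi, is_transfer psi dx eta pi nu tpsi) /\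
  forall tpsi, is_transfer psi dx eta pi nu tpsi ->
    forall phi, S_Spin9 nu phi -> forall a : F, a != 0 ->
      tpsi phi a =
      ((vabs a ^- 3)%:C)%C *
      cint dx setT (fun k : F =>
        cint dx setT (fun t : F => phi t * psi (t * k^-1))
        * psi (k * a^-1) * ((vabs k ^- 4)%:C)%C).
Proof.
have two0 : (2 : F) != 0 by rewrite ((pcharf0P F).1 charF0).
have key f a : Sc (Omega F) f -> a != 0 ->
    orbital_integral psi dx pi (whittaker psi dx eta f) a =
    double_fourier psi dx (fibre_integral nu (restr1 f)) a.
  exact: (orbital_integral_double_fourier two0 pi_uniformizer psi_char psi_conductor
    dx_selfdual eta_spec omega_spec nu_spec).
split.
  (* The formula depends on f only through I'(q f), so it defines a transfer map; the value 0 at a =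
     0 matches the extension by zero in [orbital_integral]. *)
  exists (fun phi a => if a == 0 then 0 else double_fourier psi dx phi a).
  have tE f : Sc (Omega F) f ->
      (fun a => if a == 0 then 0
        else double_fourier psi dx (fibre_integral nu (restr1 f)) a) =
      orbital_integral psi dx pi (whittaker psi dx eta f).
    move=> Sf; apply/funext => a; have [->|a0] := eqVneq a 0; last by rewrite key.
    by rewrite /orbital_integral eqxx.
  split=> // _ [phi /(restr1_onto two0)[f Sf <-] <-].
  rewrite (tE f Sf); exists (whittaker psi dx eta f) => //.
  by exists f.
move=> tpsi [_ tE] _ [phi /(restr1_onto two0)[f Sf <-] <-] a a0.
by rewrite (tE f Sf) (key f a Sf a0).
Qed.
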